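(* Let $(X,\mu)$ be a standard atomless probability space and let $T\in\mathrm{Aut}(X,[\mu])$ be ergodic. Then the topological derived subgroup $\overline{D([T]_{\mathrm{com}})}$ of the commensurating full group of $T$ is a bounded Polish group.
   Context: $\mathrm{Aut}(X,[\mu])$ is the group of measurable bijections $T:X\to X$ such that $T_*\mu$ and $\mu$ have the same null sets, two such maps being identified if they agree almost everywhere. $T$ is ergodic if every $T$-invariant Borel set is null or conull; $T$ is aperiodic if almost every $T$-orbit is infinite (ergodic transformations are aperiodic since $\mu$ is atomless). Let $T\in\mathrm{Aut}(X,[\mu])$ be aperiodic. The full group $[T]$ is the group of $S\in\mathrm{Aut}(X,[\mu])$ such that for a.e. $x$, $S(x)=T^{c_S(x)}(x)$ for some integer $c_S(x)$; the a.e. uniquely defined measurable map $c_S:X\to\mathbb Z$ is the cocycle of $S$. Let $\mathrm{Sym}(\mathbb Z,\mathbb N)$ be the group of permutations $\sigma$ of $\mathbb Z$ with $|\sigma(\mathbb N)\triangle\mathbb N|<\infty$, with the group topology for which a basis of neighborhoods of the identity is given by the pointwise stabilizers of finite subsets of $\mathrm{Comm}(\mathbb N)=\{M\subset\mathbb Z: |M\triangle\mathbb N|<\infty\}$. For $S\in[T]$, $x\in X$, define the permutation $\Phi(S)(x)$ of $\mathbb Z$ by $\Phi(S)(x)(n)=n+c_S(T^n(x))$. The commensurating full group is $$[T]_{\mathrm{com}}=\{S\in[T]:\ \Phi(S)(x)\in\mathrm{Sym}(\mathbb Z,\mathbb N)\text{ for a.e. }x\},$$ endowed with the topology pulled back by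 $\Phi$ from $\mathrm L^0(X,\mu,\mathrm{Sym}(\mathbb Z,\mathbb N))$, the group (under pointwise multiplication) of measurable maps $X\to\mathrm{Sym}(\mathbb Z,\mathbb N)$ modulo a.e. equality, with the topology of convergence in measure. With this topology it is a Polish group. $\overline{D([T]_{\mathrm{com}})}$ is the closure in $[T]_{\mathrm{com}}$ of its derived subgroup, with the induced topology. A compatible left-invariant metric $d$ on a Polish group $G$ is maximal if for any other compatible left-invariant metric $d'$ on $G$ there is a constant $C>0$ with $d'(g,h)\le C\,d(g,h)+C$ for all $g,h\in G$. $G$ is bounded if some (equivalently any) bounded compatible left-invariant metric on $G$ is maximal; that is, every compatible left-invariant metric on $G$ is bounded. *)

(* Defs.v *)
From HB Require Import structures.
From mathcomp Require Import all_boot all_order all_algebra.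
From mathcomp Require Import all_classical all_reals all_analysis.

Set Implicit Arguments.
Unset Strict Implicit.
Unset Printing Implicit Defensive.

Import Order.TTheory GRing.Theory Num.Theory.

Local Open Scope classical_set_scope.
Local Open Scope ring_scope.

Section metrics.
Context {R : realType} {T : Type}.
Implicit Type d : T -> T -> R.

Definition is_metric d : Prop :=
  [/\ forall x y, d x y = 0 <-> x = y,
      forall x y, d x y = d y x &
      forall x y z, d x z <= d x y + d y z].

Definition metric_open d : set (set T) :=
  [set U | forall x, U x ->
    exists2 e : R, 0 < e & forall y, d x y < e -> U y].

Definition metric_complete d : Prop :=
  forall u : nat -> T,
    (forall e : R, 0 < e -> exists N, forall m n,
      (N <= m)%N -> (N <= n)%N -> d (u m) (u n) < e) ->
    exists l, forall e : R, 0 < e -> exists N, forall n,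
      (N <= n)%N -> d (u n) l < e.

Definition metric_separable d : Prop :=
  exists2 Q : set T, countable Q &
    forall x (e : R), 0 < e -> exists2 q, Q q & d x q < e.

Definition polish_metric d : Prop :=
  [/\ is_metric d, metric_complete d & metric_separable d].

End metrics.

Definition compatible_metric {R : realType} (T : topologicalType)
    (d : T -> T -> R) : Prop :=
  is_metric d /\ @open T = metric_open d.

Definition polish_space (R : realType) (T : topologicalType) : Prop :=
  exists2 d : T -> T -> R, compatible_metric d & polish_metric d.

Definition standard_borel (R : realType) {disp : measure_display}
    (X : measurableType disp) : Prop :=
  exists2 d : X -> X -> R, polish_metric d &
    @measurable disp X = <<s metric_open d >>.

Section subgroups.
Variable G : groupType.

Definition is_subgroup (H : set G) : Prop :=
  [/\ H 1%g,
      forall x y, H x -> H y -> H (x * y)%g &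
      forall x, H x -> H x^-1%g].

Record subgroup := Subgroup {
  subgroup_set :> set G;
  subgroupP : is_subgroup subgroup_set }.

Definition subgroup_type (H : subgroup) : Type := set_type H.

Definition derived_subgroup : set G :=
  smallest is_subgroup [set z | exists x y : G, z = [~ x, y]%g].

Definition expgz (x : G) (k : int) : G :=
  match k with Posz n => (x ^+ n)%g | Negz n => (x ^- n.+1)%g end.

End subgroups.
Arguments derived_subgroup : clear implicits.

Section subgroup_group.
Variables (G : groupType) (H : subgroup G).

HB.instance Definition _ := SubChoice.copy (subgroup_type H) (set_type H).

Lemma subgroup_closed : group_closed (mem (H : set G)).
Proof.
case: (subgroupP H) => H1 HM HV; split; first exact/mem_set.
by move=> x y /set_mem Hx /set_mem Hy; apply/mem_set/HM => //; exact: HV.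
Qed.

HB.instance Definition _ :=
  SubChoice_isSubGroup.Build G (mem (H : set G)) (subgroup_type H) subgroup_closed.

End subgroup_group.

(** A group carrying a topology; that the operations are continuous is the
    separate predicate [topological_group]. *)
#[short(type="groupTopologyType")]
HB.structure Definition GroupTopology := {G of Group G & Topological G}.

HB.instance Definition _ (G : groupTopologyType) (H : subgroup G) :=
  Topological.copy (subgroup_type H)
    (initial_topology (val : subgroup_type H -> G)).

Definition topological_group (G : groupTopologyType) : Prop :=
  continuous (fun p : (G * G)%type => (p.1 * p.2)%g) /\
  continuous (fun x : G => (x^-1)%g).

Definition polish_group (R : realType) (G : groupTopologyType) : Prop :=
  topological_group G /\ polish_space R G.

Section bounded_groups.
Context {R : realType} {G : groupTopologyType}.
Implicit Type d : G -> G -> R.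

Definition left_invariant d : Prop :=
  forall g h k : G, d (g * h)%g (g * k)%g = d h k.

Definition maximal_metric d : Prop :=
  [/\ compatible_metric d, left_invariant d &
   forall d', compatible_metric d' -> left_invariant d' ->
     exists2 C : R, 0 < C & forall g h, d' g h <= C * d g h + C].

Definition bounded_metric d : Prop := exists M : R, forall g h, d g h <= M.

End bounded_groups.

Definition bounded_group (R : realType) (G : groupTopologyType) : Prop :=
  exists2 d : G -> G -> R, bounded_metric d & maximal_metric d.

Record bij (T : Type) := Bij {
  bij_fun :> T -> T;
  bij_inv : T -> T;
  bij_funK : cancel bij_fun bij_inv;
  bij_invK : cancel bij_inv bij_fun }.

Section bij_group.
Variable T : Type.
Implicit Types f g h : bij T.

Lemma bijP f g : f =1 g -> f = g.
Proof.
case: f g => [f f' fK f'K] [g g' gK g'K] /= /funext fg; subst g.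
have e : f' = g' by apply/funext => x; rewrite -[in LHS](g'K x) fK.
by subst g'; congr Bij; exact: Prop_irrelevance.
Qed.

HB.instance Definition _ := gen_eqMixin (bij T).
HB.instance Definition _ := gen_choiceMixin (bij T).

Definition bij_id : bij T := @Bij T id id (fun=> erefl) (fun=> erefl).
Definition bij_comp f g : bij T :=
  Bij (can_comp (bij_funK f) (bij_funK g)) (can_comp (bij_invK g) (bij_invK f)).
Definition bij_sym f : bij T := Bij (bij_invK f) (bij_funK f).

Lemma bij_compA : associative bij_comp. Proof. by move=> *; exact: bijP. Qed.
Lemma bij_comp1g : left_id bij_id bij_comp. Proof. by move=> *; exact: bijP. Qed.
Lemma bij_compg1 : right_id bij_id bij_comp. Proof. by move=> *; exact: bijP. Qed.
Lemma bij_compVg : left_inverse bij_id bij_sym bij_comp.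
Proof. by move=> f; apply: bijP => x; exact: bij_funK. Qed.
Lemma bij_compgV : right_inverse bij_id bij_sym bij_comp.
Proof. by move=> f; apply: bijP => x; exact: bij_invK. Qed.

HB.instance Definition _ := isGroup.Build (bij T)
  bij_compA bij_comp1g bij_compg1 bij_compVg bij_compgV.

Lemma bijM f g x : (f * g)%g x = f (g x). Proof. by []. Qed.
Lemma bijV f x : (f^-1)%g x = bij_inv f x. Proof. by []. Qed.

End bij_group.

Definition natZ : set int := [set n | 0 <= n].

Definition commN : set (set int) := [set M | finite_set (M `+` natZ)].

Lemma commN_natZ : commN natZ.
Proof. by rewrite /commN /mkset setYK. Qed.

Lemma commN_image (s : bij int) (M : set int) :
  commN (s @` natZ) -> commN M -> commN (s @` M).
Proof.
rewrite /commN /= => sN MN.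
have: finite_set (s @` (M `+` natZ) `|` (s @` natZ `+` natZ)).
  by rewrite finite_setU; split=> //; exact: finite_image.
apply: sub_finite_set => y [[[x Mx <-] nNx]|[Ny sMy]].
- have [Nx|nNx'] := pselect (natZ x); last by left; exists x => //; left.
  by right; left; split=> //; exists x.
- have [[x Nx xy]|sNy] := pselect ((s @` natZ) y); last by right; right.
  by left; exists x => //; right; split=> // Mx; apply: sMy; exists x.
Qed.

Lemma symZN_subgroup : is_subgroup [set s : bij int | commN (s @` natZ)].
Proof.
split=> [|s t /= sN tN|s /= sN].
- by rewrite /= (image_id natZ); exact: commN_natZ.
- have -> : (s * t)%g @` natZ = s @` (t @` natZ) by rewrite image_comp.
  exact: commN_image.
- have : finite_set ((s^-1)%g @` (s @` natZ `+` natZ)) by exact: finite_image.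
  apply: sub_finite_set => y [[[x Nx <-] nNx]|[Ny sNy]].
  + exists x => //; right; split=> // -[z Nz zx]; apply: nNx.
    by rewrite -zx [X in natZ X]bij_funK.
  + exists (s y); last exact: bij_funK.
    left; split; first by exists y.
    by move=> Nsy; apply: sNy; exists (s y) => //; exact: bij_funK.
Qed.

(** Permutations [s] of Z such that [s(N)] is commensurate to [N]. *)
Definition symZN : Type := subgroup_type (Subgroup symZN_subgroup).
HB.instance Definition _ := Group.on symZN.

Definition symZN_fun (s : symZN) : int -> int := val s.
Coercion symZN_fun : symZN >-> Funclass.

Definition stabilizer (F : set (set int)) : set symZN :=
  [set s | forall M, F M -> s @` M = M].

(** The group topology in which the pointwise stabilizers of the finite subsets
    of [commN] are a basis of neighborhoods of the identity. *)
Definition symZN_open : set (set symZN) :=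
  [set O | forall s : symZN, O s ->
    exists F : set (set int), [/\ finite_set F, F `<=` commN &
      forall t, stabilizer F t -> O (s * t)%g]].

Lemma symZN_openT : symZN_open setT.
Proof. by move=> s _; exists set0; split=> //; exact: sub0set. Qed.

Lemma symZN_openI : setI_closed symZN_open.
Proof.
move=> A B oA oB s [/oA[F [fF cF FA]] /oB[K [fK cK KB]]].
exists (F `|` K); split; first by rewrite finite_setU.
- by move=> M [/cF|/cK].
- by move=> t st; split; [apply: FA|apply: KB] => M ?; apply: st;
    [left|right].
Qed.

Lemma symZN_open_bigU (I : Type) (f : I -> set symZN) :
  (forall i, symZN_open (f i)) -> symZN_open (\bigcup_i f i).
Proof.
move=> fo s [i _ /fo[F [fF cF FA]]]; exists F; split=> // t /FA ft.
by exists i.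
Qed.

HB.instance Definition _ := isOpenTopological.Build symZN
  symZN_openT symZN_openI symZN_open_bigU.

Definition borel_type (G : groupTopologyType) : Type := G.

Section borel_structure.
Variable G : groupTopologyType.
HB.instance Definition _ := Choice.on (borel_type G).
HB.instance Definition _ := isPointed.Build (borel_type G) (1%g : G).
HB.instance Definition _ := @isMeasurable.Build (sigma_display (@open G))
  (borel_type G) <<s @open G >> (@sigma_algebra0 _ setT (@open G))
  (@sigma_algebraC (borel_type G) (@open G))
  (@sigma_algebra_bigcup _ setT (@open G)).
End borel_structure.

Section L0.
Context {disp : measure_display} {X : measurableType disp} {R : realType}.
Variables (mu : {measure set X -> \bar R}) (G : groupTopologyType).

(** Classes, modulo [mu]-a.e. equality, of Borel measurable maps. *)
Definition L0 : Type := {mfun_ mu, X >-> borel_type G}.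
HB.instance Definition _ := Choice.on L0.
HB.instance Definition _ := EqQuotient.on L0.

Definition L0_fun (f : L0) : X -> G := repr f.

(** [g] belongs to [L0_nbhd f U e] iff the set of [x] such that
    [f(x)^-1 g(x)] is not in [U] has (outer) measure less than [e]. *)
Definition L0_nbhd (f : L0) (U : set G) (e : R) : set L0 :=
  [set g | exists A, [/\ measurable A, (mu A < e%:E)%E &
    forall x, ~ A x -> U ((L0_fun f x)^-1 * L0_fun g x)%g]].

Definition L0_open : set (set L0) :=
  [set O | forall f, O f -> exists U, exists2 e : R,
    nbhs (1%g : G) U /\ 0 < e & L0_nbhd f U e `<=` O].

Lemma L0_openT : L0_open setT.
Proof. by move=> f _; exists setT, 1 => //; split=> //; exact: filterT. Qed.

Lemma L0_openI : setI_closed L0_open.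
Proof.
move=> A B oA oB f [/oA[U [d [nU d0] UA]] /oB[V [e [nV e0] VB]]].
exists (U `&` V), (Num.min d e).
  by split; [exact: filterI|rewrite lt_min d0].
move=> g [D [mD Dde UV]]; split; [apply: UA|apply: VB]; exists D; split=> //.
- by rewrite (lt_le_trans Dde)// lee_fin ge_min lexx.
- by move=> x /UV[].
- by rewrite (lt_le_trans Dde)// lee_fin ge_min lexx orbT.
- by move=> x /UV[].
Qed.

Lemma L0_open_bigU (I : Type) (F : I -> set L0) :
  (forall i, L0_open (F i)) -> L0_open (\bigcup_i F i).
Proof.
move=> Fo f [i _ /Fo[U [e Ue UF]]]; exists U, e => // g /UF Fg.
by exists i.
Qed.

HB.instance Definition _ := isOpenTopological.Build L0
  L0_openT L0_openI L0_open_bigU.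

End L0.

Section nonsingular.
Context {disp : measure_display} {X : measurableType disp} {R : realType}.
Variable mu : probability X R.

Definition nonsingular (f : bij X) : Prop :=
  [/\ measurable_fun setT f, measurable_fun setT (bij_inv f) &
      forall A, measurable A -> pushforward mu f A = 0 <-> mu A = 0].

Lemma nonsingular_subgroup : is_subgroup [set f | nonsingular f].
Proof.
split=> [|f g [mf mf' nf] [mg mg' ng]|f [mf mf' nf]].
- by split; [exact: measurable_id|exact: measurable_id|].
- split; [exact: measurableT_comp|exact: measurableT_comp|].
  move=> A mA; rewrite -(nf _ mA) -[X in _ <-> X]ng//.
  by rewrite -[X in measurable X]setTI; exact: mf.
- split=> // A mA; rewrite -[X in X <-> _]nf; last first.
    by rewrite -[X in measurable X]setTI; exact: mf'.
  by rewrite /pushforward -comp_preimage (_ : _ \o _ = id)//;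
    apply/funext => x; exact: bij_funK.
Qed.

(** Representatives of elements of Aut(X, [mu]). Measurability of the inverse is
    automatic on a standard Borel space (Lusin-Souslin). *)
Definition nonsing : Type := subgroup_type (Subgroup nonsingular_subgroup).
HB.instance Definition _ := Group.on nonsing.

Definition nonsing_fun (f : nonsing) : X -> X := val f.
Coercion nonsing_fun : nonsing >-> Funclass.

Implicit Types f g h : nonsing.

Lemma nonsingP f : nonsingular (val f).
Proof. by have /set_mem := valP f. Qed.

Lemma nonsingM f g x : (f * g : nonsing)%g x = f (g x). Proof. by []. Qed.

Lemma nonsing1 x : (1%g : nonsing) x = x. Proof. by []. Qed.

Lemma nonsingVK f x : (f^-1 : nonsing)%g (f x) = x.
Proof. by rewrite -nonsingM mulVg. Qed.

Lemma nonsingKV f x : f ((f^-1 : nonsing)%g x) = x.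
Proof. by rewrite -nonsingM mulgV. Qed.

Lemma nonsing_measurable f : measurable_fun setT f.
Proof. by have [] := nonsingP f. Qed.

Lemma ae_nonsing f (P : X -> Prop) :
  (\forall x \ae mu, P x) -> \forall x \ae mu, P (f x).
Proof.
have [mf _ nf] := nonsingP f; move=> [N [mN N0 PN]].
exists (f @^-1` N); split; last by move=> x /= nP; exact: PN.
- by rewrite -[X in measurable X]setTI; exact: mf.
- exact/(nf _ mN).
Qed.

Lemma ae_all (I : countType) (P : I -> X -> Prop) :
  (forall i, \forall x \ae mu, P i x) -> \forall x \ae mu, forall i, P i x.
Proof.
move=> aP.
pose F k := if unpickle k is Some i then ~` [set x | P i x] else set0.
have : mu.-negligible (\bigcup_k F k).
  apply: negligible_bigcup => k; rewrite /F.
  by case: (unpickle k) => [i|]; [exact: aP|exact: negligible_set0].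
apply: negligibleS => x /= /existsNP[i nP].
by exists (pickle i) => //; rewrite /F pickleK.
Qed.

Definition nonsing_rel f g : bool := `[< \forall x \ae mu, f x = g x >].

Lemma nonsing_rel_refl : reflexive nonsing_rel.
Proof. by move=> f; apply/asboolP/aeW. Qed.

Lemma nonsing_rel_sym : symmetric nonsing_rel.
Proof.
by move=> f g; apply/asboolP/asboolP; apply: filterS => x.
Qed.

Lemma nonsing_rel_trans : transitive nonsing_rel.
Proof.
move=> g f h /asboolP fg /asboolP gh; apply/asboolP.
by move: fg gh; apply: filterS2 => x ->.
Qed.

Canonical nonsing_rel_equiv :=
  EquivRel nonsing_rel nonsing_rel_refl nonsing_rel_sym nonsing_rel_trans.

Local Open Scope quotient_scope.

Definition aut : Type := {eq_quot nonsing_rel}.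
HB.instance Definition _ := Choice.on aut.
HB.instance Definition _ := EqQuotient.on aut.

Definition aut_repr (S : aut) : nonsing := repr S.
Coercion aut_repr : aut >-> nonsing.

Lemma pi_autP f g : \pi_aut f = \pi_aut g <-> \forall x \ae mu, f x = g x.
Proof.
split=> [/eqP|fg]; first by rewrite eqmodE => /asboolP.
by apply/eqP; rewrite eqmodE; exact/asboolP.
Qed.

Lemma autP (S S' : aut) : S = S' <-> \forall x \ae mu, S x = S' x.
Proof. by rewrite -pi_autP !reprK. Qed.

Lemma aut_pi f : \forall x \ae mu, (\pi_aut f : aut) x = f x.
Proof. by apply/pi_autP; rewrite reprK. Qed.

Definition aut_one : aut := \pi_aut 1%g.
Definition aut_mul (S S' : aut) : aut := \pi_aut (repr S * repr S')%g.
Definition aut_inv (S : aut) : aut := \pi_aut (repr S)^-1%g.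

Lemma pi_aut_mul f g : aut_mul (\pi_aut f) (\pi_aut g) = \pi_aut (f * g)%g.
Proof.
apply/pi_autP; have := ae_nonsing (aut_repr (\pi_aut g)) (aut_pi f).
move: (aut_pi g); apply: filterS2 => x gx fx.
by rewrite !nonsingM -gx; exact: fx.
Qed.

Lemma pi_aut_inv f : aut_inv (\pi_aut f) = \pi_aut (f^-1)%g.
Proof.
apply/pi_autP; have := ae_nonsing (f^-1)%g (aut_pi f).
apply: filterS => y; rewrite nonsingKV => e.
by rewrite -[in LHS]e nonsingVK.
Qed.

Lemma aut_mulA : associative aut_mul.
Proof.
move=> S1 S2 S3; rewrite -[S1]reprK -[S2]reprK -[S3]reprK.
by rewrite !pi_aut_mul !reprK mulgA.
Qed.
Lemma aut_mul1 : left_id aut_one aut_mul.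
Proof. by move=> S; rewrite -[S]reprK pi_aut_mul mul1g. Qed.
Lemma aut_mulr1 : right_id aut_one aut_mul.
Proof. by move=> S; rewrite -[S]reprK pi_aut_mul mulg1. Qed.
Lemma aut_mulV : left_inverse aut_one aut_inv aut_mul.
Proof. by move=> S; rewrite -[S]reprK pi_aut_inv pi_aut_mul mulVg. Qed.
Lemma aut_mulrV : right_inverse aut_one aut_inv aut_mul.
Proof. by move=> S; rewrite -[S]reprK pi_aut_inv pi_aut_mul mulgV. Qed.

HB.instance Definition _ := isGroup.Build aut
  aut_mulA aut_mul1 aut_mulr1 aut_mulV aut_mulrV.

Lemma autM (S S' : aut) : \forall x \ae mu, (S * S' : aut)%g x = S (S' x).
Proof. exact: aut_pi. Qed.

Lemma autV (S : aut) : \forall x \ae mu, (S^-1 : aut)%g x = ((aut_repr S)^-1 : nonsing)%g x.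
Proof. exact: aut_pi. Qed.

End nonsingular.

Section measurable_symZN.
Context {disp : measure_display} {X : measurableType disp}.

Lemma measurable_exists (I : countType) (P : I -> X -> Prop) :
  (forall i, measurable [set x | P i x]) -> measurable [set x | exists i, P i x].
Proof.
move=> mP; rewrite (_ : mkset _ = \bigcup_i [set x | P i x]).
  by apply: countable_bigcupT_measurable => //; exact: countableP.
by apply/seteqP; split=> x [i]; [exists i|move=> _; exists i].
Qed.

Lemma measurable_not (P : X -> Prop) :
  measurable [set x | P x] -> measurable [set x | ~ P x].
Proof. by move=> mP; exact: measurableC. Qed.

Lemma measurable_forall (I : countType) (P : I -> X -> Prop) :
  (forall i, measurable [set x | P i x]) -> measurable [set x | forall i, P i x].
Proof.
move=> mP; rewrite (_ : mkset _ = [set x | ~ exists i, ~ P i x]).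
  by apply: measurable_not; apply: measurable_exists => i; exact: measurable_not.
apply/seteqP; split=> x /= Px; first by move=> [i]; exact.
by move=> i; apply: contrapT => nP; apply: Px; exists i.
Qed.

Lemma measurable_const (P : Prop) : measurable [set _ : X | P].
Proof.
have [p|np] := pselect P.
- by rewrite (_ : mkset _ = setT)//; apply/seteqP; split.
- by rewrite (_ : mkset _ = set0)//; apply/seteqP; split.
Qed.

Lemma measurable_iff (P Q : X -> Prop) : measurable [set x | P x] ->
  measurable [set x | Q x] -> measurable [set x | P x <-> Q x].
Proof.
move=> mP mQ; rewrite (_ : mkset _ = ([set x | P x] `&` [set x | Q x]) `|`
    ([set x | ~ P x] `&` [set x | ~ Q x])).
  by apply: measurableU; apply: measurableI => //; exact: measurable_not.
apply/seteqP; split=> x /= [].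
- by move=> PQ QP; have [/[dup]/PQ|nP] := pselect (P x); [left|right];
    split=> // /QP.
- by move=> [].
- by move=> [].
Qed.

Definition seqcomm (s : seq int) : set int := natZ `+` [set` s].

Lemma setY_K (A B : set int) : B `+` (B `+` A) = A.
Proof. by rewrite setYA setYK set0Y. Qed.

Lemma seqcommP (M : set int) : commN M -> exists s, M = seqcomm s.
Proof.
move=> /finite_seqP[s sE]; exists s.
by rewrite /seqcomm -sE setYC setYC -(setYC natZ) setY_K.
Qed.

Lemma commN_seqcomm s : commN (seqcomm s).
Proof.
rewrite /commN /mkset /seqcomm (setYC natZ) -setYA setYK setY0.
exact: finite_seq.
Qed.

Definition in_symZN (p : int -> int) : Prop :=
  exists s : symZN, forall n, s n = p n.

Lemma in_symZNP (p : int -> int) : in_symZN p <->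
  [/\ forall m n, p m = p n -> m = n,
      forall m, exists n, p n = m &
      exists s, forall n, (seqcomm s) (p n) <-> natZ n].
Proof.
split=> [[s sp]|[pI pS [s sE]]].
  have {}sp : p = s by apply/funext => n; rewrite sp.
  split=> [m n|m|]; rewrite sp.
  - exact: (can_inj (bij_funK (val s))).
  - by exists (bij_inv (val s) m); exact: bij_invK.
  - have /set_mem/seqcommP[t tE] := valP s; exists t => n; rewrite -tE.
    split=> [[m Nm]|Nn]; last by exists n.
    by move/(can_inj (bij_funK (val s))) => <-.
pose q m := sval (cid (pS m)).
have qK : cancel q p by move=> m; rewrite /q; case: cid.
have pK : cancel p q by move=> m; apply: pI; rewrite qK.
have pN : [set s : bij int | commN (s @` natZ)] (Bij pK qK).
  rewrite /mkset (_ : _ @` natZ = seqcomm s); first exact: commN_seqcomm.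
  apply/seteqP; split=> [_ [n Nn <-]|m sm]; first exact/sE.
  by exists (q m); [apply/sE; rewrite qK|exact: qK].
by exists (exist _ (Bij pK qK) (mem_set pN)).
Qed.

Lemma measurable_to_symZN (f : X -> borel_type symZN) :
  (forall m n : int, measurable [set x | (f x : symZN) m = n]) ->
  measurable_fun setT f.
Proof.
move=> mf; apply: (@measurability _ _ X (borel_type symZN) setT f (@open symZN)) => //.
move=> _ [V oV <-]; rewrite setTI.
pose J (l : seq (seq int * seq int)) (s : symZN) :=
  forall i, i \in l -> forall n, seqcomm i.2 (s n) <-> seqcomm i.1 n.
have -> : f @^-1` V =
    [set x | exists l, (J l `<=` V) /\ J l (f x)].
  apply/seteqP; split=> x /=; last by move=> [l [lV]] /lV.
  have /= Vo : symZN_open V by [].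
  move=> /Vo[F [fF cF FV]].
  have {}cF M : exists s, F M -> M = seqcomm s.
    have [FM|] := pselect (F M); last by exists [::].
    by have [s ->] := seqcommP (cF _ FM); exists s.
  have cS (M : set int) : exists s, F M -> (f x : symZN) @` M = seqcomm s.
    have [FM|] := pselect (F M); last by exists [::].
    have [s Ms] := cF M; have /set_mem fx := valP (f x : symZN).
    have cM : commN M by rewrite Ms//; exact: commN_seqcomm.
    by have [t tE] := seqcommP (commN_image fx cM); exists t.
  have {fF}/finite_seqP[l lE] := fF.
  pose g M := (sval (cid (cF M)), sval (cid (cS M))).
  have gP M : F M -> M = seqcomm (g M).1 /\ (f x : symZN) @` M = seqcomm (g M).2.
    by move=> FM; split; [exact: svalP (cid (cF M)) FM|exact: svalP (cid (cS M)) FM].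
  exists (map g l); split.
    move=> t Jt; have -> : t = ((f x : symZN) * ((f x : symZN)^-1 * t))%g.
      by rewrite mulgA mulgV mul1g.
    apply: FV => M FM.
    have Ml : g M \in map g l by apply: map_f; rewrite lE in FM.
    have {}Jt := Jt _ Ml.
    have [Ms fM] := gP M FM.
    have tM : t @` M = (f x : symZN) @` M.
      rewrite fM; apply/seteqP; split=> [_ [n Mn <-]|m sm].
        by apply/Jt; rewrite -Ms.
      exists (bij_inv (val t) m); last exact: bij_invK.
      by rewrite Ms; apply/Jt; rewrite [symZN_fun _ _]bij_invK.
    have e : ((f x : symZN)^-1 * t : symZN)%g @` M = bij_inv (val (f x : symZN)) @` (t @` M).
      by rewrite image_comp.
    rewrite [LHS]e tM image_comp (_ : _ \o _ = id) ?image_id//.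
    by apply/funext => n; exact: bij_funK.
  move=> _ /mapP[M Ml ->] n; have FM : F M by rewrite lE.
  have [<- <-] := gP M FM.
  split=> [[m Mm]|Mn]; last by exists n.
  by move/(can_inj (bij_funK (val (f x : symZN)))) => <-.
apply: measurable_exists => l.
apply: (@measurableI _ _ [set _ | J l `<=` V] [set x | J l (f x)]).
  exact: measurable_const.
apply: measurable_forall => i.
have [il|nl] := boolP (i \in l); last first.
  by rewrite (_ : mkset _ = setT)//; apply/seteqP; split.
rewrite (_ : mkset _ = [set x | forall n, seqcomm i.2 ((f x : symZN) n) <->
    seqcomm i.1 n]); last by apply/seteqP; split=> x /= h; [exact: h|move=> _].
apply: measurable_forall => n; apply: measurable_iff.
  rewrite (_ : mkset _ = [set x | exists m : int,
      [set _ : X | seqcomm i.2 m] x /\ (f x : symZN) n = m]).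
    apply: measurable_exists => m; apply: measurableI; last exact: mf.
    exact: measurable_const.
  apply/seteqP; split=> x /= => [h|[m [h ->//]]].
  by exists ((f x : symZN) n).
exact: measurable_const.
Qed.

End measurable_symZN.

Section expgz_theory.
Variable G : groupType.
Implicit Type x : G.

Lemma expgzS x k : expgz x (k + 1) = (x * expgz x k)%g.
Proof.
case: k => [n|[|n]].
- by rewrite -PoszD addn1 /= expgS.
- by rewrite /= expg1 mulgV.
- have -> : Negz n.+1 + 1 = Negz n by rewrite !NegzE -addn1 PoszD opprD subrK.
  by rewrite /= (expgSr x n.+1) invgM mulgA mulgV mul1g.
Qed.

Lemma expgzD x j k : expgz x (j + k) = (expgz x j * expgz x k)%g.
Proof.
elim/int_ind: j => [|n IH|n IH].
- by rewrite add0r /= mul1g.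
- by rewrite -addn1 PoszD -addrA (addrC 1) addrA !expgzS IH mulgA.
- have e : forall i, expgz x (i - 1) = (x^-1 * expgz x i)%g.
    by move=> i; rewrite -[in RHS](subrK 1 i) expgzS mulgA mulVg mul1g.
  by rewrite -addn1 PoszD opprD addrAC !e IH mulgA.
Qed.

Lemma expgzN x k : expgz x (- k) = ((expgz x k)^-1)%g.
Proof.
have e : (expgz x (- k) * expgz x k)%g = 1%g by rewrite -expgzD addNr.
by rewrite -[LHS]mulg1 -(mulgV (expgz x k)) mulgA e mul1g.
Qed.

End expgz_theory.

Definition atomless {disp : measure_display} {X : measurableType disp}
    {R : realType} (mu : {measure set X -> \bar R}) : Prop :=
  forall A, measurable A -> (0 < mu A)%E ->
    exists B, [/\ measurable B, B `<=` A, (0 < mu B)%E & (mu B < mu A)%E].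

Section commensurating_full_group.
Context {disp : measure_display} {X : measurableType disp} {R : realType}.
Context {mu : probability X R}.

(** An element of [aut mu] coerces to one of its representatives; all the
    notions below do not depend on the choice of representatives. *)
Definition ergodic (T : aut mu) : Prop :=
  forall A, measurable A -> T @^-1` A = A -> mu A = 0 \/ mu (~` A) = 0.

Variable T : aut mu.

Definition aut_pow (k : int) : nonsing mu := expgz (aut_repr T) k.

Definition full_group : set (aut mu) :=
  [set S : aut mu | \forall x \ae mu, exists k, S x = aut_pow k x].

Definition is_cocycle (S : aut mu) (c : X -> int) : Prop :=
  (forall k, measurable (c @^-1` [set k])) /\
  \forall x \ae mu, S x = aut_pow (c x) x.

Definition cocycle_perm (c : X -> int) (x : X) (n : int) : int :=
  n + c (aut_pow n x).

(** When [T] is aperiodic the cocycle of [S] is unique up to a null set, so that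
    "some cocycle" below means "the cocycle". *)
Definition com_full_group : set (aut mu) :=
  [set S | full_group S /\ exists c, is_cocycle S c /\
    \forall x \ae mu, in_symZN (cocycle_perm c x)].

Lemma aut_powD j k x : aut_pow (j + k) x = aut_pow j (aut_pow k x).
Proof. by rewrite /aut_pow expgzD. Qed.

Lemma aut_powNK k x : aut_pow (- k) (aut_pow k x) = x.
Proof. by rewrite -aut_powD addNr. Qed.

Lemma cocycle_full S c : is_cocycle S c -> full_group S.
Proof. by move=> [_]; apply: filterS => x e; exists (c x). Qed.

Lemma measurable_cocycle S c k (f : nonsing mu) :
  is_cocycle S c -> measurable [set x | c (f x) = k].
Proof.
move=> [mc _]; rewrite -[X in measurable X]setTI.
exact: (nonsing_measurable f measurableT (mc k)).
Qed.

Lemma cocycle_orbit S c : is_cocycle S c ->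
  \forall x \ae mu, forall n, S (aut_pow n x) = aut_pow (cocycle_perm c x n) x.
Proof.
move=> [_ Sc]; apply: ae_all => n.
have := ae_nonsing (aut_pow n) Sc; apply: filterS => x ->.
by rewrite /cocycle_perm addrC aut_powD.
Qed.

Lemma com_full_group_subgroup : is_subgroup com_full_group.
Proof.
suff [c1 cM cV] : is_subgroup [set S | exists c, is_cocycle S c /\
    \forall x \ae mu, in_symZN (cocycle_perm c x)].
  have full S : (exists c, is_cocycle S c /\
      \forall x \ae mu, in_symZN (cocycle_perm c x)) -> com_full_group S.
    by move=> [c [cS cN]]; split; [exact: cocycle_full cS|exists c].
  split=> [|S S' [_ cS] [_ cS']|S [_ cS]]; apply: full => //.
  - exact: cM.
  - exact: cV.
split=> [|S S' [c [cS cN]] [c' [cS' cN']]|S [c [cS cN]]].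
- exists (fun=> 0); split.
    split=> [k|]; first exact: (measurable_const (0 = k)).
    by have := aut_pi (1%g : nonsing mu); apply: filterS => x ->.
  by apply: aeW => x; exists 1%g => n; rewrite /cocycle_perm addr0.
- exists (fun x => c (aut_repr S' x) + c' x); split.
    split=> [k|].
      rewrite (_ : _ @^-1` _ =
          [set x | exists m, c (aut_repr S' x) = m /\ c' x = k - m]).
        apply: measurable_exists => m.
        apply: (@measurableI _ _ [set x | c (aut_repr S' x) = m] [set x | c' x = k - m]).
          exact: measurable_cocycle cS.
        exact: cS'.1.
      apply/seteqP; split=> x /= [].
        by move=> <-; exists (c (aut_repr S' x)); split; rewrite // (addrC (c _)) addrK.
      by move=> m [-> ->]; rewrite addrC subrK.
    have := ae_nonsing (aut_repr S') cS.2; move: (autM S S') cS'.2.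
    apply: filterS3 => x -> e ->; rewrite aut_powD; congr (nonsing_fun _ _).
    exact: e.
  move: (cocycle_orbit cS') cN cN'; apply: filterS3 => x o [s sE] [s' sE'].
  exists (s * s')%g => n.
  rewrite (_ : symZN_fun _ _ = s (s' n))// sE sE' /cocycle_perm.
  by rewrite -[X in c (aut_pow X x)]/(cocycle_perm c' x n) -o addrAC addrA.
- exists (fun x => - c (((aut_repr S)^-1 : nonsing mu)%g x)); split.
    split=> [k|].
      rewrite (_ : _ @^-1` _ =
          [set x | c (((aut_repr S)^-1 : nonsing mu)%g x) = - k]).
        exact: measurable_cocycle cS.
      by apply/seteqP; split=> x /= => [<-|->]; rewrite opprK.
    have := ae_nonsing ((aut_repr S)^-1)%g cS.2; move: (autV S).
    apply: filterS2 => x ->; rewrite nonsingKV => e.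
    by rewrite [in X in _ = nonsing_fun _ X]e aut_powNK.
  move: (cocycle_orbit cS) cN; apply: filterS2 => x o [s sE].
  exists (s^-1)%g => n; rewrite /cocycle_perm.
  have [m <-] : exists m, s m = n.
    by exists (bij_inv (val s) n); exact: bij_invK.
  rewrite [LHS](bij_funK (val s)) sE -o nonsingVK /cocycle_perm.
  by rewrite addrK.
Qed.

Lemma Phi_mfun S c : is_cocycle S c ->
  (\forall x \ae mu, in_symZN (cocycle_perm c x)) ->
  exists f : L0 mu symZN,
    \forall x \ae mu, forall n, (L0_fun f x : symZN) n = cocycle_perm c x n.
Proof.
move=> cS cN.
pose f x : symZN := if pselect (in_symZN (cocycle_perm c x)) is left h
  then sval (cid h) else 1%g.
have fE x : in_symZN (cocycle_perm c x) -> f x =1 cocycle_perm c x.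
  by move=> h n; rewrite /f; case: pselect => // h'; case: cid.
have f1 x : ~ in_symZN (cocycle_perm c x) -> f x = 1%g.
  by move=> h; rewrite /f; case: pselect.
have mc n k : measurable [set x | cocycle_perm c x n = k].
  rewrite (_ : mkset _ = [set x | c (aut_pow n x) = k - n]).
    exact: measurable_cocycle cS.
  rewrite /cocycle_perm; apply/seteqP; split=> x /= => [<-|->].
    by rewrite addrC addKr.
  by rewrite addrC subrK.
have mP n (P : int -> Prop) : measurable [set x | P (cocycle_perm c x n)].
  rewrite (_ : mkset _ = [set x | exists k,
      [set _ : X | P k] x /\ cocycle_perm c x n = k]).
    apply: measurable_exists => k; apply: measurableI; last exact: mc.
    exact: measurable_const.
  apply/seteqP; split=> x /= => [h|[k [h ->//]]].
  by exists (cocycle_perm c x n).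
have mN : measurable [set x | in_symZN (cocycle_perm c x)].
  rewrite (_ : mkset _ =
    [set x | forall m n, cocycle_perm c x m = cocycle_perm c x n -> m = n] `&`
    ([set x | forall m, exists n, cocycle_perm c x n = m] `&`
     [set x | exists s, forall n, seqcomm s (cocycle_perm c x n) <-> natZ n])).
    apply: measurableI; last apply: measurableI.
    - apply: measurable_forall => m; apply: measurable_forall => n.
      have [->|mn] := eqVneq m n.
        by rewrite (_ : mkset _ = setT)//; apply/seteqP; split.
      rewrite (_ : mkset _ = [set x | ~ exists k, cocycle_perm c x m = k /\
          cocycle_perm c x n = k]).
        apply: measurable_not; apply: measurable_exists => k.
        by apply: (measurableI _ _ (mc m k) (mc n k)).
      apply/seteqP; split=> x /= => [h [k [e e']]|h e].
        by move/eqP: mn; apply; apply: h; rewrite e e'.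
      by exfalso; apply: h; exists (cocycle_perm c x n).
    - by apply: measurable_forall => m; apply: measurable_exists => n.
    - apply: measurable_exists => s; apply: measurable_forall => n.
      by apply: measurable_iff; [exact: mP|exact: measurable_const].
  by apply/seteqP; split=> x /= => [/in_symZNP[]|[? [? ?]]]; last exact/in_symZNP.
have mf : measurable_fun setT (f : X -> borel_type symZN).
  apply: measurable_to_symZN => m n.
  rewrite (_ : mkset _ =
     ([set x | in_symZN (cocycle_perm c x)] `&` [set x | cocycle_perm c x m = n])
     `|` ([set x | ~ in_symZN (cocycle_perm c x)] `&` [set _ | m = n])).
    apply: measurableU; apply: measurableI => //.
      exact: measurable_not.
    exact: measurable_const.
  apply/seteqP; split=> x /=.
    have [h|h] := pselect (in_symZN (cocycle_perm c x)).
      by rewrite fE//; left.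
    by rewrite f1//; right.
  by move=> [[h <-]|[h <-]]; [exact: fE|rewrite f1].
pose F : {mfun X >-> borel_type symZN} :=
  HB.pack (f : X -> borel_type symZN) (isMeasurableFun.Build _ _ _ _ _ mf).
pose g : L0 mu symZN := (\pi_(L0 mu symZN) F)%qT.
exists g.
have : \forall x \ae mu, L0_fun g x = f x.
  have /eqP : (\pi_(L0 mu symZN) (repr g) = \pi_(L0 mu symZN) F)%qT by rewrite reprK.
  by rewrite eqmodE => /asboolP; apply: filterS => x; exact.
by move: cN; apply: filterS2 => x /fE h -> n.
Qed.

Definition comfg : Type := subgroup_type (Subgroup com_full_group_subgroup).
HB.instance Definition _ := Group.on comfg.

Lemma Phi_subproof (S : comfg) : exists f : L0 mu symZN, exists c,
  is_cocycle (val S) c /\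
  \forall x \ae mu, forall n, (L0_fun f x : symZN) n = cocycle_perm c x n.
Proof.
have /set_mem[_ [c [cS cN]]] := valP S.
by have [f fE] := Phi_mfun cS cN; exists f, c.
Qed.

(** [comfg] carries the topology pulled back by [Phi] from [L0 mu symZN]. *)
Definition Phi (S : comfg) : L0 mu symZN := sval (cid (Phi_subproof S)).

HB.instance Definition _ := Topological.copy comfg (initial_topology Phi).

End commensurating_full_group.

(* Main.v *)
Require Import Defs.
From mathcomp Require Import all_boot all_order all_algebra.
From mathcomp Require Import all_classical all_reals all_analysis.
From mathcomp Require Import zify lra ring.

(** Identify the orbit of a point [x] with the integers through [n |-> T^n x].
    An element [S] of the commensurating full group then becomes a measurable
    field of permutations [psi S x] of the integers, each commensurating the
    half-line [N] of nonnegative integers; [psi] is multiplicative, and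
    [psi S (T^k x)] is the conjugate of [psi S x] by the translation by [k].

    A permutation preserving the half-lines [k + N] and [k + 1 + N] fixes [k], so
    half-lines suffice to define the topology of Sym(Z, N); by equivariance
    [psi S x] preserves [k + N] if and only if [psi S (T^k x)] preserves [N], and
    [T] is nonsingular. Hence the topology of the whole group is given by one
    left-invariant distance [d(S, V) = mu {x | psi S x N <> psi V x N}], that is, by
    the length function [len S = d(1, S)] ([comfg_length_group]). The two-sided
    distance deduced from it is complete ([comfg_complete]) and separable
    ([comfg_separable]), which gives Polishness. As [len] is at most 1, it remains
    to bound the compatible left-invariant distances on the closure [H] of the
    derived subgroup.

    If [len S < 1], then by ergodicity and recurrence almost every orbit is cut by
    [S]-invariant half-lines arbitrarily far to the left. Two facts follow.

    - Such an [S] lies in [H] ([len_lt1_mem]). Reversing each [S]-orbit from its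
      leftmost point writes [S] as a product of two involutions. An involution
      is a limit of finite products of exchanges of a set [E] with [T^k E], and up
      to a null set [E] is a disjoint union of sets [F] and [T^l F], over
      which the exchange is a commutator ([swap_mem]).
    - Given [e > 0], such an [S] is a product of elements of [H] of length less
      than [e], whose number is bounded in terms of [e] only ([len_lt1_bounded]):
      restrict [S] to unions of the intervals between consecutive cuts. There is
      no atom, so the unions can be taken of measure less than [e].

    A compatible left-invariant distance is less than 1 on some ball around the
    identity of [H]; by the second fact it is bounded on the elements of length
    less than 1. Finally, the elements of [H] have index zero, like all limits of
    products of commutators. So on a set of positive measure [S] in [H] maps [N] to
    a set [M] that a finitely supported permutation brings back to [N]; doing this
    in disjoint windows gives [W] such that [W] and [W S] have length less than 1
    ([index_zero_correction]). Every element of [H] is thus a product of two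
    elements on which the distance is bounded. *)

Set Implicit Arguments.
Unset Strict Implicit.
Unset Printing Implicit Defensive.

Import Order.TTheory GRing.Theory Num.Theory.

Local Open Scope classical_set_scope.
Local Open Scope ring_scope.

(** * Real-valued probabilities *)

Section probabilities.
Context {disp : measure_display} {X : measurableType disp} {R : realType}.
Variable mu : probability X R.
Implicit Types (A B : set X) (e : R).

Definition pr A : R := fine (mu A).

Lemma prE A : measurable A -> mu A = (pr A)%:E.
Proof. by move=> mA; rewrite /pr fineK// fin_num_measure. Qed.

Lemma pr_ge0 A : 0 <= pr A.
Proof. by rewrite /pr fine_ge0. Qed.

Lemma pr_set0 : pr set0 = 0.
Proof. by rewrite /pr measure0. Qed.

Lemma pr_setT : pr setT = 1.
Proof. by rewrite /pr probability_setT. Qed.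

Lemma pr_ltE A e : measurable A -> (mu A < e%:E)%E = (pr A < e).
Proof. by move=> mA; rewrite prE// lte_fin. Qed.

Lemma le_pr A B : measurable A -> measurable B -> A `<=` B -> pr A <= pr B.
Proof.
by move=> mA mB AB; rewrite -lee_fin -!prE//; apply: le_measure; rewrite ?inE.
Qed.

Lemma prU A B : measurable A -> measurable B -> pr (A `|` B) <= pr A + pr B.
Proof.
move=> mA mB; rewrite -lee_fin EFinD -!prE//; last exact: measurableU.
exact: measureU2.
Qed.

Lemma pr_disjointU A B : measurable A -> measurable B ->
  (forall x, A x -> B x -> False) -> pr (A `|` B) = pr A + pr B.
Proof.
move=> mA mB AB; apply: EFin_inj; rewrite EFinD -!prE//; last exact: measurableU.
by apply: measureU => //; apply/seteqP; split=> // x [/AB].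
Qed.

Lemma pr_le1 A : measurable A -> pr A <= 1.
Proof. by move=> mA; rewrite -pr_setT le_pr. Qed.

Lemma pr0P A : measurable A -> pr A = 0 <-> \forall x \ae mu, ~ A x.
Proof.
move=> mA; split=> [A0|A0].
  by exists A; split => //; [rewrite prE// A0|move=> x /= /contrapT].
have : mu.-negligible A by apply: negligibleS A0 => x /= Ax; apply.
by move/(measure_negligible mA); rewrite /pr => ->.
Qed.

Lemma pr_gt0P A : measurable A -> 0 < pr A <-> ~ \forall x \ae mu, ~ A x.
Proof.
by move=> mA; rewrite -pr0P// lt0r pr_ge0 andbT; split; [move/eqP|move=> ?; apply/eqP].
Qed.

Lemma ae_le_pr A B : measurable A -> measurable B ->
  (\forall x \ae mu, A x -> B x) -> pr A <= pr B.
Proof.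
move=> mA mB AB.
have mD : measurable (A `\` B) by exact: measurableD.
have D0 : pr (A `\` B) = 0.
  by apply/pr0P => //; apply: filterS AB => x AB [/AB].
apply: (@le_trans _ _ (pr ((A `\` B) `|` B))).
  apply: le_pr => //; first exact: measurableU.
  by move=> x Ax; have [|] := pselect (B x); [right|left].
by rewrite (le_trans (prU _ _))// D0 add0r.
Qed.

Lemma ae_pr1 A : measurable A -> (\forall x \ae mu, A x) -> pr A = 1.
Proof.
move=> mA hA; apply/eqP; rewrite eq_le pr_le1//= -pr_setT; apply: ae_le_pr => //.
by apply: filterS hA => x.
Qed.

Lemma ae_ex (P : X -> Prop) : (\forall x \ae mu, P x) -> exists x, P x.
Proof.
move=> h; apply: contrapT => np.
have : pr setT = 0.
  by apply/pr0P => //; apply: filterS h => x px _; apply: np; exists x.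
by rewrite pr_setT; move/eqP; rewrite oner_eq0.
Qed.

Lemma pr_pos_ex A (P : X -> Prop) : measurable A -> 0 < pr A ->
  (\forall x \ae mu, P x) -> exists2 x, A x & P x.
Proof.
move=> mA /pr_gt0P A0 aP; apply: contrapT => nex; apply: (A0 mA).
by apply: filterS aP => x Px Ax; apply: nex; exists x.
Qed.

Lemma pr_decr_small (A : nat -> set X) : (forall n, measurable (A n)) ->
  (forall n, A n.+1 `<=` A n) -> (\forall x \ae mu, exists n, ~ A n x) ->
  forall e, 0 < e -> exists n, pr (A n) < e.
Proof.
move=> mA dA hA e e0.
have mI : measurable (\bigcap_n A n) by apply: bigcap_measurable.
have I0 : mu (\bigcap_n A n) = 0%E.
  rewrite prE//; congr (_%:E); apply/pr0P => //.
  by apply: filterS hA => x [n nA] /(_ n Logic.I).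
have cv : mu (A n) @[n --> \oo] --> 0%E.
  rewrite -I0; apply: nonincreasing_cvg_mu => //.
  - by apply: (@le_lt_trans _ _ 1%E); [exact: probability_le1|exact: ltry].
  - by apply/nonincreasing_seqP => n; apply/subsetPset.
have /(_ (fun x : \bar R => (x < e%:E)%E)) := cv.
have : nbhs 0%E (fun x : \bar R => (x < e%:E)%E).
  have := @open_nbhs_nbhs _ (0%E : \bar R) [set x | (x < e%:E)%E]; apply.
  by split; [exact: open_ereal_lt_ereal|rewrite /= lte_fin].
move=> n0 /(_ n0) [N _ /(_ N (leqnn N))] /=.
by rewrite pr_ltE//; exists N.
Qed.

Lemma pr_countable_pos (I : countType) A (B : I -> set X) :
  measurable A -> (forall i, measurable (B i)) -> 0 < pr A ->
  (\forall x \ae mu, A x -> exists i, B i x) -> exists i, 0 < pr (A `&` B i).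
Proof.
move=> mA mB A0 AB; apply: contrapT => nex.
have h i : \forall x \ae mu, ~ (A `&` B i) x.
  apply/pr0P; first exact: measurableI.
  by apply/eqP; rewrite eq_le pr_ge0 andbT leNgt; apply/negP => h; apply: nex; exists i.
have [x Ax [Bx nx]] : exists2 x, A x & (A x -> exists i, B i x) /\ forall i, ~ (A `&` B i) x.
  by apply: pr_pos_ex => //; move: AB (ae_all h); apply: filterS2.
by have [i Bi] := Bx Ax; apply: (nx i).
Qed.

(** The Borel-Cantelli lemma. *)
Lemma pr_limsup (F : nat -> set X) : (forall n, measurable (F n)) ->
  (forall n, pr (F n) <= 2^-1 ^+ n) ->
  \forall x \ae mu, exists N, forall n, (N <= n)%N -> ~ F n x.
Proof.
move=> mF hF.
have mL : measurable (lim_sup_set F).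
  by apply: bigcap_measurable => // k _; exact: bigcup_measurable.
have L0 : mu (lim_sup_set F) = 0%E.
  apply: lim_sup_set_cvg0 => //.
  apply: (@le_lt_trans _ _ (\sum_(n <oo) (2^-1 ^+ n)%:E)%E).
    apply: lee_nneseries => [n _ _|n _]; first exact: measure_ge0.
    by have := hF n; rewrite -lee_fin -prE.
  have -> : (\sum_(n <oo) ((2^-1 : R) ^+ n)%:E)%E = 2%:E.
    have := @cvg_geometric_eseries_half R 2 0.
    rewrite expr0 divr1 => /cvg_lim e; rewrite -[RHS]e//.
    apply/congr_lim/funext => n; rewrite /eseries /=.
    apply: eq_bigr => i _; congr (_%:E).
    by rewrite addn1 natrX exprS exprVn; field; rewrite expf_neq0.
  by rewrite ltry.
exists (lim_sup_set F); split=> // x /= nx n _.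
apply: contrapT => h; apply: nx; exists n => k nk Fk; apply: h; by exists k.
Qed.

Lemma measurable_nonsing (f : nonsing mu) A : measurable A -> measurable (f @^-1` A).
Proof.
by move=> mA; rewrite -[X in measurable X]setTI; exact: nonsing_measurable.
Qed.

(** Nonsingularity is absolute continuity, hence uniform on sets of small
    measure because the measure is finite. *)
Lemma pr_abs_cont (f : nonsing mu) e : 0 < e ->
  exists2 d, 0 < d & forall A, measurable A -> pr A < d -> pr (f @^-1` A) < e.
Proof.
move=> e0; apply: contrapT => nd.
(* otherwise sets of measure at most [2^-n] have preimages of measure at least
   [e], but their upper limit is null *)
have hA n : exists A, [/\ measurable A, pr A <= 2^-1 ^+ n & e <= pr (f @^-1` A)].
  apply: contrapT => nA; apply: nd; exists (2^-1 ^+ n); first by rewrite exprn_gt0// invr_gt0.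
  move=> A mA /ltW Ad; rewrite ltNge; apply/negP => eA; apply: nA; by exists A.
pose A n := sval (cid (hA n)).
have mA n : measurable (A n) by rewrite /A; case: cid => /= ? [].
have A2 n : pr (A n) <= 2^-1 ^+ n by rewrite /A; case: cid => /= ? [].
have Ae n : e <= pr (f @^-1` (A n)) by rewrite /A; case: cid => /= ? [].
have := ae_nonsing f (pr_limsup mA A2) => ls.
pose C n := \bigcup_(k in [set k | (n <= k)%N]) (f @^-1` (A k)).
have mC n : measurable (C n) by apply: bigcup_measurable => k _; exact: measurable_nonsing.
have [n] : exists n, pr (C n) < e.
  apply: pr_decr_small => //.
    by move=> n x [k /= nk Ak]; exists k => //=; exact: ltnW.
  by apply: filterS ls => x [N hN]; exists N => -[k /= Nk]; exact: hN.
rewrite ltNge => /negP; apply; rewrite (le_trans (Ae n))//; apply: le_pr => //.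
  exact: measurable_nonsing.
by move=> x ?; exists n => /=.
Qed.

End probabilities.

(** * Standard atomless spaces *)

Section separating_family.
Context {disp : measure_display} {X : measurableType disp} {R : realType}.
Variable mu : probability X R.

Definition separating (U : nat -> set X) : Prop :=
  forall x y, x <> y -> exists i, U i x /\ ~ U i y.

(** Balls with centres in a countable dense set and radii [1 / n]. *)
Lemma standard_borel_separating : standard_borel R X ->
  exists U : nat -> set X, [/\ forall i, measurable (U i), separating U &
    @measurable disp X = <<s range U >>].
Proof.
move=> [d [[d0 dC dT] _ [Q cQ Qd]] mE].
have [x0 _] : exists x : X, True by apply: (@ae_ex _ _ _ mu); exact: aeW.
have [q qQ] : exists q : nat -> X, forall x, Q x -> exists i, q i = x.
  have [Q0|[q]] := pfcard_geP cQ.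
    by have [y] := Qd x0 1 ltr01; rewrite Q0.
  by exists q => x /(@surj _ _ _ _ q)[i _ <-]; exists i.
pose B i k := [set y | d (q i) y < k.+1%:R^-1].
have dxx x : d x x = 0 by exact/d0.
have d_ge0 x y : 0 <= d x y.
  by have := dT x y x; rewrite dxx (dC y x); lra.
have oB i k : metric_open d (B i k).
  move=> x /= xB; exists (k.+1%:R^-1 - d (q i) x); first by rewrite subr_gt0.
  by move=> y xy; rewrite /B/= (le_lt_trans (dT _ x _))// -ltrBrDl.
have dense x e : 0 < e -> exists i k, B i k x /\ forall y, B i k y -> d x y < e.
  move=> e0; have [k hk] : exists k, k.+1%:R^-1 < e / 2.
    exists (Num.truncn (e / 2)^-1).
    by rewrite -[X in _ < X]invrK ltf_pV2 ?posrE ?invr_gt0 ?divr_gt0// truncnS_gt.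
  have [y /qQ[i <-] xq] := Qd x (k.+1%:R^-1) (ltac:(by rewrite invr_gt0)).
  exists i, k; split; first by rewrite /B/= dC.
  move=> y' yB; rewrite (le_lt_trans (dT _ (q i) _))// [e]splitr.
  by apply: ltrD; [exact: lt_trans hk|apply: lt_trans hk].
pose U n := if (unpickle n : option (nat * nat)) is Some (i, k) then B i k else set0.
have UE i k : U (pickle (i, k)) = B i k by rewrite /U pickleK.
exists U; split.
- move=> n; rewrite /U; case: unpickle => [[i k]|]; last exact: measurable0.
  by rewrite mE; apply: sub_gen_smallest.
- move=> x y xy; have dxy : 0 < d x y.
    by rewrite lt0r d_ge0 andbT; apply/eqP => /d0.
  have [i [k [xB h]]] := dense x _ dxy.
  by exists (pickle (i, k)); rewrite UE; split=> // /h; rewrite ltxx.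
- rewrite mE; apply/seteqP; split.
    apply: smallest_sub; first exact: smallest_sigma_algebra.
    move=> O oO.
    have -> : O = \bigcup_n (if `[< U n `<=` O >] then U n else set0).
      apply/seteqP; split=> x.
        move=> Ox; have [e e0 eO] := oO _ Ox.
        have [i [k [xB h]]] := dense x _ e0.
        exists (pickle (i, k)) => //; rewrite UE ifT//.
        by apply/asboolP => y /h; exact: eO.
      by move=> [n _]; case: asboolP => // nO /nO.
    apply: sigma_algebra_bigcup => n; case: asboolP => _.
      by apply: sub_gen_smallest; exists n.
    exact: sigma_algebra0.
  apply: smallest_sub; first exact: smallest_sigma_algebra.
  move=> _ [n _ <-]; rewrite /U; case: unpickle => [[i k]|].
    by apply: sub_gen_smallest.
  exact: sigma_algebra0.
Qed.

Variables (U : nat -> set X) (mU : forall i, measurable (U i)) (sepU : separating U).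

(** The patterns cut the space into finitely many measurable cells, which shrink
    to points as [N] grows. *)
Definition pattern N (x : X) : N.-tuple bool := [tuple `[< U i x >] | i < N].

Lemma patternP N x y : pattern N x = pattern N y <-> forall i, (i < N)%N -> U i x <-> U i y.
Proof.
split=> [e i iN|h].
  have := congr1 (fun t => tnth t (Ordinal iN)) e; rewrite !tnth_mktuple /= => {}e.
  by split=> /asboolP; [rewrite e|rewrite -e] => /asboolP.
by apply: eq_from_tnth => i; rewrite !tnth_mktuple; apply/asbool_equiv_eq/h.
Qed.

Lemma measurable_pattern N (P : N.-tuple bool -> Prop) :
  measurable [set x | P (pattern N x)].
Proof.
rewrite (_ : mkset _ = [set x | exists w, [set _ : X | P w] x /\ pattern N x = w]).
  apply: measurable_exists => w.
  apply: (@measurableI _ _ [set _ : X | P w] [set x | pattern N x = w]).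
    exact: measurable_const.
  rewrite (_ : mkset _ = [set x | forall i : 'I_N, U i x <-> tnth w i]).
    apply: measurable_forall => i; apply: measurable_iff; first exact: mU.
    exact: (measurable_const (tnth w i)).
  apply/seteqP; split=> x /=.
    by move=> <- i; rewrite tnth_mktuple; split=> /asboolP.
  by move=> h; apply: eq_from_tnth => i; rewrite tnth_mktuple; apply/asboolP/idP => /h.
by apply/seteqP; split=> x /=; [exists (pattern N x)|move=> [w [? ->]]].
Qed.

Definition cell N x : set X := [set y | pattern N y = pattern N x].

Lemma measurable_cell N x : measurable (cell N x).
Proof. exact: (measurable_pattern (fun w => w = pattern N x)). Qed.

Lemma cellS N x : cell N.+1 x `<=` cell N x.
Proof. by move=> y /patternP h; apply/patternP => i iN; apply/h/ltnW. Qed.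

Lemma cell_shrink x y : (forall N, cell N x y) -> y = x.
Proof.
move=> h; apply: contrapT => /sepU[i [Uy nUx]]; apply: nUx.
by have /patternP/(_ i (ltnSn i))[+ _] := h i.+1; exact.
Qed.

(** The points whose cell at level [N] has [nu]-mass at least [e] form a union
    of cells, and these unions decrease to the empty set. One of them has mass less
    than [e], so it contains no such cell: it is empty. *)
Lemma small_cells (nu : set X -> R) :
  (forall A B, measurable A -> measurable B -> A `<=` B -> nu A <= nu B) ->
  (forall A : nat -> set X, (forall n, measurable (A n)) ->
     (forall n, A n.+1 `<=` A n) ->
     (forall x y, (forall n, A n x) -> (forall n, A n y) -> x = y) ->
     forall e, 0 < e -> exists n, nu (A n) < e) ->
  forall e, 0 < e -> exists N, forall x, nu (cell N x) < e.
Proof.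
move=> mono small e e0.
pose Z N := [set x | e <= nu (cell N x)].
have mZ N : measurable (Z N).
  rewrite (_ : Z N = [set x | exists2 y, e <= nu (cell N y) & pattern N x = pattern N y]).
    exact: (measurable_pattern (fun w => exists2 y, e <= nu (cell N y) & w = pattern N y)).
  by apply/seteqP; split=> x; [exists x|move=> [y ey xy]; rewrite /Z/cell/= xy].
have [N ZN] : exists n, nu (Z n) < e.
  apply: (small) => //.
    move=> n x /= h; apply: (le_trans h); apply: mono;
      [exact: measurable_cell..|exact: cellS].
  move=> x y Zx; exfalso.
  have [n] : exists n, nu (cell n x) < e.
    apply: (small) => //; first by move=> n; exact: measurable_cell.
      by move=> n; exact: cellS.
    by move=> a b /cell_shrink -> /cell_shrink ->.
  by rewrite ltNge Zx.
exists N => x; rewrite ltNge; apply/negP => ex.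
move: ZN; rewrite ltNge => /negP; apply; rewrite (le_trans ex)//; apply: mono => //.
  exact: measurable_cell.
by move=> y yx; rewrite /Z/= /cell yx.
Qed.

Hypothesis mu_atomless : atomless mu.

Lemma pr_atomless A : measurable A -> 0 < pr mu A ->
  exists B, [/\ measurable B, B `<=` A, 0 < pr mu B & pr mu B < pr mu A].
Proof.
move=> mA A0; have : (0 < mu A)%E by rewrite prE.
move=> /(mu_atomless mA)[B [mB BA B0 B1]]; exists B; split=> //.
  by rewrite -lte_fin -prE.
by rewrite -lte_fin -!prE.
Qed.

Lemma measurable_point (x : X) : measurable [set x].
Proof.
rewrite (_ : [set x] = \bigcap_N cell N x); last first.
  apply/seteqP; split=> y; first by move=> -> N _.
  by move=> h; apply: cell_shrink => N; exact: h.
by apply: bigcap_measurable => // N _; exact: measurable_cell.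
Qed.

(** Otherwise the point would be an atom. *)
Lemma pr_point (x : X) : pr mu [set x] = 0.
Proof.
apply/eqP; rewrite eq_le pr_ge0 andbT leNgt; apply/negP => x0.
have mx := measurable_point x.
have [B [mB Bx B0 B1]] := pr_atomless mx x0.
have [Bxx|nBx] := pselect (B x).
  move: B1; rewrite (_ : B = [set x]) ?ltxx//.
  by apply/seteqP; split=> // y ->.
move: B0; rewrite (_ : B = set0) ?pr_set0 ?ltxx//.
by apply/seteqP; split=> // y /[dup] /Bx -> /nBx.
Qed.

Lemma ae_neq (x : X) : \forall y \ae mu, y <> x.
Proof. by apply/(@pr0P _ _ _ mu [set x]); [exact: measurable_point|exact: pr_point]. Qed.

End separating_family.

(** * Aperiodicity and recurrence of ergodic transformations *)

Lemma int_has_min (P : int -> Prop) (n : int) :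
  (exists k, P k) -> (forall k, P k -> n <= k) ->
  exists b, P b /\ forall k, P k -> b <= k.
Proof.
move=> [k Pk] nP.
pose p i := `[< P (n + i%:Z) >].
have ex_p : exists i, p i.
  exists `|k - n|%N; apply/asboolP.
  by have := nP _ Pk => nk; rewrite (_ : n + _ = k)//; lia.
exists (n + (ex_minn ex_p)%:Z); case: ex_minnP => i /asboolP Pi imin.
split=> // j Pj; have nj := nP _ Pj.
have : p `|j - n|%N by apply/asboolP; rewrite (_ : n + _ = j)//; lia.
by move/imin; lia.
Qed.

Lemma decr_finite_common (X : Type) (A : nat -> set X) (f : nat -> X) n :
  (forall m, A m.+1 `<=` A m) ->
  (forall k, (k < n)%N -> exists m, ~ A m (f k)) ->
  exists m, forall k, (k < n)%N -> ~ A m (f k).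
Proof.
move=> dA; have dA' m m' : (m <= m')%N -> A m' `<=` A m.
  elim: m' => [|m' IH]; first by rewrite leqn0 => /eqP ->.
  by rewrite leq_eqVlt => /predU1P[->//|/IH h]; apply: subset_trans h.
elim: n => [|n IH] h; first by exists 0%N.
have [m hm] := IH (fun k kn => h k (leqW kn)).
have [m' hm'] := h n (ltnSn n).
exists (maxn m m') => k; rewrite ltnS leq_eqVlt => /predU1P[->|kn] Ak.
  by apply: hm'; apply: dA' Ak; exact: leq_maxr.
by apply: (hm k kn); apply: dA' Ak; exact: leq_maxl.
Qed.

#[global] Arguments aut_pow : simpl never.
#[global] Arguments expgz : simpl never.

Section ergodic_theory.
Context {disp : measure_display} {X : measurableType disp} {R : realType}.
Context {mu : probability X R}.
Variable T : aut mu.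
Notation Tp := (aut_pow T).

Lemma aut_pow0 x : Tp 0 x = x.
Proof. by []. Qed.

Lemma aut_pow1 x : Tp 1 x = T x.
Proof. by []. Qed.

Lemma aut_pow_inj k : injective (Tp k).
Proof. by move=> x y e; rewrite -(aut_powNK T k x) e aut_powNK. Qed.

Lemma aut_powDC j k x : Tp j (Tp k x) = Tp k (Tp j x).
Proof. by rewrite -!aut_powD addrC. Qed.

Lemma ae_orbit (P : X -> Prop) : (\forall x \ae mu, P x) ->
  \forall x \ae mu, forall n, P (Tp n x).
Proof. by move=> h; apply: ae_all => n; exact: ae_nonsing. Qed.

Lemma measurable_aut_pow k (A : set X) : measurable A -> measurable [set x | A (Tp k x)].
Proof. exact: measurable_nonsing. Qed.

Variables (U : nat -> set X) (mU : forall i, measurable (U i)) (sepU : separating U).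
Hypotheses (mu_atomless : atomless mu) (T_ergodic : ergodic T).

Lemma ergodic_dichotomy (A : set X) : measurable A ->
  (forall x, A (T x) <-> A x) -> (\forall x \ae mu, ~ A x) \/ (\forall x \ae mu, A x).
Proof.
move=> mA hA; have [|A0|A0] := T_ergodic mA; first by apply/seteqP; split=> x /hA.
- by left; apply/pr0P => //; rewrite /pr A0.
- right; have : pr mu (~` A) = 0 by rewrite /pr A0.
  move/pr0P => /(_ (measurableC mA)); apply: filterS => x /=; exact: contrapT.
Qed.

Lemma ergodic_orbit (A : set X) : measurable A -> 0 < pr mu A ->
  \forall x \ae mu, exists k, A (Tp k x).
Proof.
move=> mA A0; have [||h|//] := @ergodic_dichotomy [set x | exists k, A (Tp k x)].
- by apply: measurable_exists => k; exact: measurable_aut_pow.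
- move=> x /=; rewrite -aut_pow1; split=> -[k Ak]; first by exists (k + 1); rewrite aut_powD.
  by exists (k - 1); rewrite -aut_powD subrK.
- exfalso; move/(pr_gt0P mu mA): A0; apply; apply: filterS h => x nA Ax; apply: nA.
  by exists 0.
Qed.

Lemma orbit_leaves (A : nat -> set X) :
  (forall x y, (forall n, A n x) -> (forall n, A n y) -> x = y) ->
  \forall x \ae mu, forall k, exists m, ~ A m (Tp k x).
Proof.
move=> A1; have [[y Ay]|nA] := pselect (exists y, forall m, A m y).
  apply: filterS (ae_orbit (ae_neq mU sepU mu_atomless y)) => x hx k.
  apply: contrapT => /forallNP h; apply: (hx k).
  by apply: A1 => // m; exact: contrapT.
apply: aeW => x k; apply: contrapT => /forallNP h.
by apply: nA; exists (Tp k x) => m; exact: contrapT.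
Qed.

Lemma aut_pow_period n x : (0 < n)%N -> Tp n x = x ->
  forall k, exists2 j : nat, (j < n)%N & Tp k x = Tp j x.
Proof.
move=> n0 nx; elim/int_ind => [|k [j jn e]|k [j jn e]]; first by exists 0%N.
- have eS : Tp (k.+1%:Z) x = Tp j.+1 x.
    by rewrite -addn1 PoszD addrC aut_powD e -aut_powD -PoszD add1n.
  move: jn; rewrite leq_eqVlt => /predU1P[jn|jn]; last by exists j.+1.
  by exists 0%N => //; rewrite eS jn nx.
- have eS : Tp (- (k.+1%:Z)) x = Tp (-1) (Tp j x).
    by rewrite -addn1 PoszD opprD addrC aut_powD e.
  case: j jn e eS => [|j] jn e eS; last first.
    by exists j; [exact: ltnW|rewrite eS -aut_powD; congr (Tp _ x); lia].
  exists n.-1; first by lia.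
  by rewrite eS -[in LHS]nx -!aut_powD; congr (Tp _ x); lia.
Qed.

(** If [T^n] fixed almost every point, the saturation of a cell of positive measure
    would be the union of [n] of its images, hence not of full measure when the
    cell is small. *)
Lemma aperiodic : \forall x \ae mu, forall k, Tp k x = x -> k = 0.
Proof.
suff h n : (0 < n)%N -> \forall x \ae mu, Tp n x <> x.
  have : \forall x \ae mu, forall n : nat, Tp n.+1 x <> x by apply: ae_all => n; exact: h.
  apply: filterS => x nx [[//|k]|k] e; exfalso; apply: (nx k) => //.
  by rewrite -[in LHS]e NegzE -aut_powD subrr.
move=> n0; pose P := [set x | Tp n x = x].
have mP : measurable P.
  rewrite (_ : P = [set x | ~ exists i, U i x /\ ~ U i (Tp n x)]).
    apply: measurable_not; apply: measurable_exists => i.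
    apply: (@measurableI _ _ (U i) [set x | ~ U i (Tp n x)]) => //.
    by apply: measurable_not; exact: measurable_aut_pow.
  apply/seteqP; split=> x; rewrite /P /=; first by move=> -> [i []].
  by move=> h; apply/esym; apply: contrapT => /sepU.
have [|//|aP] := ergodic_dichotomy mP.
  move=> x; rewrite /P/= -!aut_pow1 aut_powDC; split=> [/aut_pow_inj//|->//].
exfalso; pose nu A := pr mu [set x | exists k : 'I_n, A (Tp k x)].
have mnu A : measurable A -> measurable [set x | exists k : 'I_n, A (Tp k x)].
  by move=> mA; apply: measurable_exists => k; exact: measurable_aut_pow.
have [N hN] : exists N, forall x, nu (cell U N x) < 1.
  apply: small_cells => //.
    move=> A B mA mB AB; apply: le_pr; [exact: mnu|exact: mnu|].
    by move=> x [k /AB Bx]; exists k.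
  move=> A mA dA A1 e e0; apply: pr_decr_small => //.
  - by move=> i; exact: mnu.
  - by move=> i x [k /dA ?]; exists k.
  move: (orbit_leaves A1).
  apply: filterS => x h.
  have [m hm] := @decr_finite_common _ A (fun k => Tp k x) n dA (fun k _ => h k%:Z).
  by exists m => -[k]; exact: hm.
have hw (w : N.-tuple bool) : \forall x \ae mu, pattern U N x <> w.
  have [[y yw]|nw] := pselect (exists y, pattern U N y = w); last first.
    by apply: aeW => x xw; apply: nw; exists x.
  apply/(@pr0P _ _ _ mu [set x | pattern U N x = w]).
    exact: (measurable_pattern mU (fun v => v = w)).
  have mw : measurable [set x | pattern U N x = w].
    exact: (measurable_pattern mU (fun v => v = w)).
  apply/eqP; rewrite eq_le pr_ge0 andbT leNgt; apply/negP => /(ergodic_orbit mw) sat.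
  have : nu (cell U N y) = 1.
    apply: ae_pr1; first by apply: mnu; exact: measurable_cell.
    move: aP sat; apply: filterS2 => x /= Px [k].
    have [j jn ->] := aut_pow_period n0 Px k.
    by move=> e; exists (Ordinal jn); rewrite /cell /= yw.
  by move=> e; have := hN y; rewrite e ltxx.
have /ae_ex[x] : \forall x \ae mu, forall w : N.-tuple bool, pattern U N x <> w.
  exact: ae_all.
by move=> /(_ (pattern U N x)).
Qed.

Lemma aperiodic_inj : \forall x \ae mu, forall j k, Tp j x = Tp k x -> j = k.
Proof.
apply: filterS aperiodic => x h j k e.
by apply/eqP; rewrite -subr_eq0; apply/eqP/h; rewrite addrC aut_powD e aut_powNK.
Qed.

(** The points of [B] whose past avoids [B] meet each orbit at most once; were
    they not negligible, the saturations of two halves of this set would be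
    disjoint invariant sets of positive measure. *)
Lemma backward_recurrence (B : set X) : measurable B -> 0 < pr mu B ->
  \forall x \ae mu, forall n, exists2 b, b <= n & B (Tp b x).
Proof.
move=> mB B0.
pose W := [set x | B x /\ forall n : nat, ~ B (Tp (- n.+1%:Z) x)].
have mW : measurable W.
  apply: (@measurableI _ _ B [set x | forall n : nat, ~ B (Tp (- n.+1%:Z) x)]) => //.
  by apply: measurable_forall => n; apply: measurable_not; exact: measurable_aut_pow.
have W0 : pr mu W = 0.
  apply/eqP; rewrite eq_le pr_ge0 andbT leNgt; apply/negP => W0.
  have [V [mV VW V0 VW1]] := pr_atomless mu_atomless mW W0.
  have mD : measurable (W `\` V) by exact: measurableD.
  have : 0 < pr mu (W `\` V).
    have : pr mu W <= pr mu (W `\` V) + pr mu V.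
      rewrite -pr_disjointU//; last by move=> x [].
      apply: le_pr => //; first exact: measurableU.
      by move=> x Wx; have [|] := pselect (V x); [right|left].
    by move: VW1; lra.
  move=> D0; have [x [Wx nV] [k Vk]] := pr_pos_ex mD D0 (ergodic_orbit mV V0).
  have [Bk Wk] := VW _ Vk.
  have [Bx nB] := Wx.
  case: k Vk Bk Wk => [[|k]|k] Vk Bk Wk.
  - exact: nV.
  - by apply: (Wk k); rewrite aut_powNK.
  - by apply: (nB k); rewrite -NegzE.
have nW := ae_orbit ((pr0P mu mW).1 W0).
move: nW (ergodic_orbit mB B0); apply: filterS2 => x nW exB n.
apply: contrapT => h.
have [||b [Bb bmin]] := @int_has_min (fun k => B (Tp k x)) n; first exact: exB.
  move=> k Bk; rewrite leNgt; apply/negP => kn; apply: h.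
  by exists k => //; exact: ltW.
apply: (nW b); split=> // m Bm.
by have := bmin (- m.+1%:Z + b); rewrite aut_powD => /(_ Bm); lia.
Qed.

End ergodic_theory.

(** * Permutations of the integers commensurating the positive half-line *)

Definition pres (p : int -> int) (k : int) : Prop :=
  forall n, (k <= p n) = (k <= n).

Lemma finite_int_bounded (A : set int) : finite_set A ->
  exists2 K : int, 0 <= K & forall n, A n -> `|n| < K.
Proof.
move=> /finite_seqP[s ->].
elim: s => [|a s [K K0 hK]]; first by exists 0.
exists (K + `|a| + 1) => [|n]; first by lia.
by rewrite /= inE => /orP[/eqP ->|/hK]; lia.
Qed.

Lemma bounded_int_finite (K : int) : finite_set [set n : int | `|n| < K].
Proof.
have : finite_set ((fun i : nat => i%:Z - K) @` `I_(`|K| + `|K|)%N).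
  exact/finite_image/finite_II.
by apply: sub_finite_set => n /= nK; exists (absz (n + K)) => /=; lia.
Qed.

Section symZN_theory.
Implicit Types s t : symZN.

Lemma symM s t n : symZN_fun (s * t)%g n = s (t n). Proof. by []. Qed.
Lemma sym1 n : symZN_fun 1%g n = n. Proof. by []. Qed.

Lemma symVK s n : symZN_fun (s^-1)%g (s n) = n.
Proof. by rewrite -symM mulVg. Qed.

Lemma symKV s n : s (symZN_fun (s^-1)%g n) = n.
Proof. by rewrite -symM mulgV. Qed.

Lemma sym_inj s : injective s.
Proof. exact: can_inj (symVK s). Qed.

Lemma sym_ext s t : s =1 t -> s = t.
Proof. by move=> st; apply: val_inj; exact: bijP. Qed.

Lemma symV_eq s n m : s n = m -> symZN_fun (s^-1)%g m = n.
Proof. by move=> <-; rewrite symVK. Qed.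

Lemma pres1 k : pres (symZN_fun 1%g) k. Proof. by move=> n; rewrite sym1. Qed.

Lemma presM s t k : pres s k -> pres t k -> pres (symZN_fun (s * t)%g) k.
Proof. by move=> hs ht n; rewrite symM hs ht. Qed.

Lemma presV s k : pres s k -> pres (symZN_fun (s^-1)%g) k.
Proof. by move=> hs n; rewrite -[in RHS](symKV s n) hs. Qed.

Lemma pres_expgz s k i : pres s k -> pres (symZN_fun (expgz s i)) k.
Proof.
move=> hs; have hn n : pres (symZN_fun (s ^+ n)%g) k.
  elim: n => [|n IH]; first by rewrite expg0; exact: pres1.
  by rewrite expgS; exact: presM.
by case: i => n; rewrite /expgz; [|apply: presV].
Qed.

(** Two consecutive half-lines determine a point. *)
Lemma pres_fix (p : int -> int) k : pres p k -> pres p (k + 1) -> p k = k.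
Proof. by move=> /(_ k) h /(_ k); lia. Qed.

Lemma sym_bound s : exists2 K : int, 0 <= K & forall n, K <= `|n| -> (0 <= s n) = (0 <= n).
Proof.
have /set_mem sN := valP s.
have : finite_set (symZN_fun (s^-1)%g @` (val s @` natZ `+` natZ)) by exact: finite_image.
move=> /finite_int_bounded[K K0 hK]; exists K => // n Kn.
apply: contrapT => ne.
suff /hK : (symZN_fun (s^-1)%g @` (val s @` natZ `+` natZ)) n by lia.
exists (s n); last exact: symVK.
have [n0|n0] := leP 0 n.
  left; split; first by exists n.
  by rewrite /natZ/= => sn0; apply: ne; rewrite n0 sn0.
right; split; first by rewrite /natZ/=; case: (leP 0 (s n)) ne => //; lia.
by move=> [m /= m0 /(@sym_inj s) mn]; move: n0; rewrite -mn ltNge m0.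
Qed.

(** Commensuration means that only boundedly many integers cross the origin. *)
Lemma in_symZN_bound (p q : int -> int) (K : int) : cancel p q -> cancel q p ->
  (forall n, K <= `|n| -> (0 <= p n) = (0 <= n)) -> in_symZN p.
Proof.
move=> pK qK hK.
have pN : [set s : Defs.bij int | commN (s @` natZ)] (Defs.Bij pK qK).
  have : finite_set (p @` [set n : int | `|n| < K]).
    exact/finite_image/bounded_int_finite.
  rewrite /commN/=; apply: sub_finite_set => m [[[n /= n0 <-] pn]|[/= m0 nm]].
    exists n => //=; rewrite ltNge; apply/negP => /hK.
    by move: pn; rewrite /natZ/= n0 => ? ?; auto.
  exists (q m) => //=; rewrite ltNge; apply/negP => /hK; rewrite qK.
  by move: m0; rewrite /natZ/= => -> /esym q0; apply: nm; exists (q m).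
by exists (exist _ (Defs.Bij pK qK) (mem_set pN)).
Qed.

Lemma in_symZN_displacement (p q : int -> int) (K : int) : cancel p q -> cancel q p ->
  (forall n, `|p n - n| < K) -> in_symZN p.
Proof.
by move=> pK qK hK; apply: (in_symZN_bound pK qK (K := K)) => n; have := hK n; lia.
Qed.

Definition near_natZ (M : set int) (K : int) : Prop :=
  forall n, K <= `|n| -> M n <-> 0 <= n.

(** A permutation preserving all half-lines near 0 fixes the points near 0 and
    preserves what lies on either side of them. *)
Lemma pres_near s (M : set int) (K : int) : 0 <= K -> near_natZ M K ->
  (forall k, `|k| <= K -> pres s k) -> forall n, M (s n) <-> M n.
Proof.
move=> K0 MK sK n.
have [nK|nK] := ltP `|n| K.
  have -> : s n = n by apply: pres_fix; apply: sK; lia.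
  by [].
have := sK K; have := sK (- K + 1); have := sK (- K) => hN hN1 hP.
have eP := hP (ltac:(lia)) n.
have eN := hN (ltac:(lia)) n.
have [n0|n0] := leP 0 n; first by rewrite !MK; lia.
have [K1|K1] := ltP 0 K.
  have eN1 := hN1 (ltac:(lia)) n; rewrite !MK; lia.
by rewrite !MK; lia.
Qed.

Lemma near_natZ_image s (K : int) :
  (forall n, K <= `|n| -> (0 <= symZN_fun (s^-1)%g n) = (0 <= n)) -> near_natZ (s @` natZ) K.
Proof.
move=> sK n /sK <-; split=> [[m /= m0 <-]|h]; first by rewrite symVK.
by exists (symZN_fun (s^-1)%g n) => //; exact: symKV.
Qed.

(** A commensurated set differs from a half-line near 0 only, so stabilizing
    enough half-lines around 0 stabilizes any given finite family of such sets. *)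
Lemma nbhs1_pres (V : set symZN) : nbhs (1%g : symZN) V ->
  exists2 K : int, 0 <= K & forall s, (forall k, `|k| <= K -> pres s k) -> V s.
Proof.
rewrite nbhsE => -[W [oW W1] WV].
have /(_ _ W1)[F [fF cF FW]] : symZN_open W by exact: oW.
have : finite_set (\bigcup_(M in F) (M `+` natZ)).
  by apply: bigcup_finite => // M /cF.
move=> /finite_int_bounded[K K0 hK]; exists K => // s sK.
have FK M : F M -> near_natZ M K.
  move=> FM n Kn; split=> h; apply: contrapT => nh.
    have /hK : (\bigcup_(M in F) (M `+` natZ)) n by exists M => //; left; split.
    by lia.
  have /hK : (\bigcup_(M in F) (M `+` natZ)) n by exists M => //; right; split.
  by lia.
apply: WV; rewrite -[s]mul1g; apply: FW => M FM.
have h := pres_near K0 (FK _ FM) sK.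
apply/seteqP; split=> [_ [n Mn <-]|n Mn]; first exact/h.
by exists (symZN_fun (s^-1)%g n); [apply/h; rewrite symKV|exact: symKV].
Qed.

(** Membership in such a [V] depends on the images of two half-lines only. *)
Lemma open_pres_left (V : set symZN) k :
  (forall s t, V s -> pres t k -> pres t (k + 1) -> V (s * t)%g) -> open V.
Proof.
move=> hV; suff : symZN_open V by [].
move=> s Vs; pose H j : set int := [set n | j <= n].
have cH j : commN (H j).
  rewrite /commN/=; apply: sub_finite_set (bounded_int_finite (`|j| + 1)) => n.
  by rewrite /setY /H/natZ/= => -[[? ?]|[? ?]]; lia.
exists [set H k; H (k + 1)]; split; first by rewrite finite_setU; split; exact: finite_set1.
  by move=> _ [->|->].
move=> t st; have pt j : t @` H j = H j -> pres t j.
  move=> e n; apply/idP/idP => h.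
    have : (t @` H j) (t n) by rewrite e.
    by move=> [m jm /sym_inj <-].
  have : H j (t n) by rewrite -e; exists n.
  by [].
by apply: hV => //; apply/pt/st; [left|right].
Qed.

Lemma open_at (n m : int) : open [set s : symZN | s n = m].
Proof.
by apply: (@open_pres_left _ n) => s t /= sn h h'; rewrite symM (pres_fix h h').
Qed.

Lemma nbhs1_pres0 : nbhs (1%g : symZN) [set s | pres s 0].
Proof.
apply: open_nbhs_nbhs; split; last exact: pres1.
by apply: (@open_pres_left _ 0) => s t /= hs ht _; exact: presM.
Qed.

End symZN_theory.

(** * Elements of the commensurating full group as fields of permutations *)

Section fields_of_permutations.
Context {disp : measure_display} {X : measurableType disp} {R : realType}.
Context {mu : probability X R}.
Variable T : aut mu.
Notation Tp := (aut_pow T).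
Notation G := (comfg T).
Implicit Types S V : G.

Definition psi S (x : X) : symZN := L0_fun (Phi S) x.

Definition act S : nonsing mu := aut_repr (val S).

Lemma psi_cocycle S : exists c, is_cocycle T (val S) c /\
  \forall x \ae mu, forall n, psi S x n = cocycle_perm T c x n.
Proof. exact: svalP (cid (Phi_subproof S)). Qed.

Lemma psi_orbit S : \forall x \ae mu, forall n, act S (Tp n x) = Tp (psi S x n) x.
Proof.
have [c [cS pS]] := psi_cocycle S.
by move: pS (cocycle_orbit cS); apply: filterS2 => x p o n; rewrite p o.
Qed.

Lemma measurable_L0 (f : L0 mu symZN) (V : set symZN) : open V ->
  measurable [set x | V (L0_fun f x)].
Proof.
move=> oV; rewrite -[X in measurable X]setTI.
have mf := @measurable_funPT _ _ X (borel_type symZN) (repr f).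
by apply: (mf measurableT); apply: sub_gen_smallest.
Qed.

Lemma measurable_psi_eq S n m : measurable [set x | psi S x n = m].
Proof. exact: (measurable_L0 (Phi S) (@open_at n m)). Qed.

Lemma measurable_psi S n (P : int -> Prop) : measurable [set x | P (psi S x n)].
Proof.
rewrite (_ : mkset _ = [set x | exists m, [set _ : X | P m] x /\ psi S x n = m]).
  apply: measurable_exists => m.
  apply: (@measurableI _ _ [set _ : X | P m] [set x | psi S x n = m]).
    exact: measurable_const.
  exact: measurable_psi_eq.
by apply/seteqP; split=> x /=; [exists (psi S x n)|move=> [m [? ->]]].
Qed.

Lemma measurable_pres S k : measurable [set x | pres (psi S x) k].
Proof.
apply: measurable_forall => n.
exact: (measurable_psi S n (fun m => (k <= m) = (k <= n))).
Qed.

(** The equivariance of the field [psi S]. *)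
Lemma psi_shift S : \forall x \ae mu, forall k n, psi S (Tp k x) n = psi S x (n + k) - k.
Proof.
have [c [cS pS]] := psi_cocycle S.
move: (ae_orbit T pS); apply: filterS => x p k n.
rewrite p -[in RHS](aut_pow0 T x) p aut_pow0 /cocycle_perm -aut_powD.
by rewrite addrAC addrK.
Qed.

Lemma pres_shift S : \forall x \ae mu, forall k j,
  pres (psi S (Tp k x)) j <-> pres (psi S x) (j + k).
Proof.
move: (psi_shift S); apply: filterS => x h k j; split=> p n.
  by have := p (n - k); rewrite h subrK; lia.
by rewrite h; have := p (n + k); lia.
Qed.

Hypothesis T_aperiodic : \forall x \ae mu, forall j k, Tp j x = Tp k x -> j = k.

Lemma psi_unique S : \forall x \ae mu, forall (f : int -> int),
  (forall n, act S (Tp n x) = Tp (f n) x) -> forall n, psi S x n = f n.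
Proof.
move: (psi_orbit S) T_aperiodic; apply: filterS2 => x o ap f hf n.
by apply: ap; rewrite -o hf.
Qed.

Lemma psiM S V : \forall x \ae mu, psi (S * V)%g x = (psi S x * psi V x)%g.
Proof.
have h := ae_orbit T (autM (val S) (val V)).
have hSV : \forall x \ae mu, (forall n, act S (Tp n x) = Tp (psi S x n) x) /\
    (forall n, act V (Tp n x) = Tp (psi V x n) x).
  by move: (psi_orbit S) (psi_orbit V); apply: filterS2 => x.
move: h hSV (psi_unique (S * V)%g); apply: filterS3 => x h [hS hV] hu.
by apply: sym_ext; apply: hu => n; rewrite symM -hS -hV; exact: h.
Qed.

Lemma psi_comm S V : \forall x \ae mu, psi [~ S, V]%g x =
  (psi (S^-1)%g x * (psi (V^-1)%g x * (psi S x * psi V x)))%g.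
Proof.
rewrite /commg /conjg.
move: (psiM S V) (psiM (V^-1)%g (S * V)%g) (psiM (S^-1)%g (V^-1 * (S * V))%g).
by apply: filterS3 => x -> -> ->.
Qed.

Lemma psi1 : \forall x \ae mu, psi 1%g x = 1%g.
Proof.
apply: filterS (psiM 1%g 1%g) => x; rewrite mulg1 => e.
by apply: (@mulgI _ (psi 1%g x)); rewrite mulg1 -e.
Qed.

Lemma psiV S : \forall x \ae mu, psi (S^-1)%g x = ((psi S x)^-1)%g.
Proof.
move: (psiM (S^-1)%g S) psi1; apply: filterS2 => x; rewrite mulVg => e1 e2.
by apply: (@mulIg _ (psi S x)); rewrite -e1 e2 mulVg.
Qed.

Lemma psiX S n : \forall x \ae mu, psi (S ^+ n)%g x = (psi S x ^+ n)%g.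
Proof.
elim: n => [|n IH]; first by apply: filterS psi1 => x ->; rewrite !expg0.
by rewrite expgS; move: (psiM S (S ^+ n)%g) IH; apply: filterS2 => x -> ->; rewrite expgS.
Qed.

Lemma psi_expgz S i : \forall x \ae mu, psi (expgz S i) x = expgz (psi S x) i.
Proof.
case: i => n; first exact: psiX.
move: (psiV (S ^+ n.+1)%g) (psiX S n.+1); apply: filterS2 => x; rewrite /expgz.
by move=> -> ->.
Qed.

Lemma psi_ext S V : (\forall x \ae mu, forall n, psi S x n = psi V x n) -> S = V.
Proof.
move=> h; apply: val_inj; apply/autP.
move: h (psi_orbit S) (psi_orbit V); apply: filterS3 => x h hS hV.
by have := hS 0; have := hV 0; rewrite /act aut_pow0 h => -> ->.
Qed.

(** The points [x] for which [cocycle_perm T c x] is a permutation form an invariant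
    set, on which [x |-> T^(c x) x] is a bijection; its inverse is read off the
    inverse permutations. *)
Lemma psi_of_perm (c : X -> int) : (forall k, measurable (c @^-1` [set k])) ->
  (\forall x \ae mu, in_symZN (cocycle_perm T c x)) ->
  exists S, \forall x \ae mu, forall n, psi S x n = cocycle_perm T c x n.
Proof.
move=> mc hc.
have mcp n m : measurable [set x | cocycle_perm T c x n = m].
  rewrite (_ : mkset _ = [set x | (c @^-1` [set m - n]) (Tp n x)]).
    exact: measurable_aut_pow.
  by apply/seteqP; split=> x; rewrite /cocycle_perm/=; lia.
(* [Z] is invariant everywhere and not only almost everywhere, so that [f] and
   [g] below are inverse to each other on all of [X] *)
pose Z := [set x | (forall m n, cocycle_perm T c x m = cocycle_perm T c x n -> m = n) /\
  (forall m, exists n, cocycle_perm T c x n = m)].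
have shift x k n : cocycle_perm T c (Tp k x) n = cocycle_perm T c x (n + k) - k.
  by rewrite /cocycle_perm -aut_powD addrAC addrK.
have ZT x k : Z x -> Z (Tp k x).
  move=> [inj sur]; split=> [m n|m].
    by rewrite !shift => e; have := inj (m + k) (n + k); lia.
  by have [n nm] := sur (m + k); exists (n - k); rewrite shift subrK nm addrK.
have mZ : measurable Z.
  apply: (@measurableI _ _
    [set x | forall m n, cocycle_perm T c x m = cocycle_perm T c x n -> m = n]
    [set x | forall m, exists n, cocycle_perm T c x n = m]).
    apply: measurable_forall => m; apply: measurable_forall => n.
    have [->|mn] := eqVneq m n.
      by rewrite (_ : mkset _ = setT)//; apply/seteqP; split.
    rewrite (_ : mkset _ = [set x | ~ exists k, cocycle_perm T c x m = k /\
        cocycle_perm T c x n = k]).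
      apply: measurable_not; apply: measurable_exists => k.
      by apply: (measurableI _ _ (mcp m k) (mcp n k)).
    apply/seteqP; split=> x /= => [h [k [h1 h2]]|h e].
      by move/eqP: mn; apply; apply: h; rewrite h1 h2.
    by exfalso; apply: h; exists (cocycle_perm T c x n).
  by apply: measurable_forall => m; apply: measurable_exists => n.
have exm x : exists m, Z x -> m + c (Tp m x) = 0.
  have [Zx|nZ] := pselect (Z x); last by exists 0.
  by have [m hm] := Zx.2 0; exists m.
pose m_ x := sval (cid (exm x)).
have mP x : Z x -> m_ x + c (Tp (m_ x) x) = 0 by rewrite /m_; case: cid.
pose f x := if `[< Z x >] then Tp (c x) x else x.
pose g x := if `[< Z x >] then Tp (m_ x) x else x.
have fZ x : Z x -> f x = Tp (c x) x by move=> Zx; rewrite /f ifT//; exact/asboolP.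
have fN x : ~ Z x -> f x = x by move=> Zx; rewrite /f ifF//; exact/asboolP.
have gZ x : Z x -> g x = Tp (m_ x) x by move=> Zx; rewrite /g ifT//; exact/asboolP.
have gN x : ~ Z x -> g x = x by move=> Zx; rewrite /g ifF//; exact/asboolP.
have fK : cancel f g.
  move=> x; have [Zx|Zx] := pselect (Z x); last by rewrite fN// gN.
  rewrite fZ// gZ; last exact: ZT.
  have h := mP _ (ZT x (c x) Zx).
  have e : m_ (Tp (c x) x) = - c x.
    move: h; rewrite -aut_powD => h.
    have := Zx.1 (m_ (Tp (c x) x) + c x) 0.
    rewrite /cocycle_perm aut_pow0 add0r => h'.
    by have := h' ltac:(lia); lia.
  by rewrite e aut_powNK.
have gK : cancel g f.
  move=> x; have [Zx|Zx] := pselect (Z x); last by rewrite gN// fN.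
  rewrite gZ// fZ; last exact: ZT.
  by rewrite -aut_powD addrC mP.
have preim (h : X -> X) (c' : X -> int) (A : set X) : measurable A ->
    (forall k, measurable [set x | Z x /\ c' x = k]) ->
    (forall x, Z x -> h x = Tp (c' x) x) -> (forall x, ~ Z x -> h x = x) ->
    measurable (h @^-1` A).
  move=> mA mc' hZ hN.
  rewrite (_ : h @^-1` A = ([set x | exists k, [set x | Z x /\ c' x = k] x /\
      [set x | A (Tp k x)] x]) `|` ([set x | ~ Z x] `&` A)).
    apply: measurableU; last by apply: measurableI => //; exact: measurableC.
    apply: measurable_exists => k.
    apply: (@measurableI _ _ [set x | Z x /\ c' x = k] [set x | A (Tp k x)]) => //.
    exact: measurable_aut_pow.
  apply/seteqP; split=> x /=.
    have [Zx|nZ] := pselect (Z x); first by rewrite hZ// => Ax; left; exists (c' x).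
    by rewrite hN//; right.
  by move=> [[k [[Zx <-] Ax]]|[nZ Ax]]; [rewrite hZ|rewrite hN].
have mfA A : measurable A -> measurable (f @^-1` A).
  move=> mA; apply: (preim f c) => //.
  by move=> k; apply: (@measurableI _ _ Z (c @^-1` [set k])).
have mgA A : measurable A -> measurable (g @^-1` A).
  move=> mA; apply: (preim g m_) => // k.
  rewrite (_ : mkset _ = Z `&` [set x | cocycle_perm T c x k = 0]).
    exact: measurableI.
  apply/seteqP; split=> x /= [Zx e]; split=> //.
    by rewrite -e; exact: mP.
  by apply: Zx.1; rewrite e; exact: mP.
have aeA (A : set X) (h : X -> X) (k_ : X -> int) : (forall x, Z x -> h x = Tp (k_ x) x) ->
    (forall x, ~ Z x -> h x = x) -> (\forall x \ae mu, ~ A x) ->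
    \forall x \ae mu, ~ A (h x).
  move=> hZ hN /(ae_orbit T); apply: filterS => x nA.
  have [Zx|nZ] := pselect (Z x); first by rewrite hZ.
  by rewrite hN//; exact: (nA 0).
pose b : Defs.bij X := Defs.Bij fK gK.
have nb : [set f | nonsingular mu f] b.
  split.
  - by move=> _ A mA; rewrite setTI; exact: mfA.
  - by move=> _ A mA; rewrite setTI; exact: mgA.
  move=> A mA; rewrite /pushforward; split=> [h|h].
    have : pr mu (f @^-1` A) = 0 by rewrite /pr [X in fine X](_ : _ = 0%E).
    move/pr0P => /(_ (mfA _ mA)) => h'.
    have : \forall x \ae mu, ~ A (f (g x)) by exact: (aeA (f @^-1` A) g m_ gZ gN h').
    under eq_near do rewrite gK.
    by move/pr0P => /(_ mA); rewrite prE// => ->.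
  have : pr mu A = 0 by rewrite /pr [X in fine X](_ : _ = 0%E).
  move/pr0P => /(_ mA) h'.
  have : \forall x \ae mu, ~ A (f x) by exact: (aeA A f c fZ fN h').
  move/(@pr0P _ _ _ mu (f @^-1` A)) => /(_ (mfA _ mA)).
  by have := prE mu (mfA _ mA) => -> ->.
pose F : nonsing mu := exist _ b (mem_set nb).
pose S0 : aut mu := (\pi_(aut mu) F)%qT.
have aeZ : \forall x \ae mu, Z x.
  by apply: filterS hc => x /in_symZNP[inj sur _].
have S0c : is_cocycle T S0 c.
  split=> //; move: (aut_pi F) aeZ; apply: filterS2 => x -> Zx.
  by rewrite -[LHS]/(f x) /f ifT//; exact/asboolP.
have S0com : S0 \in com_full_group T.
  by apply/mem_set; split; [exact: cocycle_full S0c|exists c].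
exists (exist _ S0 S0com : G).
move: (psi_unique (exist _ S0 S0com : G)) (cocycle_orbit S0c).
by apply: filterS2 => x u o n; exact: u.
Qed.

(** By equivariance the field is determined by its value at 0, which serves as the
    cocycle. *)
Lemma psi_build (f : X -> int -> int) : (forall m, measurable [set x | f x 0 = m]) ->
  (\forall x \ae mu, forall n, f (Tp n x) 0 = f x n - n) ->
  (\forall x \ae mu, in_symZN (f x)) ->
  exists S, \forall x \ae mu, forall n, psi S x n = f x n.
Proof.
move=> mf ef hf.
have [] := @psi_of_perm (fun x => f x 0).
- by move=> k; exact: mf.
- move: ef hf; apply: filterS2 => x e [s sE]; exists s => n.
  by rewrite sE /cocycle_perm e addrC subrK.
- move=> S hS; exists S; move: ef hS; apply: filterS2 => x e hS n.
  by rewrite hS /cocycle_perm e addrC subrK.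
Qed.

End fields_of_permutations.

(** * Groups topologized by a length function *)

Section length_groups.
Context {R : realType} {G : groupTopologyType}.
Variable len : G -> R.

Definition len_dist (x y : G) : R := len (x^-1 * y)%g.

(** The last condition makes right translations, hence all the group
    operations, continuous for the left-invariant distance [len_dist]. *)
Definition length_group : Prop :=
  [/\ (forall x, len x = 0 <-> x = 1%g) /\ (forall x, len (x^-1)%g = len x),
      forall x y, len (x * y)%g <= len x + len y,
      forall g e, 0 < e -> exists2 d, 0 < d &
        forall x, len x < d -> len (g^-1 * x * g)%g < e &
      @open G = metric_open len_dist].

Hypothesis lenG : length_group.

Lemma len1 : len 1%g = 0.
Proof. by case: lenG => -[h _] _ _ _; apply/h. Qed.

Lemma len_eq0 x : len x = 0 -> x = 1%g.
Proof. by case: lenG => -[h _] _ _ _ /h. Qed.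

Lemma lenV x : len (x^-1)%g = len x.
Proof. by case: lenG => -[_ h]. Qed.

Lemma lenM x y : len (x * y)%g <= len x + len y.
Proof. by case: lenG. Qed.

Lemma len_ge0 x : 0 <= len x.
Proof. by have := lenM x (x^-1)%g; rewrite mulgV len1 lenV; lra. Qed.

Lemma len_conj g e : 0 < e -> exists2 d, 0 < d &
  forall x, len x < d -> len (g^-1 * x * g)%g < e.
Proof. by case: lenG => _ _ h _; exact: h. Qed.

Lemma len_distE x y z : len (x^-1 * z)%g <= len (x^-1 * y)%g + len (y^-1 * z)%g.
Proof. by rewrite (le_trans _ (lenM _ _))// mulgA -(mulgA _ y) mulgV mulg1. Qed.

Lemma len_dist_metric : is_metric len_dist.
Proof.
split=> [x y|x y|x y z]; last exact: len_distE.
- split=> [/len_eq0 e|->]; last by rewrite /len_dist mulVg len1.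
  by apply: (@mulgI _ (x^-1)%g); rewrite e mulVg.
- by rewrite /len_dist -[in RHS]lenV invgM invgK.
Qed.

Lemma len_dist_left_invariant : left_invariant len_dist.
Proof.
by move=> g h k; rewrite /len_dist invgM -mulgA (mulgA (g^-1)%g) mulVg mul1g.
Qed.

Lemma len_dist_compatible : compatible_metric len_dist.
Proof. by split; [exact: len_dist_metric|case: lenG]. Qed.

Lemma len_distxx x : len_dist x x = 0.
Proof. by rewrite /len_dist mulVg len1. Qed.

Lemma len_distC x y : len_dist x y = len_dist y x.
Proof. by have [_ h _] := len_dist_metric. Qed.

Lemma len_ball_open x e : open [set y | len_dist x y < e].
Proof.
case: lenG => _ _ _ ->; move=> y /= xy; exists (e - len_dist x y); first by rewrite subr_gt0.
by move=> z yz; have := len_distE x y z; move: xy yz; rewrite /len_dist; lra.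
Qed.

Lemma nbhs_len x (A : set G) :
  nbhs x A <-> exists2 e, 0 < e & forall y, len_dist x y < e -> A y.
Proof.
rewrite nbhsE; split=> [[V [oV Vx] VA]|[e e0 hA]].
  move: oV; case: lenG => _ _ _ ->; move=> /(_ x Vx)[e e0 eV].
  by exists e => // y /eV/VA.
exists [set y | len_dist x y < e] => //; split; first exact: len_ball_open.
by rewrite /= len_distxx.
Qed.

Lemma closure_len (A : set G) x :
  closure A x <-> forall e, 0 < e -> exists2 a, A a & len_dist x a < e.
Proof.
split=> [h e e0|h B /nbhs_len[e e0 eB]].
  have /h[a [Aa xa]] : nbhs x [set y | len_dist x y < e] by apply/nbhs_len; exists e.
  by exists a.
by have [a Aa xa] := h e e0; exists a; split=> //; exact: eB.
Qed.

Lemma len_mul_continuous x y e : 0 < e -> exists2 d, 0 < d & forall x' y',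
  len_dist x x' < d -> len_dist y y' < d -> len_dist (x * y)%g (x' * y')%g < e.
Proof.
move=> e0; have e20 : 0 < e / 2 by rewrite divr_gt0.
have [d d0 hd] := len_conj y e20.
exists (Num.min d (e / 2)); first by rewrite lt_min d0.
move=> x' y'; rewrite !lt_min => /andP[/hd xd _] /andP[_ yd].
rewrite [e]splitr; apply: le_lt_trans (ltrD xd yd); rewrite (le_trans _ (lenM _ _))//.
by rewrite /len_dist invgM !mulgA mulgK.
Qed.

Lemma len_inv_continuous x e : 0 < e -> exists2 d, 0 < d & forall x',
  len_dist x x' < d -> len_dist (x^-1)%g (x'^-1)%g < e.
Proof.
move=> e0; have [d d0 hd] := len_conj (x^-1)%g e0.
exists d => // x' /hd; rewrite !invgK !mulgA mulgV mul1g.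
by rewrite -[X in X < _]lenV invgM !invgK /len_dist invgK.
Qed.

Lemma length_topological_group : topological_group G.
Proof.
split=> [[x y]|x] A /nbhs_len[e e0 eA].
  have [d d0 hd] := len_mul_continuous x y e0.
  exists ([set x' | len_dist x x' < d], [set y' | len_dist y y' < d]) => /=.
    by split; apply/nbhs_len; exists d.
  by move=> [x' y'] /= [xd yd]; apply: eA; exact: hd.
have [d d0 hd] := len_inv_continuous x e0.
by apply/nbhs_len; exists d => // y /hd/eA.
Qed.

Lemma closure_subgroup (D : set G) : is_subgroup D -> is_subgroup (closure D).
Proof.
move=> [D1 DM DV]; split; first exact: subset_closure.
- move=> x y /closure_len Dx /closure_len Dy; apply/closure_len => e e0.
  have [d d0 hd] := len_mul_continuous x y e0.
  have [a Da xa] := Dx d d0; have [b Db yb] := Dy d d0.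
  by exists (a * b)%g; [exact: DM|exact: hd].
- move=> x /closure_len Dx; apply/closure_len => e e0.
  have [d d0 hd] := len_inv_continuous x e0.
  by have [a Da xa] := Dx d d0; exists (a^-1)%g; [exact: DV|exact: hd].
Qed.

(** Adding the right-invariant distance turns [len_dist] into a distance for the
    two-sided uniformity. *)
Definition two_sided_dist (x y : G) : R := len_dist x y + len_dist (x^-1)%g (y^-1)%g.

Lemma len_dist_ge0 x y : 0 <= len_dist x y.
Proof. exact: len_ge0. Qed.

(** Convergence for [len_dist] suffices, inversion being continuous. *)
Definition two_sided_complete : Prop := forall u : nat -> G,
  (forall e : R, 0 < e -> exists N, forall m n,
    (N <= m)%N -> (N <= n)%N -> two_sided_dist (u m) (u n) < e) ->
  exists l, forall e : R, 0 < e -> exists N, forall n, (N <= n)%N -> len_dist (u n) l < e.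

Lemma length_polish_space :
  metric_separable len_dist -> two_sided_complete -> polish_space R G.
Proof.
move=> [Q cQ hQ] complete; have [d0 dC dT] := len_dist_metric.
have small x e : 0 < e -> exists2 d, 0 < d & forall y,
    len_dist x y < d -> two_sided_dist x y < e.
  move=> e0; have e20 : 0 < e / 2 by rewrite divr_gt0.
  have [d d_0 hd] := len_inv_continuous x e20.
  exists (Num.min d (e / 2)); first by rewrite lt_min d_0.
  move=> y; rewrite lt_min => /andP[/hd xd yd].
  by rewrite [e]splitr /two_sided_dist; exact: ltrD.
have metric : is_metric two_sided_dist.
  split=> [x y|x y|x y z].
  - split=> [h|->]; last by rewrite /two_sided_dist !len_distxx addr0.
    by apply/d0; have := len_dist_ge0 x y; have := len_dist_ge0 (x^-1)%g (y^-1)%g;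
      move: h; rewrite /two_sided_dist; lra.
  - by rewrite /two_sided_dist dC (dC (x^-1)%g).
  - have := dT x y z; have := dT (x^-1)%g (y^-1)%g (z^-1)%g.
    by rewrite /two_sided_dist; lra.
have le2 x y : len_dist x y <= two_sided_dist x y by rewrite lerDl len_dist_ge0.
exists two_sided_dist.
  split=> //; case: lenG => _ _ _ ->; apply/seteqP; split=> A hA x /hA[e e0 eA].
    by exists e => // y /(le_lt_trans (le2 _ _)); exact: eA.
  by have [d d_0 hd] := small x e e0; exists d => // y /hd/eA.
split=> //.
  move=> u /complete[l hl]; exists l => e e0.
  have [d d_0 hd] := small l e e0; have [N hN] := hl d d_0.
  exists N => n /hN ul; have [_ C _] := metric; rewrite C; apply: hd.
  by rewrite len_distC.
exists Q => // x e e0; have [d d_0 hd] := small x e e0.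
by have [q Qq xq] := hQ x d d_0; exists q => //; exact: hd.
Qed.

Lemma length_bounded_group (M : R) : (forall x, len x <= M) ->
  (forall d' : G -> G -> R, compatible_metric d' -> left_invariant d' ->
     bounded_metric d') ->
  bounded_group R G.
Proof.
move=> lM hb; exists len_dist; first by exists M => x y; exact: lM.
split; [exact: len_dist_compatible|exact: len_dist_left_invariant|].
move=> d' cd' ld'; have [C hC] := hb d' cd' ld'.
exists (Num.max C 1); first by rewrite lt_max ltr01 orbT.
move=> g h; rewrite (le_trans (hC g h))// (@le_trans _ _ (Num.max C 1))//.
  by rewrite le_max lexx.
by rewrite lerDr mulr_ge0 ?len_dist_ge0// le_max ler01 orbT.
Qed.

End length_groups.

Section subgroups_of_length_groups.
Context {R : realType} {G : groupTopologyType}.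
Variables (len : G -> R) (lenG : length_group len) (H : subgroup G).

Definition sub_len (x : subgroup_type H) : R := len (val x).

Lemma sub_lenE (x y : subgroup_type H) : len_dist sub_len x y = len_dist len (val x) (val y).
Proof. by []. Qed.

Lemma sub_valM (x y : subgroup_type H) : val (x * y)%g = (val x * val y)%g.
Proof. by []. Qed.

Lemma sub_two_sidedE (x y : subgroup_type H) :
  two_sided_dist sub_len x y = two_sided_dist len (val x) (val y).
Proof. by []. Qed.

Lemma sub_two_sided_complete : closed (subgroup_set H) -> two_sided_complete len ->
  two_sided_complete sub_len.
Proof.
move=> cH complete u cauchy; have [e /cauchy[N hN]|l hl] := complete (fun n => val (u n)).
  by exists N => m n Nm Nn; rewrite -sub_two_sidedE; exact: hN.
have Hl : subgroup_set H l.
  apply: cH; apply/(closure_len lenG) => e e0; have [N hN] := hl e e0.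
  exists (val (u N)); first by have /set_mem := valP (u N).
  by rewrite (len_distC lenG); exact: hN.
by exists (exist _ l (mem_set Hl) : subgroup_type H).
Qed.

Lemma sub_length_group : length_group sub_len.
Proof.
split.
- split=> x; last exact: (lenV lenG).
  split=> [/(len_eq0 lenG) h|->]; last exact: (len1 lenG).
  exact: val_inj.
- by move=> x y; exact: (lenM lenG).
- move=> g e e0; have [d d0 hd] := len_conj lenG (val g) e0.
  by exists d => // x /hd.
- apply/seteqP; split=> [_ [A oA <-]|A hA].
    case: lenG => _ _ _ oE; move: oA; rewrite oE => oA x /oA[e e0 eA].
    by exists e => // y /eA.
  pose V := \bigcup_(p in [set p : subgroup_type H * R |
      forall y, len_dist sub_len p.1 y < p.2 -> A y])
    [set z | len_dist len (val p.1) z < p.2].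
  exists V; first by apply: bigcup_open => p _; exact: len_ball_open.
  apply/seteqP; split=> x /=.
    by move=> [p hp xp]; exact: hp.
  move=> /hA[e e0 eA]; exists (x, e) => //=.
  by rewrite (len_distxx lenG).
Qed.

End subgroups_of_length_groups.

(** * The length function of the commensurating full group *)

Section half_line_length.
Context {disp : measure_display} {X : measurableType disp} {R : realType}.
Context {mu : probability X R}.
Variable T : aut mu.
Notation Tp := (aut_pow T).
Notation G := (comfg T).
Notation psi := (@psi disp X R mu T).
Implicit Types (S V : G) (e : R).
Hypothesis T_aperiodic : \forall x \ae mu, forall j k, Tp j x = Tp k x -> j = k.

Definition broken S : set X := [set x | ~ pres (psi S x) 0].

(** By equivariance the half-line starting at [0] controls all the others, so
    that this single set of points suffices to define the topology. *)
Definition len S : R := pr mu (broken S).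

Lemma measurable_broken S : measurable (broken S).
Proof. by apply: measurable_not; exact: measurable_pres. Qed.

Lemma len_le_pr S (A : set X) : measurable A ->
  (\forall x \ae mu, ~ pres (psi S x) 0 -> A x) -> len S <= pr mu A.
Proof. by move=> mA h; apply: ae_le_pr => //; exact: measurable_broken. Qed.

Lemma comfg_len_le1 S : len S <= 1.
Proof. by apply: pr_le1; exact: measurable_broken. Qed.

Lemma comfg_len_eq0 S : len S = 0 -> S = 1%g.
Proof.
move=> /pr0P-/(_ (measurable_broken S)) /(ae_orbit T) h.
apply: psi_ext; move: h (pres_shift S) (psi1 T_aperiodic).
apply: filterS3 => x h sh -> n; rewrite sym1.
by apply: pres_fix; have := sh; [move=> /(_ n 0)|move=> /(_ (n + 1) 0)];
  rewrite add0r => -[+ _]; apply; exact: contrapT (h _).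
Qed.

Lemma comfg_len1 : len 1%g = 0.
Proof.
apply/pr0P; first exact: measurable_broken.
by apply: filterS (psi1 T_aperiodic) => x; rewrite /broken/= => ->; apply; exact: pres1.
Qed.

Lemma comfg_lenM S V : len (S * V)%g <= len S + len V.
Proof.
apply: le_trans (prU _ (measurable_broken S) (measurable_broken V)).
apply: len_le_pr; first by apply: measurableU; exact: measurable_broken.
apply: filterS (psiM T_aperiodic S V) => x ->.
have [hS|] := pselect (pres (psi S x) 0); last by left.
have [hV|] := pselect (pres (psi V x) 0); last by right.
by move=> h; exfalso; apply: h; exact: presM.
Qed.

Lemma comfg_lenV S : len (S^-1)%g = len S.
Proof.
suff le S' : len (S'^-1)%g <= len S'.
  by apply/eqP; rewrite eq_le le -[in X in X <= _](invgK S) le.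
apply: len_le_pr; first exact: measurable_broken.
apply: filterS (psiV T_aperiodic S') => x -> h h'; apply: h; exact: presV.
Qed.

Definition near_orbit (A : set X) (K : int) : set X :=
  [set x | exists k, `|k| <= K /\ A (Tp k x)].

Lemma measurable_near_orbit A K : measurable A -> measurable (near_orbit A K).
Proof.
move=> mA; apply: measurable_exists => k.
apply: (@measurableI _ _ [set _ : X | `|k| <= K] [set x | A (Tp k x)]).
  exact: (measurable_const (`|k| <= K)).
exact: measurable_aut_pow.
Qed.

(** Nonsingularity of the finitely many powers [T^k] with [|k| <= K]. *)
Lemma near_orbit_small (K : int) e : 0 < e -> exists2 d, 0 < d & forall A,
  measurable A -> pr mu A < d -> pr mu (near_orbit A K) < e.
Proof.
move=> e0; have [K0|K0] := ltP K 0.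
  exists 1 => // A _ _; rewrite (_ : near_orbit A K = set0) ?pr_set0//.
  by apply/seteqP; split=> // x [k [kK _]]; move: kK; lia.
rewrite -(gez0_abs K0); move: `|K|%N e e0 => {K0}{}K; elim: K => [|K IH] e e0.
  have [d d0 hd] := pr_abs_cont (Tp 0) e0; exists d => // A mA Ad.
  apply: le_lt_trans (hd A mA Ad); apply: le_pr.
  - exact: measurable_near_orbit.
  - exact: measurable_aut_pow.
  by move=> x [k [k0 Ak]]; rewrite /= (_ : 0 = k)//; lia.
have e30 : 0 < e / 3 by rewrite divr_gt0.
have [d d0 hd] := IH _ e30.
have [d1 d10 hd1] := pr_abs_cont (Tp K.+1%:Z) e30.
have [d2 d20 hd2] := pr_abs_cont (Tp (- K.+1%:Z)) e30.
exists (Num.min d (Num.min d1 d2)); first by rewrite !lt_min d0 d10.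
move=> A mA; rewrite !lt_min => /andP[/(hd _ mA) h /andP[/(hd1 _ mA) h1 /(hd2 _ mA) h2]].
have m1 := measurable_near_orbit K%:Z mA.
have m2 := measurable_aut_pow T K.+1%:Z mA.
have m3 := measurable_aut_pow T (- K.+1%:Z) mA.
have : pr mu (near_orbit A K.+1) <= pr mu (near_orbit A K `|`
    (Tp K.+1%:Z @^-1` A `|` Tp (- K.+1%:Z) @^-1` A)).
  apply: le_pr; [exact: measurable_near_orbit|by do ?apply: measurableU|].
  move=> x [k [kK Ak]].
  have [kK'|kK'] := leP `|k| K%:Z; first by left; exists k.
  right; have [k0|k0] := leP 0 k; [left|right].
    by rewrite /= (_ : K.+1%:Z = k)//; lia.
  by rewrite /= (_ : - K.+1%:Z = k)//; lia.
have := prU mu m1 (measurableU _ _ m2 m3); have := prU mu m2 m3.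
by move: h h1 h2; lra.
Qed.

Lemma len_half_lines S : \forall x \ae mu, forall K,
  ~ near_orbit (broken S) K x -> forall k, `|k| <= K -> pres (psi S x) k.
Proof.
apply: filterS (pres_shift S) => x sh K nx k kK.
have := sh k 0; rewrite add0r => -[+ _]; apply; apply: contrapT => h.
by apply: nx; exists k.
Qed.

Definition far_fixed S (K : int) : set X :=
  [set x | forall n, K <= `|n| -> (0 <= psi S x n) = (0 <= n)].

Lemma measurable_far_fixed S K : measurable (far_fixed S K).
Proof.
apply: measurable_forall => n.
have [Kn|Kn] := leP K `|n|.
  rewrite (_ : mkset _ = [set x | (0 <= psi S x n) = (0 <= n)]).
    exact: (measurable_psi S n (fun m => (0 <= m) = (0 <= n))).
  by apply/seteqP; split=> x /=; auto.
by rewrite (_ : mkset _ = setT)//; apply/seteqP; split.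
Qed.

Lemma far_fixed_large S e : 0 < e -> exists2 K, 0 <= K & pr mu (~` far_fixed S K) < e.
Proof.
move=> e0; have [] := @pr_decr_small _ _ _ mu (fun N => ~` far_fixed S N%:Z) _ _ _ e e0.
- by move=> N; apply: measurableC; exact: measurable_far_fixed.
- by move=> N; apply: subsetC => x h n Nn; apply: h; lia.
- apply: aeW => x; have [K K0 hK] := sym_bound (psi S x).
  by exists `|K|%N; apply => n Kn; apply: hK; lia.
by move=> N hN; exists N%:Z.
Qed.

(** Outside a set of small measure [S] moves the half-line within a bounded window
    only, and an element of small length preserves all half-lines starting in this
    window, except at few points. *)
Lemma comfg_len_conj S e : 0 < e -> exists2 d, 0 < d &
  forall V, len V < d -> len (S^-1 * V * S)%g < e.
Proof.
move=> e0; have e20 : 0 < e / 2 by rewrite divr_gt0.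
have [K K0 hK] := far_fixed_large (S^-1)%g e20.
have [d d0 hd] := near_orbit_small K e20.
exists d => // V /(hd _ (measurable_broken V)) hV.
have mC := measurableC (measurable_far_fixed (S^-1)%g K).
have mN := measurable_near_orbit K (measurable_broken V).
apply: (@le_lt_trans _ _ (pr mu (~` far_fixed (S^-1)%g K `|` near_orbit (broken V) K))); last first.
  by rewrite (le_lt_trans (prU _ _ _))// [e]splitr ltrD.
apply: len_le_pr; first exact: measurableU.
have hM : \forall x \ae mu, psi (S^-1 * V * S)%g x = ((psi S x)^-1 * psi V x * psi S x)%g.
  move: (psiM T_aperiodic (S^-1 * V)%g S) (psiM T_aperiodic (S^-1)%g V) (psiV T_aperiodic S).
  by apply: filterS3 => x -> -> ->.
move: hM (psiV T_aperiodic S) (len_half_lines V); apply: filterS3 => x -> eV hl h.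
have [fx|] := pselect (far_fixed (S^-1)%g K x); last by left.
right; apply: contrapT => nx; apply: h.
have near : near_natZ (psi S x @` natZ) K.
  by apply: near_natZ_image => n Kn; rewrite -eV; exact: fx.
have pn := pres_near K0 near (hl K nx).
have mem m : (psi S x @` natZ) m <-> 0 <= symZN_fun (psi S x)^-1%g m.
  split=> [[j j0 <-]|h]; first by rewrite symVK.
  by exists (symZN_fun (psi S x)^-1%g m) => //; rewrite symKV.
move=> n; rewrite !symM; apply/idP/idP.
  by move/mem/pn/mem; rewrite symVK.
by move=> n0; apply/mem/pn/mem; rewrite symVK.
Qed.

Lemma psi_dist S V : \forall x \ae mu, psi (S^-1 * V)%g x = ((psi S x)^-1 * psi V x)%g.
Proof.
by move: (psiM T_aperiodic (S^-1)%g V) (psiV T_aperiodic S); apply: filterS2 => x -> ->.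
Qed.

(** A neighborhood for convergence in measure contains a ball because it only
    involves the half-lines starting near 0. Conversely balls are pullbacks of open
    sets because preserving the half-line is an open condition. *)
Lemma open_comfg : @open G = metric_open (len_dist len).
Proof.
apply/seteqP; split=> [_ [Q oQ <-]|Q hQ].
  move=> S QS; have {}oQ : L0_open Q by exact: oQ.
  have [W [e [W1 e0] WQ]] := oQ _ QS.
  have [K K0 hK] := nbhs1_pres W1.
  have [d d0 hd] := near_orbit_small K e0.
  exists d => // V SV; apply: WQ.
  have [N [mN N0 hN]] : \forall x \ae mu, ~ near_orbit (broken (S^-1 * V)%g) K x ->
      W ((psi S x)^-1 * psi V x)%g.
    move: (len_half_lines (S^-1 * V)%g) (psi_dist S V).
    by apply: filterS2 => x hl <- /hl; exact: hK.
  have mO := measurable_near_orbit K (measurable_broken (S^-1 * V)%g).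
  exists (near_orbit (broken (S^-1 * V)%g) K `|` N); split.
  - exact: measurableU.
  - suff : pr mu (near_orbit (broken (S^-1 * V)%g) K `|` N) < e.
      by rewrite -pr_ltE//; exact: measurableU.
    rewrite (le_lt_trans (prU _ _ _))//.
    have -> : pr mu N = 0 by rewrite /pr [X in fine X](_ : _ = 0%E).
    by rewrite addr0; apply: hd => //; exact: measurable_broken.
  - move=> x /not_orP[nx /= nN]; apply: contrapT => nW; apply: nN; apply: hN => /= h.
    by apply: nW; exact: h.
pose P := [set s : symZN | pres s 0].
have oP S r : open (L0_nbhd (Phi S) P r).
  suff : L0_open (L0_nbhd (Phi S) P r) by [].
  move=> f [A [mA Ar hA]]; have {}Ar : pr mu A < r by rewrite -pr_ltE.
  exists P, (r - pr mu A); first by split; [exact: nbhs1_pres0|rewrite subr_gt0].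
  move=> g [B [mB Br hB]].
  have {}Br : pr mu B < r - pr mu A by rewrite -pr_ltE.
  exists (A `|` B); split; first exact: measurableU.
    suff : pr mu (A `|` B) < r by rewrite -pr_ltE//; exact: measurableU.
    by rewrite (le_lt_trans (prU _ _ _))// -ltrBrDl.
  move=> x /not_orP[/hA h1 /hB h2].
  have := presM h1 h2; rewrite /P/=.
  by rewrite mulgA -(mulgA _ _ (_^-1)%g) mulgV mulg1.
exists (\bigcup_(p in [set p : G * R | 0 < p.2 /\ forall V, len_dist len p.1 V < p.2 -> Q V])
   L0_nbhd (Phi p.1) P p.2).
  by apply: bigcup_open => p _; exact: oP.
apply/seteqP; split=> V /=.
  move=> [[S r] [r0 hr] [A [mA Ar hA]]]; apply: hr; rewrite /= in Ar hA *.
  have {}Ar : pr mu A < r by rewrite -pr_ltE.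
  apply: le_lt_trans Ar.
  apply: len_le_pr => //; apply: filterS (psi_dist S V) => x -> h.
  by apply: contrapT => /hA.
move=> /hQ[r r0 hr]; exists (V, r) => //.
exists set0; split; [exact: measurable0|by rewrite measure0 lte_fin|].
by move=> x _; rewrite /P/= mulVg; exact: pres1.
Qed.

Lemma comfg_length_group : length_group len.
Proof.
split.
- split=> S; last exact: comfg_lenV.
  by split=> [/comfg_len_eq0|->]; last exact: comfg_len1.
- exact: comfg_lenM.
- exact: comfg_len_conj.
- exact: open_comfg.
Qed.

End half_line_length.

(** * Restrictions to invariant sets and limits *)

Section restrictions.
Context {disp : measure_display} {X : measurableType disp} {R : realType}.
Context {mu : probability X R}.
Variable T : aut mu.
Notation Tp := (aut_pow T).
Notation G := (comfg T).
Notation psi := (@psi disp X R mu T).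
Notation len := (@len disp X R mu T).
Implicit Types (S V W : G) (e : R) (Y : set X).
Hypothesis T_aperiodic : \forall x \ae mu, forall j k, Tp j x = Tp k x -> j = k.

Definition invariant_under S Y : Prop :=
  \forall x \ae mu, forall n, Y (Tp (psi S x n) x) <-> Y (Tp n x).

Definition restricts S Y V : Prop :=
  \forall x \ae mu, forall n, psi V x n = if `[< Y (Tp n x) >] then psi S x n else n.

(** Restricting can only remove crossings of the origin. *)
Lemma restricts_exists S Y : measurable Y -> invariant_under S Y ->
  exists V, restricts S Y V.
Proof.
rewrite /invariant_under => mY iY; apply: (@psi_build _ _ _ _ T T_aperiodic
    (fun x n => if `[< Y (Tp n x) >] then psi S x n else n)).
- move=> m; rewrite (_ : mkset _ =
      (Y `&` [set x | psi S x 0 = m]) `|` (~` Y `&` [set _ | 0 = m])).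
    apply: measurableU; apply: measurableI => //.
    + exact: measurable_psi_eq.
    + exact: measurableC.
    + exact: (measurable_const (0 = m)).
  apply/seteqP; split=> x /=; rewrite aut_pow0.
    by case: asboolP; [left|right].
  by move=> [[Yx <-]|[nY <-]]; case: asboolP.
- apply: filterS (psi_shift S) => x sh n; rewrite aut_pow0 sh add0r.
  by case: asboolP => _ //; rewrite subrr.
- apply: filterS iY => x iY; have [K K0 hK] := sym_bound (psi S x).
  have iYV n : Y (Tp (symZN_fun (psi S x)^-1%g n) x) <-> Y (Tp n x).
    by rewrite -{2}(symKV (psi S x) n) iY.
  pose p n := if `[< Y (Tp n x) >] then psi S x n else n.
  pose q n := if `[< Y (Tp n x) >] then symZN_fun (psi S x)^-1%g n else n.
  have pT n : Y (Tp n x) -> p n = psi S x n by move=> Yn; rewrite /p asboolT.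
  have pF n : ~ Y (Tp n x) -> p n = n by move=> Yn; rewrite /p asboolF.
  have qT n : Y (Tp n x) -> q n = symZN_fun (psi S x)^-1%g n.
    by move=> Yn; rewrite /q asboolT.
  have qF n : ~ Y (Tp n x) -> q n = n by move=> Yn; rewrite /q asboolF.
  apply: (@in_symZN_bound p q K) => [n|n|n Kn].
  + have [Yn|Yn] := pselect (Y (Tp n x)); last by rewrite pF// qF.
    by rewrite pT// qT ?symVK ?iY.
  + have [Yn|Yn] := pselect (Y (Tp n x)); last by rewrite qF// pF.
    by rewrite qT// pT ?symKV ?iYV.
  + by rewrite /p; case: asboolP => _ //; exact: hK.
Qed.

Lemma restricts_mul S Y V W : invariant_under S Y ->
  restricts S Y W -> restricts S (~` Y) V -> S = (V * W)%g.
Proof.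
rewrite /invariant_under /restricts => iY hW hV; apply: (psi_ext (T := T)).
have hVW : \forall x \ae mu,
    (forall n, psi V x n = if `[< (~` Y) (Tp n x) >] then psi S x n else n) /\
    (forall n, psi W x n = if `[< Y (Tp n x) >] then psi S x n else n).
  by move: hV hW; apply: filterS2.
move: iY (psiM T_aperiodic V W) hVW; apply: filterS3 => x iY -> [hV' hW'] n.
rewrite symM hW'; have [Yn|Yn] := pselect (Y (Tp n x)).
  by rewrite asboolT// hV' asboolF//= => /(_ ((iY n).2 Yn)).
by rewrite (asboolF Yn) hV' asboolT.
Qed.

(** Only finitely many points of an orbit cross the origin, so a decreasing
    sequence of sets leaving almost every point eventually leaves all of them. *)
Lemma restricts_small S (Y : nat -> set X) (V : nat -> G) :
  (forall m, measurable (Y m)) -> (forall m, Y m.+1 `<=` Y m) ->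
  (\forall x \ae mu, exists m, ~ Y m x) -> (forall m, restricts S (Y m) (V m)) ->
  forall e, 0 < e -> exists m, len (V m) < e.
Proof.
rewrite /restricts => mY dY nY hV e e0.
pose A m := [set x | exists n, (0 <= psi S x n) <> (0 <= n) /\ Y m (Tp n x)].
have mA m : measurable (A m).
  apply: measurable_exists => n.
  apply: (@measurableI _ _ [set x | (0 <= psi S x n) <> (0 <= n)] [set x | Y m (Tp n x)]).
    exact: (measurable_psi S n (fun k => (0 <= k) <> (0 <= n))).
  exact: measurable_aut_pow.
have [m hm] : exists m, pr mu (A m) < e.
  apply: pr_decr_small => //.
    by move=> m x [n [cr /dY Yn]]; exists n.
  apply: filterS (ae_orbit T nY) => x hx.
  have [K K0 hK] := sym_bound (psi S x).
  have [m hm] := @decr_finite_common _ Y (fun i : nat => Tp (i%:Z - K) x) (absz (K + K)) dY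
    (fun i _ => hx (i%:Z - K)).
  exists m => -[n [cr Yn]]; have nK : `|n| < K by rewrite ltNge; apply/negP => /hK.
  by apply: (hm (absz (n + K))); [lia|rewrite (_ : _ - K = n)//; lia].
exists m; apply: le_lt_trans hm; apply: len_le_pr => //.
apply: filterS (hV m) => x hx h; apply: contrapT => nA; apply: h => n.
rewrite hx; case: asboolP => // Yn; apply: contrapT => cr; apply: nA.
by exists n.
Qed.

End restrictions.

(** * Exchanging two disjoint sets *)

Section swaps_of_integers.
Variables (e : int -> bool) (k l : int).

(** The exchange of [a] with its translate by [j]; an involution when the two are
    disjoint. *)
Definition zswap (a : int -> bool) (j n : int) : int :=
  if a n then n + j else if a (n - j) then n - j else n.

Lemma zswapK (a : int -> bool) j : (forall n, a n -> ~~ a (n + j)) ->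
  cancel (zswap a j) (zswap a j).
Proof.
move=> ha n; rewrite /zswap; case: (boolP (a n)) => an.
  by rewrite (negbTE (ha _ an)) addrK an.
case: (boolP (a (n - j))) => anj; first by rewrite anj subrK.
by rewrite (negbTE an) (negbTE anj).
Qed.

Let a n := e n || e (n - l).
Let b n := e n || e (n - k).

Hypotheses (he : forall n, e n -> ~~ e (n + l)) (ha : forall n, a n -> ~~ a (n + k)).

Let disjoint u v : e u -> e v ->
  [/\ u - v != k, u - v != l, u - v != k + l & u - v != k - l].
Proof.
move=> eu ev; split; apply/negP => /eqP h.
- by have := @ha v; rewrite /a ev (_ : v + k = u) ?eu => [/(_ isT)|]; lia.
- by have := @he v; rewrite ev (_ : v + l = u) ?eu => [/(_ isT)|]; lia.
- have := @ha (v + l); rewrite /a addrK ev orbT (_ : v + l + k = u) ?eu => [/(_ isT)|]; lia.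
- have := @ha v; rewrite /a ev (_ : v + k = u + l) ?addrK ?eu ?orbT => [/(_ isT)|]; lia.
Qed.

Let off u d : e u -> d \in [:: k; l; k + l; k - l; - k; - l; - (k + l); l - k] ->
  e (u + d) = false.
Proof.
move=> eu hd; apply/negP => ed; have [] := disjoint ed eu; have [] := disjoint eu ed.
by move: hd; rewrite !inE; lia.
Qed.

Lemma zswap_disjoint n : b n -> ~~ b (n + l).
Proof.
by rewrite /b => /orP[] h; rewrite negb_or; apply/andP; split; apply/negP => h';
  have [] := disjoint h h'; have [] := disjoint h' h; lia.
Qed.

(** The commutator of the exchange of [e] with [e + k] and of the exchange of
    both with their translates by [l] exchanges [e] and [e + l] with their
    translates by [k]. *)
Lemma zswap_commutator n : zswap e k (zswap b l (zswap e k (zswap b l n))) = zswap a k n.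
Proof.
have at_ u v : e u -> v - u \in [:: k; l; k + l; k - l; - k; - l; - (k + l); l - k] ->
    e v = false.
  by move=> eu /(off eu); rewrite addrC subrK.
have step u : e u -> [/\ zswap e k u = u + k, zswap e k (u + k) = u,
    zswap e k (u + l) = u + l & zswap e k (u + k + l) = u + k + l].
  move=> eu; rewrite /zswap eu addrK eu.
  by rewrite !(@at_ u (_ + _) eu) ?inE; try (by split); lia.
have stepb u : e u -> [/\ zswap b l u = u + l, zswap b l (u + l) = u,
    zswap b l (u + k) = u + k + l & zswap b l (u + k + l) = u + k].
  move=> eu; rewrite /zswap /b !addrK eu ?orbT /=.
  by rewrite !(@at_ u (_ + _) eu) ?inE; try (by split); lia.
have stepa u : e u -> [/\ zswap a k u = u + k, zswap a k (u + k) = u,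
    zswap a k (u + l) = u + l + k & zswap a k (u + k + l) = u + l].
  move=> eu; rewrite /zswap /a (addrAC u k l) !addrK eu ?orbT /=.
  by rewrite !(@at_ u (_ + _) eu) ?inE; try (by split); lia.
have [en|ne0] := boolP (e n).
  have [h1 h2 h3 h4] := step _ en; have [g1 g2 g3 g4] := stepb _ en.
  by have [-> _ _ _] := stepa _ en; rewrite g1 h3 g2.
have [en|ne1] := boolP (e (n - k)).
  move: (n - k) (subrK k n) en => u <- eu.
  have [h1 h2 h3 h4] := step _ eu; have [g1 g2 g3 g4] := stepb _ eu.
  by have [_ -> _ _] := stepa _ eu; rewrite g3 h4 g4 h2.
have [en|ne2] := boolP (e (n - l)).
  move: (n - l) (subrK l n) en => u <- eu.
  have [h1 h2 h3 h4] := step _ eu; have [g1 g2 g3 g4] := stepb _ eu.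
  by have [_ _ -> _] := stepa _ eu; rewrite g2 h1 g3 h4 addrAC.
have [en|ne3] := boolP (e (n - k - l)).
  have E : n - k - l + k + l = n by lia.
  move: (n - k - l) E en => u <- eu.
  have [h1 h2 h3 h4] := step _ eu; have [g1 g2 g3 g4] := stepb _ eu.
  by have [_ _ _ ->] := stepa _ eu; rewrite g4 h2 g1 h3.
have fe : zswap e k n = n by rewrite /zswap (negbTE ne0) (negbTE ne1).
have fb : zswap b l n = n.
  rewrite /zswap /b (negbTE ne0) (negbTE ne1) (negbTE ne2) /=.
  by rewrite (_ : n - l - k = n - k - l) ?(negbTE ne3)//; lia.
by rewrite fb fe fb fe /zswap /a (negbTE ne0) (negbTE ne1) (negbTE ne2) (negbTE ne3).
Qed.

End swaps_of_integers.

(** * Involutions lie in the closure of the derived subgroup *)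

Section swaps.
Context {disp : measure_display} {X : measurableType disp} {R : realType}.
Context {mu : probability X R}.
Variable T : aut mu.
Notation Tp := (aut_pow T).
Notation G := (comfg T).
Notation psi := (@psi disp X R mu T).
Notation len := (@len disp X R mu T).
Implicit Types (S V W : G) (e : R) (A E F : set X).
Hypothesis T_aperiodic : \forall x \ae mu, forall j k, Tp j x = Tp k x -> j = k.

Definition visits E (x : X) (n : int) : bool := `[< E (Tp n x) >].

Definition is_swap E k S : Prop :=
  \forall x \ae mu, forall n, psi S x n = zswap (visits E x) k n.

Definition avoids E k : Prop := forall x, E x -> ~ E (Tp k x).

Lemma avoids_visits E k x n : avoids E k -> visits E x n -> ~~ visits E x (n + k).
Proof.
move=> hE /asboolP En; apply/asboolP; rewrite addrC aut_powD; exact: hE.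
Qed.

Lemma avoidsS E F k : E `<=` F -> avoids F k -> avoids E k.
Proof. by move=> EF hF x /EF/hF h /EF. Qed.

Lemma swap_exists E k : measurable E -> avoids E k -> exists S, is_swap E k S.
Proof.
move=> mE hE; apply: (@psi_build _ _ _ _ T T_aperiodic (fun x => zswap (visits E x) k)).
- move=> m; rewrite (_ : mkset _ = (E `&` [set _ | 0 + k = m]) `|`
     (~` E `&` (([set x | E (Tp (0 - k) x)] `&` [set _ | 0 - k = m]) `|`
       (~` [set x | E (Tp (0 - k) x)] `&` [set _ | 0 = m])))).
    have mk := measurable_aut_pow T (0 - k) mE.
    apply: measurableU; first by apply: measurableI => //; exact: (measurable_const (0 + k = m)).
    apply: measurableI; first exact: measurableC.
    apply: measurableU; apply: measurableI => //.
    + exact: (measurable_const (0 - k = m)).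
    + exact: measurableC.
    + exact: (measurable_const (0 = m)).
  apply/seteqP; split=> x; rewrite /zswap /visits /= aut_pow0.
    case: asboolP => Ex; first by left.
    by case: asboolP => Ex'; right; split=> //; [left|right].
  move=> [[Ex <-]|[Ex [[Ex' <-]|[Ex' <-]]]]; first by rewrite asboolT.
    by rewrite asboolF// asboolT.
  by rewrite asboolF// asboolF.
- apply: aeW => x n; rewrite /zswap /visits -!aut_powD !add0r [- k + n]addrC.
  by case: ifP => _; last case: ifP => _; lia.
- apply: aeW => x; have K := zswapK (fun n => @avoids_visits E k x n hE).
  apply: (in_symZN_displacement (K := `|k| + 1) K K) => n.
  by rewrite /zswap; case: ifP => _; last case: ifP => _; lia.
Qed.

Lemma swap_unique E k S V : is_swap E k S -> is_swap E k V -> S = V.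
Proof.
rewrite /is_swap => hS hV; apply: psi_ext.
by move: hS hV; apply: filterS2 => x hS hV n; rewrite hS hV.
Qed.

Lemma swap_union E F k S V : (forall x, E x -> ~ F x) -> avoids (E `|` F) k ->
  is_swap E k S -> is_swap F k V -> is_swap (E `|` F) k (S * V)%g.
Proof.
rewrite /is_swap => EF hEF hS hV; move: (psiM T_aperiodic S V) hS hV.
apply: filterS3 => x -> hS hV n; rewrite symM hS hV.
have hE m : visits E x m -> [/\ visits F x m = false, visits E x (m + k) = false &
    visits F x (m + k) = false].
  move=> h; have Em : E (Tp m x) by exact/asboolP.
  have := @avoids_visits (E `|` F) k x m hEF.
  rewrite {1}/visits asboolT; last by left.
  move=> /(_ isT) /asboolP/not_orP[nE nF].
  by split; apply/asboolP => //; exact: EF.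
have hF m : visits F x m -> [/\ visits E x m = false, visits E x (m + k) = false &
    visits F x (m + k) = false].
  move=> h; have Fm : F (Tp m x) by exact/asboolP.
  have := @avoids_visits (E `|` F) k x m hEF.
  rewrite {1}/visits asboolT; last by right.
  move=> /(_ isT) /asboolP/not_orP[nE nF].
  by split; apply/asboolP => // /EF.
have vU m : visits (E `|` F) x m = visits E x m || visits F x m.
  by rewrite /visits asbool_or.
rewrite /zswap !vU.
have [Fn|nFn] := boolP (visits F x n).
  have [-> e1 e2] := hF _ Fn; rewrite /= e1 addrK.
  by have [-> _ _] := hF _ Fn.
have [Fk|nFk] := boolP (visits F x (n - k)).
  have [e0 e1 e2] := hF _ Fk; rewrite subrK in e1 e2.
  rewrite e0 e1 /=; case: (boolP (visits E x (n - k - k))) => // Ekk.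
  by have [_ _] := hE _ Ekk; rewrite subrK Fk.
by rewrite !orbF.
Qed.

Lemma swap_restricts E C k S V : C `<=` E -> avoids E k ->
  is_swap E k S -> is_swap C k V -> restricts S (C `|` [set x | C (Tp (- k) x)]) V.
Proof.
rewrite /is_swap /restricts => CE hE hS hV; move: hS hV.
apply: filterS2 => x hS hV n; rewrite hS hV.
rewrite /zswap; case: (boolP (visits C x n)) => Cn.
  have Cn' : C (Tp n x) by exact/asboolP.
  have En : visits E x n by apply/asboolP/CE.
  by rewrite asboolT ?En//; left.
have [Ck|nCk] := boolP (visits C x (n - k)).
  have Ck' : C (Tp (n - k) x) by exact/asboolP.
  have Ek : visits E x (n - k) by apply/asboolP/CE.
  have := avoids_visits hE Ek; rewrite subrK => /negbTE ->.
  by rewrite Ek asboolT//; right; rewrite /= -aut_powD addrC.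
rewrite asboolF// => -[Cn'|/=]; first by move/asboolP: Cn.
by rewrite -aut_powD addrC => Ck'; move/asboolP: nCk.
Qed.

(** ** Membership in a closed subgroup containing the commutators *)

Variable H : set G.
Hypotheses (H_sub : is_subgroup H) (H_comm : forall S V, H [~ S, V]%g).
Hypothesis H_closed : forall S,
  (forall e, 0 < e -> exists V, H V /\ len (S^-1 * V)%g < e) -> H S.

Lemma mem_limit S : (forall e, 0 < e -> exists V W, [/\ H V, S = (V * W)%g & len W < e]) ->
  H S.
Proof.
move=> h; apply: H_closed => e /h[V [W [HV -> We]]]; exists V; split=> //.
by rewrite invgM -mulgA mulVg mulg1 comfg_lenV.
Qed.

Lemma mem_id : H 1%g.
Proof. by case: H_sub. Qed.

(** Exchanging the union of [E] and [T^k E] with its image under [T^l] conjugates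
    the exchange of [E] with [T^k E] to that of [T^l E] with [T^(k + l) E]. As these
    are involutions, the exchange over [A] is their commutator. *)
Lemma swap_pair E k l : measurable E -> avoids E l ->
  let A := E `|` [set x | E (Tp (- l) x)] in avoids A k ->
  exists S, is_swap A k S /\ H S.
Proof.
move=> mE hl A hA; pose B := E `|` [set x | E (Tp (- k) x)].
have mB : measurable B by apply: measurableU => //; exact: measurable_aut_pow.
have vA x n : visits A x n = visits E x n || visits E x (n - l).
  by rewrite /visits /A asbool_or /= -aut_powD (addrC n).
have vB x n : visits B x n = visits E x n || visits E x (n - k).
  by rewrite /visits /B asbool_or /= -aut_powD (addrC n).
have hA' x n : visits E x n || visits E x (n - l) ->
    ~~ (visits E x (n + k) || visits E x (n + k - l)).
  by rewrite -!vA; exact: avoids_visits.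
have hB : avoids B l.
  move=> x Bx; have := @zswap_disjoint _ k l (fun n => @avoids_visits E l x n hl) (@hA' x) 0.
  have h0 : B (Tp 0 x) by [].
  rewrite -!vB {1}/visits asboolT// => /(_ isT); rewrite add0r => /asboolP; exact.
have [S hS] := swap_exists mE (avoidsS (@subsetUl _ _ _) hA).
have [P hP] := swap_exists mB hB.
exists [~ S, P]%g; split=> //; rewrite /is_swap in hS hP *.
have hSV : \forall x \ae mu, forall n, psi (S^-1)%g x n = psi S x n.
  move: hS (psiV T_aperiodic S); apply: filterS2 => x hS -> n.
  apply: symV_eq; rewrite !hS; apply: zswapK => m vm.
  by apply: avoids_visits vm; exact: (avoidsS (@subsetUl _ _ _) hA).
have hPV : \forall x \ae mu, forall n, psi (P^-1)%g x n = psi P x n.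
  move: hP (psiV T_aperiodic P); apply: filterS2 => x hP -> n.
  by apply: symV_eq; rewrite !hP; apply: zswapK => m; exact: avoids_visits.
have hc := psi_comm T_aperiodic S P.
have hSP : \forall x \ae mu, (forall n, psi S x n = zswap (visits E x) k n) /\
    (forall n, psi P x n = zswap (visits B x) l n) by move: hS hP; apply: filterS2.
have hSPV : \forall x \ae mu, (forall n, psi (S^-1)%g x n = psi S x n) /\
    (forall n, psi (P^-1)%g x n = psi P x n) by move: hSV hPV; apply: filterS2.
move: hc hSP hSPV; apply: filterS3 => x -> [S1 P1] [S2 P2] n.
rewrite !symM S2 P2 !S1 !P1.
have -> : zswap (visits B x) l =1 zswap (fun n => visits E x n || visits E x (n - k)) l.
  by move=> m; rewrite /zswap !vB.
have -> : zswap (visits B x) l =1 zswap (fun n => visits E x n || visits E x (n - k)) l.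
  by move=> m; rewrite /zswap !vB.
rewrite zswap_commutator; first by rewrite /zswap !vA.
- by move=> m; exact: avoids_visits.
- exact: hA'.
Qed.

Variables (U : nat -> set X) (mU : forall i, measurable (U i)) (sepU : separating U).
Hypotheses (mu_atomless : atomless mu) (T_ergodic : ergodic T).

(** One step of the pairing removes from [C] the points of
    [U j `&` ~` T^-l U j] that return to [C] after [l] steps, together with
    their images. *)
Definition pair_part (C : set X) (i : nat) : set X :=
  if (unpickle i : option (nat * nat)) is Some (j, l)
  then C `&` [set x | C (Tp l.+1 x)] `&` [set x | U j x /\ ~ U j (Tp l.+1 x)]
  else set0.

Definition pair_shift (i : nat) : int :=
  if (unpickle i : option (nat * nat)) is Some (j, l) then l.+1%:Z else 1.

Definition pair_image (C : set X) (i : nat) : set X :=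
  pair_part C i `|` [set x | pair_part C i (Tp (- pair_shift i) x)].

Fixpoint unpaired (E : set X) (i : nat) : set X :=
  if i is i'.+1 then unpaired E i' `\` pair_image (unpaired E i') i' else E.

Lemma measurable_pair_part C i : measurable C -> measurable (pair_part C i).
Proof.
move=> mC; rewrite /pair_part; case: unpickle => [[j l]|]; last exact: measurable0.
apply: measurableI; first by apply: measurableI => //; exact: measurable_aut_pow.
apply: (@measurableI _ _ (U j) [set x | ~ U j (Tp l.+1 x)]) => //.
by apply: measurable_not; exact: measurable_aut_pow.
Qed.

Lemma measurable_pair_image C i : measurable C -> measurable (pair_image C i).
Proof.
move=> mC; have mP := measurable_pair_part i mC.
by apply: measurableU => //; exact: measurable_aut_pow.
Qed.

Lemma measurable_unpaired E i : measurable E -> measurable (unpaired E i).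
Proof.
move=> mE; elim: i => //= i IH; apply: measurableD => //.
exact: measurable_pair_image.
Qed.

Lemma pair_image_sub C i : pair_image C i `<=` C.
Proof.
rewrite /pair_image /pair_part /pair_shift => x; case: unpickle => [[j l]|]; last by case.
move=> [[[Cx _] _]//|[[_ /=]]]; by rewrite -aut_powD subrr.
Qed.

Lemma unpaired_decr E i : unpaired E i.+1 `<=` unpaired E i.
Proof. by move=> x []. Qed.

Lemma unpaired_sub E i : unpaired E i `<=` E.
Proof. by elim: i => //= i IH x [/IH]. Qed.

Lemma pair_part_avoids C i : avoids (pair_part C i) (pair_shift i).
Proof.
rewrite /pair_part /pair_shift => x; case: unpickle => [[j l]|] //=.
by move=> [_ [_ nU]] [_ [/nU]].
Qed.

(** The remaining points never return to the remaining set: a return time [l] of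
    [y] and a set [U j] separating [y] from [T^l y] would have led to the removal
    of [y]. By recurrence there are almost no such points. *)
Lemma unpaired_null E : measurable E -> \forall x \ae mu, exists i, ~ unpaired E i x.
Proof.
move=> mE; pose C := \bigcap_i unpaired E i.
have mC : measurable C by apply: bigcap_measurable => // i _; exact: measurable_unpaired.
suff : pr mu C = 0.
  move=> /(pr0P mu mC); apply: filterS => x nC; apply: contrapT => /forallNP h.
  by apply: nC => i _; exact: contrapT.
apply/eqP; rewrite eq_le pr_ge0 andbT leNgt; apply/negP => C0.
have rec := @backward_recurrence _ _ _ _ T mu_atomless T_ergodic C mC C0.
have [x Cx [/(_ (-1))[b b1 Cb] ap]] : exists2 x, C x &
    (forall n, exists2 b, b <= n & C (Tp b x)) /\ (forall j k, Tp j x = Tp k x -> j = k).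
  by apply: (pr_pos_ex mC C0); move: rec T_aperiodic; apply: filterS2.
pose l := `|b|%N.-1; have lE : l.+1%:Z = - b by rewrite /l; lia.
have back : Tp l.+1 (Tp b x) = x by rewrite lE -aut_powD addNr.
have [j [Uj nUj]] : exists j, U j (Tp b x) /\ ~ U j x.
  by apply: sepU => e; have := ap b 0 e; lia.
have := Cb (pickle (j, l)).+1 Logic.I => -[_]; apply; left.
rewrite /pair_part pickleK; split; last by rewrite /= back.
by split; [exact: Cb|rewrite /= back; exact: Cx].
Qed.

(** Up to the exchange over the unpaired points, whose length tends to zero, the
    exchange over [E] is a product of commutators. *)
Lemma swap_mem E k S : measurable E -> avoids E k -> is_swap E k S -> H S.
Proof.
move=> mE hE hS.
have hC i : avoids (unpaired E i) k := avoidsS (@unpaired_sub E i) hE.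
have part i : exists V, is_swap (E `\` unpaired E i) k V /\ H V.
  elim: i => [|i [V [hV HV]]] /=.
    have [V hV] := swap_exists (measurableD mE mE) (avoidsS (@subDsetl _ _ _) hE).
    exists V; split=> //; suff -> : V = 1%g by exact: mem_id.
    apply: psi_ext; move: hV (psi1 T_aperiodic); rewrite /is_swap.
    apply: filterS2 => x hV -> n; rewrite sym1 hV /zswap /visits.
    by rewrite asboolF ?setDv// asboolF ?setDv.
  have Psub : pair_image (unpaired E i) i `<=` E.
    by apply: subset_trans (@unpaired_sub E i); exact: pair_image_sub.
  have [W [hW HW]] := swap_pair (measurable_pair_part i (measurable_unpaired i mE))
    (@pair_part_avoids (unpaired E i) i) (avoidsS Psub hE).
  exists (V * W)%g; split; last by case: H_sub => _ h _; exact: h.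
  have -> : E `\` (unpaired E i `\` pair_image (unpaired E i) i) =
      (E `\` unpaired E i) `|` pair_image (unpaired E i) i.
    apply/seteqP; split=> x.
      move=> [Ex nC]; have [Cx|] := pselect (unpaired E i x); last by left.
      by right; apply: contrapT => nP; exact: nC.
    by move=> [[Ex nC]|Px]; split; [|case|exact: Psub|case].
  apply: swap_union => //.
  - by move=> x [_ nC] /pair_image_sub.
  - by apply: avoidsS hE => x [[]|/Psub].
have [V hV] := choice (fun i => swap_exists (measurable_unpaired i mE) (hC i)).
pose Y i := unpaired E i `|` [set x | unpaired E i (Tp (- k) x)].
have small e : 0 < e -> exists i, len (V i) < e.
  apply: (@restricts_small _ _ _ _ T S Y).
  - move=> i; apply: measurableU; first exact: measurable_unpaired.
    by apply: measurable_aut_pow; exact: measurable_unpaired.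
  - by move=> i x [/unpaired_decr|/unpaired_decr]; [left|right].
  - apply: filterS (ae_orbit T (unpaired_null mE)) => x hx.
    have [m hm] := @decr_finite_common _ (unpaired E)
      (fun i : nat => Tp (if i is 0%N then 0 else - k) x) 2 (@unpaired_decr E)
      (fun i _ => hx _).
    by exists m => -[]; [exact: (hm 0%N)|exact: (hm 1%N)].
  - by move=> i; apply: swap_restricts (hS) (hV i) => //; exact: unpaired_sub.
apply: mem_limit => e /small[i Vi]; have [W [hW HW]] := part i.
exists W, (V i); split=> //.
apply: (swap_unique hS).
have EE : E = (E `\` unpaired E i) `|` unpaired E i.
  by rewrite setUC setDUK//; exact: unpaired_sub.
rewrite [X in is_swap X]EE; apply: swap_union => //; first by move=> x [].
by rewrite -EE.
Qed.

(** The part of [S] that moves points by at most [m] steps along the orbits is a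
    product of [m] exchanges. *)
Lemma involution_mem S : (S * S)%g = 1%g -> H S.
Proof.
move=> SS.
have inv : \forall x \ae mu, forall n, psi S x (psi S x n) = n.
  move: (psiM T_aperiodic S S) (psi1 T_aperiodic); rewrite SS; apply: filterS2.
  by move=> x e1 e2 n; rewrite -symM -e1 e2 sym1.
pose Y (m : nat) := [set x | m%:Z < `|psi S x 0|].
have mY m : measurable (Y m) by exact: (measurable_psi S 0 (fun j => m%:Z < `|j|)).
have vY : \forall x \ae mu, forall m n, Y m (Tp n x) <-> m%:Z < `|psi S x n - n|.
  by apply: filterS (psi_shift S) => x sh m n; rewrite /Y/= sh add0r.
have iY m : invariant_under S (Y m).
  rewrite /invariant_under; move: vY inv; apply: filterS2 => x h hi n.
  by rewrite !h hi distrC.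
have part m : exists V, restricts S (~` Y m) V /\ H V.
  elim: m => [|m [V [hV HV]]].
    exists 1%g; split; last exact: mem_id.
    rewrite /restricts; move: vY (psi1 T_aperiodic); apply: filterS2 => x h -> n.
    rewrite sym1; case: asboolP => // nY.
    have : ~ 0%:Z < `|psi S x n - n| by move/h.
    by lia.
  pose k := m.+1%:Z.
  (* the second condition, automatic almost everywhere, makes [E] and [T^k E]
     disjoint at every point *)
  pose E := [set x | psi S x 0 = k /\ psi S (Tp k x) 0 = - k].
  have mE : measurable E.
    apply: (@measurableI _ _ [set x | psi S x 0 = k] [set x | psi S (Tp k x) 0 = - k]).
      exact: measurable_psi_eq.
    exact: (measurable_aut_pow T k (measurable_psi_eq S 0 (- k))).
  have hE : avoids E k by move=> x [_ h] [h' _]; move: h'; rewrite h /k; lia.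
  have [W hW] := swap_exists mE hE.
  exists (V * W)%g; split; last first.
    by case: H_sub => _ h _; apply: h => //; exact: swap_mem hW.
  rewrite /restricts /is_swap in hV hW *.
  have hVW : \forall x \ae mu,
      (forall n, psi V x n = if `[< (~` Y m) (Tp n x) >] then psi S x n else n) /\
      (forall n, psi W x n = zswap (visits E x) k n) by move: hV hW; apply: filterS2.
  have hs : \forall x \ae mu, (forall m n, Y m (Tp n x) <-> m%:Z < `|psi S x n - n|) /\
      (forall n, psi S x (psi S x n) = n) by move: vY inv; apply: filterS2.
  have vE : \forall x \ae mu, forall n, visits E x n = (psi S x n == n + k).
    move: (psi_shift S) inv; apply: filterS2 => x sh hi n.
    apply/asboolP/eqP; rewrite /E/= -aut_powD !sh !add0r.
      by move=> [+ _]; lia.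
    by move=> e; split; [lia|rewrite (addrC k) -e hi; lia].
  have hm := psiM T_aperiodic V W.
  have hall : \forall x \ae mu, psi (V * W)%g x = (psi V x * psi W x)%g /\
     forall n, visits E x n = (psi S x n == n + k) by move: hm vE; apply: filterS2.
  move: hall hVW hs; apply: filterS3 => x [-> {}vE] [{}hV {}hW] [{}vY hi] n.
  have yV j : psi V x j = if `|psi S x j - j| <= m%:Z then psi S x j else j.
    rewrite hV; case: asboolP => [/=|/contrapT] /vY.
      by rewrite leNgt => /negP/negbTE ->.
    by rewrite ltNge => /negbTE ->.
  rewrite symM hW /zswap !vE yV.
  have -> : `[< (~` Y m.+1) (Tp n x) >] = (`|psi S x n - n| <= k).
    by rewrite /setC/= asbool_neg (asbool_equiv_eq (vY _ _)) asboolb -leNgt.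
  have [e|ne] := eqVneq (psi S x n) (n + k).
    have e' : psi S x (n + k) = n by rewrite -e hi.
    by rewrite e' e; rewrite /k; case: ifP; case: ifP; lia.
  have [e|ne'] := eqVneq (psi S x (n - k)) (n - k + k).
    rewrite subrK in e; have e' : psi S x n = n - k by rewrite -[in LHS]e hi.
    by rewrite e e' /k; case: ifP; case: ifP; lia.
  have ne'' : psi S x n <> n - k.
    by move=> e; move/eqP: ne'; apply; rewrite -e hi e subrK.
  by move/eqP: ne; rewrite /k in ne'' *; case: ifP; case: ifP; lia.
have exV m : exists V, restricts S (Y m) V.
  exact: restricts_exists.
have [V hV] := choice exV.
have small e : 0 < e -> exists m, len (V m) < e.
  apply: (@restricts_small _ _ _ _ T S Y) => //.
  - by move=> m x /=; rewrite /Y/=; lia.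
  - apply: aeW => x; exists `|psi S x 0|%N; by rewrite /Y/= abszE ltxx.
apply: mem_limit => e /small[m Vm]; have [W [hW HW]] := part m.
by exists W, (V m); split=> //; exact: restricts_mul hW.
Qed.

End swaps.

(** * Elements preserving half-lines on a set of positive measure *)

Local Notation zpow s i := (symZN_fun (expgz s i)).

Section reflection.
Variable s : symZN.

Lemma expgz_symD i j n : zpow s (i + j) n = zpow s i (zpow s j n).
Proof. by rewrite expgzD symM. Qed.

Lemma expgz_sym0 n : zpow s 0 n = n.
Proof. by []. Qed.

Lemma expgz_sym1 n : zpow s 1 n = s n.
Proof. by []. Qed.

(** [m] is the mirror image of [n] in its [s]-orbit, parametrized from the least
    element [b] of this orbit. *)
Definition mirror (n m : int) : Prop := exists b i,
  [/\ zpow s i b = n, zpow s (- i) b = m & forall j, b <= zpow s j b].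

Hypothesis s_intervals : forall n, exists2 b, b <= n & pres s b.

Lemma mirror_ex n : exists m, mirror n m.
Proof.
have [b0 b0n hb0] := s_intervals n.
have [||b [[j <-] bmin]] := @int_has_min (fun k => exists j, zpow s j n = k) b0.
- by exists n, 0.
- by move=> _ [j <-]; rewrite (pres_expgz j hb0).
exists (zpow s (j + j) n), (zpow s j n), (- j); split.
- by rewrite -expgz_symD addNr.
- by rewrite opprK -expgz_symD.
- by move=> i; apply: bmin; exists (i + j); rewrite expgz_symD.
Qed.

Lemma mirror_unique n m m' : mirror n m -> mirror n m' -> m = m'.
Proof.
move=> [b [i [bn <- bmin]]] [b' [i' [b'n <- bmin']]].
have bb' : b = b'.
  apply/eqP; rewrite eq_le; apply/andP; split.
    have := bmin (- i' + i); rewrite expgz_symD bn -b'n -expgz_symD addNr.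
    by rewrite expgz_sym0.
  have := bmin' (- i + i'); rewrite expgz_symD b'n -bn -expgz_symD addNr.
  by rewrite expgz_sym0.
subst b'; have e : zpow s (i - i') b = b.
  by rewrite addrC expgz_symD bn -b'n -expgz_symD addNr expgz_sym0.
by rewrite -[in LHS]e -expgz_symD; congr (zpow s _ b); lia.
Qed.

Lemma reflection_ex : exists r : int -> int,
  [/\ forall n m, mirror n m <-> m = r n, cancel r r,
      forall n, s (r (s (r n))) = n & forall n, exists j, r n = zpow s j n].
Proof.
have [r hr] := choice mirror_ex.
have rP n m : mirror n m <-> m = r n.
  by split=> [h|->//]; exact: mirror_unique h (hr n).
exists r; split=> // [n|n|n]; have [b [i [bn bm bmin]]] := hr n.
- by apply/esym/rP; exists b, (- i); rewrite opprK.
- have e : s (r n) = zpow s (1 - i) b by rewrite expgz_symD -bm.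
  have -> : r (s (r n)) = zpow s (i - 1) b.
    by apply/esym/rP; exists b, (1 - i); rewrite opprB.
  by rewrite -bn -[LHS]expgz_sym1 -expgz_symD; congr (zpow s _ b); lia.
- exists (- i - i); rewrite -bm -bn -expgz_symD; congr (zpow s _ b); lia.
Qed.

End reflection.

Section small_length.
Context {disp : measure_display} {X : measurableType disp} {R : realType}.
Context {mu : probability X R}.
Variable T : aut mu.
Notation Tp := (aut_pow T).
Notation G := (comfg T).
Notation psi := (@psi disp X R mu T).
Notation len := (@len disp X R mu T).
Implicit Types (S V W : G) (e : R) (A C D : set X).
Variables (U : nat -> set X) (mU : forall i, measurable (U i)) (sepU : separating U).
Hypotheses (mu_atomless : atomless mu) (T_ergodic : ergodic T).

Let T_aperiodic := aperiodic_inj mU sepU mu_atomless T_ergodic.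

Lemma len_lt1_intervals S : len S < 1 ->
  \forall x \ae mu, forall n, exists2 b, b <= n & pres (psi S x) b.
Proof.
move=> S1; have mB := measurable_pres S 0.
have B0 : 0 < pr mu [set x | pres (psi S x) 0].
  have : 1 <= pr mu [set x | pres (psi S x) 0] + len S.
    rewrite -(pr_setT mu); apply: le_trans (prU _ mB (measurable_broken S)).
    apply: le_pr => //; first by apply: measurableU => //; exact: measurable_broken.
    by move=> x _; have [|] := pselect (pres (psi S x) 0); [left|right].
  by move: S1; lra.
move: (@backward_recurrence _ _ _ _ T mu_atomless T_ergodic _ mB B0) (pres_shift S).
apply: filterS2 => x rec sh n; have [b bn hb] := rec n.
by exists b => //; have := sh b 0; rewrite add0r => -[+ _]; apply.
Qed.

(** The mirror image in each orbit of [S] conjugates [S] to its inverse, which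
    makes [S] a product of two involutions. *)
Lemma len_lt1_involutions S : len S < 1 -> exists V W,
  [/\ S = (V * W)%g, (V * V)%g = 1%g & (W * W)%g = 1%g].
Proof.
move=> S1; have hS := len_lt1_intervals S1.
pose M x m := exists b i, [/\ psi (expgz S i) x b = 0, psi (expgz S (- i)) x b = m &
  forall j, b <= psi (expgz S j) x b].
have mM m : measurable [set x | M x m].
  apply: measurable_exists => b; apply: measurable_exists => i.
  rewrite (_ : mkset _ = [set x | psi (expgz S i) x b = 0] `&`
    ([set x | psi (expgz S (- i)) x b = m] `&`
     [set x | forall j, b <= psi (expgz S j) x b])).
    apply: measurableI; first exact: measurable_psi_eq.
    apply: measurableI; first exact: measurable_psi_eq.
    apply: measurable_forall => j; exact: (measurable_psi _ b (fun n => b <= n)).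
  by apply/seteqP; split=> x /=; [move=> [? ? ?]|move=> [? [? ?]]].
(* requiring uniqueness makes [c] measurable also on the null set where [M] is not
   the graph of a function *)
pose P x m := M x m /\ forall m', M x m' -> m' = m.
have mP m : measurable [set x | P x m].
  apply: (@measurableI _ _ [set x | M x m] [set x | forall m', M x m' -> m' = m]) => //.
  apply: measurable_forall => m'.
  rewrite (_ : mkset _ = [set x | ~ M x m'] `|` [set _ | m' = m]).
    apply: measurableU; first exact: measurable_not.
    exact: (measurable_const (m' = m)).
  apply/seteqP; split=> x /=; last by move=> [].
  by have [h /(_ h)|h] := pselect (M x m'); [right|left].
pose c x := xget 0 [set m | P x m].
have cP x m : P x m -> c x = m.
  by move=> Pm; apply: xget_unique => // m' [h _]; exact: Pm.2.
have mc m : measurable (c @^-1` [set m]).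
  rewrite (_ : _ @^-1` _ = [set x | P x m] `|`
      ([set x | forall m', ~ P x m'] `&` [set _ | 0 = m])).
    apply: measurableU => //; apply: measurableI; last exact: (measurable_const (0 = m)).
    by apply: measurable_forall => m'; exact: measurable_not.
  apply/seteqP; split=> x /=.
    have [[m' Pm'] <-|/forallNP nP <-] := pselect (exists m', P x m').
      by left; rewrite (cP _ _ Pm').
    right; split=> //; apply/esym/xgetPN => m'; exact: nP.
  move=> [/cP//|[nP <-]]; apply/xgetPN => m'; exact: nP.
have hpow : \forall x \ae mu, forall i n, psi (expgz S i) x n = zpow (psi S x) i n.
  apply: ae_all => i; apply: filterS (psi_expgz T_aperiodic S i) => x h n.
  by rewrite h.
have hsh : \forall x \ae mu, forall i k n, psi (expgz S i) (Tp k x) n =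
    psi (expgz S i) x (n + k) - k by apply: ae_all => i; exact: psi_shift.
have hM : \forall x \ae mu, forall n m, M (Tp n x) m <-> mirror (psi S x) n (m + n).
  move: hpow hsh; apply: filterS2 => x hp sh n m; split=> -[b [i [h1 h2 h3]]].
    exists (b + n), i; rewrite -!hp; split.
    - by move: h1; rewrite sh; lia.
    - by move: h2; rewrite sh; lia.
    - by move=> j; rewrite -hp; have := h3 j; rewrite sh; lia.
  exists (b - n), i; rewrite !sh !subrK !hp; split.
  - by rewrite h1 subrr.
  - by rewrite h2 addrK.
  - by move=> j; rewrite sh subrK hp lerB.
have hc : \forall x \ae mu, exists r : int -> int, [/\ forall n, cocycle_perm T c x n = r n,
    cancel r r, forall n, psi S x (r (psi S x (r n))) = n &
    forall n, exists j, r n = zpow (psi S x) j n].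
  move: hM hS; apply: filterS2 => x hm /reflection_ex[r [rP rK rs rj]].
  exists r; split=> // n; rewrite /cocycle_perm (cP _ (r n - n)) ?subrKC//.
  split; first by apply/hm/rP; rewrite subrK.
  by move=> m' /hm/rP; lia.
have [|W hW] := psi_of_perm T_aperiodic mc.
  move: hc hS; apply: filterS2 => x [r [rE rK _ rj]] hI.
  have [b b0 hb] := hI 0.
  have rb n : (b <= r n) = (b <= n) by have [j ->] := rj n; exact: pres_expgz.
  have fin : finite_set (r @` [set n : int | `|n| < `|b| + 1]).
    exact/finite_image/bounded_int_finite.
  have [K K0 hK] := finite_int_bounded fin.
  have [s sE] : in_symZN r.
    apply: (@in_symZN_bound r r (K + `|b| + 1)) => // n Kn.
    have rn : r n < 0 -> b <= r n -> `|n| < K.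
      by move=> h1 h2; apply: hK; exists (r n) => //=; lia.
    have hb' := rb n; case: (leP 0 (r n)) => rn0; case: (leP 0 n) => n0 //; first by lia.
    by have := rn rn0; lia.
  by exists s => n; rewrite sE rE.
have hr : \forall x \ae mu, exists r : int -> int, [/\ forall n, psi W x n = r n,
    cancel r r & forall n, psi S x (r (psi S x (r n))) = n].
  move: hW hc; apply: filterS2 => x hw [r [rE rK rs _]].
  by exists r; split=> // n; rewrite hw.
have WW : (W * W)%g = 1%g.
  apply: psi_ext; move: hr (psiM T_aperiodic W W) (psi1 T_aperiodic).
  by apply: filterS3 => x [r [rE rK _]] -> -> n; rewrite symM !rE rK sym1.
exists (S * W)%g, W; split=> //; first by rewrite -mulgA WW mulg1.
apply: psi_ext; move: hr (psi1 T_aperiodic) => hr h1.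
have hm := psiM T_aperiodic (S * W)%g (S * W)%g.
have h2 : \forall x \ae mu, psi (S * W * (S * W))%g x =
    (psi S x * psi W x * (psi S x * psi W x))%g.
  by move: hm (psiM T_aperiodic S W); apply: filterS2 => x -> ->.
move: hr h1 h2; apply: filterS3 => x [r [rE _ rs]] -> -> n.
by rewrite !symM !rE rs sym1.
Qed.

Variable H : set G.
Hypotheses (H_sub : is_subgroup H) (H_comm : forall S V, H [~ S, V]%g).
Hypothesis H_closed : forall S,
  (forall e, 0 < e -> exists V, H V /\ len (S^-1 * V)%g < e) -> H S.

(** This makes [H] contain a neighborhood of the identity of the whole group. *)
Lemma len_lt1_mem S : len S < 1 -> H S.
Proof.
move=> /len_lt1_involutions[V [W [-> VV WW]]].
have inv := involution_mem T_aperiodic H_sub H_comm H_closed mU sepU mu_atomless T_ergodic.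
by case: H_sub => _ h _; apply: h; exact: inv.
Qed.

(** ** Cutting an element into elements of small length *)

Section pieces.
Variables (S : G) (S1 : len S < 1).

(** The points whose last preserved half-line, going backwards along the orbit,
    starts in [C]. *)
Definition interval_sat C : set X := [set x | exists b,
  [/\ b <= 0, pres (psi S (Tp b x)) 0, C (Tp b x) &
      forall b', b' <= 0 -> pres (psi S (Tp b' x)) 0 -> b' <= b]].

Lemma measurable_interval_sat C : measurable C -> measurable (interval_sat C).
Proof.
move=> mC; apply: measurable_exists => b.
have mp b' : measurable [set x | pres (psi S (Tp b' x)) 0].
  exact: (measurable_aut_pow T b' (measurable_pres S 0)).
rewrite (_ : mkset _ = [set _ | b <= 0] `&` ([set x | pres (psi S (Tp b x)) 0] `&`
  ([set x | C (Tp b x)] `&` [set x | forall b', b' <= 0 ->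
    pres (psi S (Tp b' x)) 0 -> b' <= b]))).
  apply: measurableI; first exact: (measurable_const (b <= 0)).
  apply: measurableI => //; apply: measurableI; first exact: measurable_aut_pow.
  apply: measurable_forall => b'.
  have [h|h] := pselect (b' <= 0 -> b' <= b).
    by rewrite (_ : mkset _ = setT)//; apply/seteqP; split=> // x _ b'0 _; exact: h.
  rewrite (_ : mkset _ = ~` [set x | pres (psi S (Tp b' x)) 0]); first exact: measurableC.
  apply/seteqP; split=> x /=; last by move=> np _ /np.
  by move=> h' hp; apply: h => b'0; exact: h'.
by apply/seteqP; split=> x /=; [move=> [? ? ? ?]|move=> [? [? [? ?]]]].
Qed.

Lemma interval_satE C : \forall x \ae mu, forall n, interval_sat C (Tp n x) <->
  exists b, [/\ b <= n, pres (psi S x) b, C (Tp b x) &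
    forall b', b' <= n -> pres (psi S x) b' -> b' <= b].
Proof.
apply: filterS (pres_shift S) => x sh n.
have sh0 b : pres (psi S (Tp b x)) 0 <-> pres (psi S x) b by rewrite sh add0r.
split=> -[b [bn pb Cb bmax]].
  exists (b + n); split; [by lia|by apply/sh0; rewrite aut_powD|by rewrite aut_powD|].
  move=> b' b'n /sh0 pb'; have := bmax (b' - n); rewrite -aut_powD subrK => h.
  by have := h ltac:(lia) pb'; lia.
exists (b - n); rewrite -!aut_powD !subrK; split=> //; [by lia|exact/sh0|].
move=> b' b'n; rewrite -aut_powD => /sh0 pb'.
by have := bmax (b' + n) ltac:(lia) pb'; lia.
Qed.

Lemma interval_sat_invariant C : invariant_under S (interval_sat C).
Proof.
rewrite /invariant_under; apply: filterS (interval_satE C) => x h n; rewrite !h.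
split=> -[b [bn pb Cb bmax]]; exists b; split=> //.
- by rewrite -(pb n).
- by move=> b' b'n pb'; apply: bmax => //; rewrite (pb' n).
- by rewrite (pb n).
- by move=> b' b'n pb'; apply: bmax => //; rewrite -(pb' n).
Qed.

Lemma interval_sat_disjoint C D : (forall x, C x -> ~ D x) ->
  forall x, interval_sat C x -> ~ interval_sat D x.
Proof.
move=> CD x [b [b0 pb Cb bmax]] [b' [b'0 pb' Db' b'max]].
have e : b = b' by apply/eqP; rewrite eq_le bmax// b'max.
by move: Db'; rewrite -e; exact: CD.
Qed.

Lemma interval_satS C D : C `<=` D -> interval_sat C `<=` interval_sat D.
Proof. by move=> CD x [b [b0 pb /CD Db bmax]]; exists b. Qed.

Lemma interval_satU C D : interval_sat (C `|` D) = interval_sat C `|` interval_sat D.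
Proof.
apply/seteqP; split=> x; last first.
  by move=> [|]; apply: interval_satS; [exact: subsetUl|exact: subsetUr].
by move=> [b [b0 pb [Cb|Db] bmax]]; [left|right]; exists b.
Qed.

Lemma interval_satT : \forall x \ae mu, interval_sat setT x.
Proof.
move: (interval_satE setT) (len_lt1_intervals S1); apply: filterS2 => x h hI.
rewrite -(aut_pow0 T x); apply/h.
have [b0 b00 hb0] := hI 0.
have [||b [[b'0 hb] bmin]] := @int_has_min (fun k => k >= 0 /\ pres (psi S x) (- k)) 0.
- by exists (- b0); rewrite opprK oppr_ge0.
- by move=> k [].
exists (- b); split=> //; first by lia.
by move=> b' b'n pb'; have := bmin (- b'); rewrite opprK => /(_ (conj _ pb')) h';
  have := h' ltac:(lia); lia.
Qed.

Lemma restricts_len_le Y V : restricts S Y V -> len V <= len S.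
Proof.
rewrite /restricts => hV; apply: len_le_pr; first exact: measurable_broken.
apply: filterS hV => x hV h hS; apply: h => n; rewrite hV.
by case: asboolP => _ //; exact: hS.
Qed.

(** A point that [V] moves across the origin lies in the same interval as the
    origin. *)
Lemma piece_len C V : measurable C -> restricts S (interval_sat C) V ->
  len V <= pr mu (interval_sat C).
Proof.
rewrite /restricts => mC hV; apply: len_le_pr; first exact: measurable_interval_sat.
move: hV (interval_satE C); apply: filterS2 => x hV hC h.
apply: contrapT => n0; apply: h => n; rewrite hV; case: asboolP => // /hC.
move=> [b [bn pb Cb bmax]]; apply: contrapT => cr; apply: n0.
rewrite -(aut_pow0 T x); apply/hC.
have sn := pb n.
have b0 : b <= 0.
  by rewrite leNgt; apply/negP => b0; apply: cr; move: bn sn b0; lia.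
exists b; split=> // b' b'0 pb'; apply: bmax => //.
have := pb' n; move: cr b'0; case: (leP 0 n); case: (leP 0 (psi S x n)) => //; lia.
Qed.

Lemma piece_mul C D V W : (forall x, C x -> ~ D x) ->
  restricts S (interval_sat C) V -> restricts S (interval_sat D) W ->
  restricts S (interval_sat (C `|` D)) (V * W)%g.
Proof.
move=> CD; rewrite /restricts => hV hW.
have iD : invariant_under S (interval_sat D) := interval_sat_invariant D.
rewrite /invariant_under in iD.
have hVW : \forall x \ae mu,
   (forall n, psi V x n = if `[< interval_sat C (Tp n x) >] then psi S x n else n) /\
   (forall n, psi W x n = if `[< interval_sat D (Tp n x) >] then psi S x n else n).
  by move: hV hW; apply: filterS2.
move: (psiM T_aperiodic V W) hVW iD; apply: filterS3 => x -> [{}hV {}hW] iD n.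
rewrite symM hW interval_satU asbool_or.
have disj := interval_sat_disjoint CD.
have [Dn|Dn] := pselect (interval_sat D (Tp n x)).
  rewrite (asboolT Dn) orbT hV asboolF// => /disj; apply; exact/iD.
by rewrite (asboolF Dn) orbF hV.
Qed.

Lemma piece_exists C : measurable C -> exists V, restricts S (interval_sat C) V.
Proof.
move=> mC; apply: (restricts_exists T_aperiodic).
  exact: measurable_interval_sat.
exact: interval_sat_invariant.
Qed.

(** [C |-> mu (interval_sat C)] is the distribution of the starting point of the
    current interval; it has no atom because orbits are countable. *)
Lemma small_interval_cells e : 0 < e ->
  exists N, forall x, pr mu (interval_sat (cell U N x)) < e.
Proof.
move=> e0; apply: (small_cells mU sepU (nu := fun C => pr mu (interval_sat C))) => //.
  move=> A B mA mB AB; apply: le_pr; [exact: measurable_interval_sat..|exact: interval_satS].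
move=> A mA dA A1 d d0; apply: pr_decr_small => //.
- by move=> n; exact: measurable_interval_sat.
- by move=> n; exact: interval_satS.
have hy := orbit_leaves T mU sepU mu_atomless A1.
apply: filterS hy => x hy; apply: contrapT => /forallNP h.
have {}h m : interval_sat (A m) x by exact: contrapT.
have [b [b0 pb Ab bmax]] := h 0%N; have [m nAm] := hy b.
have [b' [b'0 pb' Ab' b'max]] := h m.
have bb' : b = b' by apply/eqP; rewrite eq_le bmax// b'max.
by apply: nAm; rewrite bb'.
Qed.

End pieces.

(** The pieces are grouped greedily: each group but the last one has measure at
    least [e / 2], so that their number is bounded in terms of [e] only. *)
Lemma len_lt1_bounded (L : G -> R) e : 0 < e ->
  (forall V W, H V -> H W -> L (V * W)%g <= L V + L W) ->
  (forall V, H V -> len V < e -> L V <= 1) ->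
  exists M, forall S, len S < 1 -> L S <= M.
Proof.
move=> e0 LM L1; have e20 : 0 < e / 2 by rewrite divr_gt0.
pose q := Num.truncn (e / 2)^-1; exists (q.+1%:R + 1) => S S1.
have [N hN] := small_interval_cells S e20.
pose rank x : nat := enum_rank (pattern U N x).
pose C (i j : nat) := [set x | (i <= rank x < j)%N].
have mC i j : measurable (C i j).
  exact: (measurable_pattern mU (fun w => (i <= enum_rank w < j)%N)).
pose nu A := pr mu (interval_sat S A).
have Cii i : nu (C i i) = 0.
  rewrite /nu (_ : interval_sat _ _ = set0) ?pr_set0//.
  by apply/seteqP; split=> // x [b [_ _]]; rewrite /C/=; lia.
have CS i : nu (C i i.+1) < e / 2.
  have [[y yC]|nC] := pselect (exists y, C i i.+1 y).
    apply: le_lt_trans (hN y); apply: le_pr.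
    - exact: measurable_interval_sat.
    - exact/measurable_interval_sat/measurable_cell.
    - apply: interval_satS => x xC; rewrite /cell/=.
      have aux (k l : nat) : (i <= k < i.+1)%N -> (i <= l < i.+1)%N -> k = l by lia.
      have er : rank x = rank y by exact: aux.
      by apply: (can_inj enum_rankK); exact: val_inj.
  rewrite /nu (_ : interval_sat _ _ = set0) ?pr_set0//.
  by apply/seteqP; split=> // x [b [_ _ Cb _]]; apply: nC; exists (Tp b x).
have CU i k j : (i <= k)%N -> (k <= j)%N -> C i j = C i k `|` C k j.
  move=> ik kj; apply/seteqP; split=> x.
    move=> /andP[h1 h2]; have [h|h] := ltnP (rank x) k; [left|right]; exact/andP.
  move=> [] /andP[h1 h2]; apply/andP; split=> //; first exact: leq_trans kj.
  exact: leq_trans h1.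
have Cdisj i k j : forall x, C i k x -> ~ C k j x 
  by move=> x /andP[_ h1] /andP[h2 _]; move: h2; rewrite leqNgt h1.
have nuD i k j : (i <= k)%N -> (k <= j)%N -> nu (C i j) = nu (C i k) + nu (C k j).
  move=> ik kj; rewrite /nu (CU i k j)// interval_satU.
  apply: pr_disjointU; [exact: measurable_interval_sat..|].
  by apply: interval_sat_disjoint; exact: Cdisj.
have HV i j V : restricts S (interval_sat S (C i j)) V -> H V.
  by move=> /restricts_len_le h; apply: len_lt1_mem; exact: le_lt_trans S1.
have small i j V : restricts S (interval_sat S (C i j)) V -> nu (C i j) < e -> L V <= 1.
  move=> hV nue; apply: L1; first exact: HV hV.
  by apply: le_lt_trans nue; exact: piece_len.
have claim n : forall i j V, (i <= j)%N -> nu (C i j) <= n%:R * (e / 2) ->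
    restricts S (interval_sat S (C i j)) V -> L V <= n%:R + 1.
  elim: n => [|n IH] i j V ij nuij hV.
    rewrite add0r; apply: small hV _; apply: le_lt_trans nuij _; by rewrite mul0r.
  have [nue|nue] := ltP (nu (C i j)) e.
    by have := small _ _ _ hV nue; have := ler0n R n.+1; lra.
  have ex_k : exists k, (i <= k)%N && (e / 2 <= nu (C i k)).
    by exists j; rewrite ij /=; move: e0 nue; lra.
  case: (ex_minnP ex_k) => k /andP[ik nuk] kmin.
  have kj : (k <= j)%N by apply: kmin; rewrite ij /=; move: e0 nue; lra.
  case: k => [|k] in ik nuk kmin kj *.
    by exfalso; move: nuk; rewrite (_ : i = 0%N) ?Cii; [lra|lia].
  have ik' : (i <= k)%N.
    rewrite leqNgt; apply/negP => ki; have ei : i = k.+1 by lia.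
    by move: nuk; rewrite ei Cii; lra.
  have nuk' : nu (C i k) < e / 2.
    rewrite ltNge; apply/negP => h; have := kmin k; rewrite ik' h => /(_ isT).
    by rewrite ltnn.
  have ex_piece a b : exists W, restricts S (interval_sat S (C a b)) W.
    exact: piece_exists.
  have [V1 hV1] := ex_piece i k.+1; have [V2 hV2] := ex_piece k.+1 j.
  have -> : V = (V1 * V2)%g.
    have : restricts S (interval_sat S (C i k.+1 `|` C k.+1 j)) (V1 * V2)%g.
      by apply: piece_mul => //; exact: Cdisj.
    rewrite -CU//; move: hV; rewrite /restricts => hV hV12; apply: psi_ext.
    by move: hV hV12; apply: filterS2 => x h h' m; rewrite h h'.
  apply: (le_trans (LM _ _ (HV _ _ _ hV1) (HV _ _ _ hV2))).
  have h1 : L V1 <= 1.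
    apply: small hV1 _; rewrite (nuD i k k.+1)//.
    by have := CS k; move: nuk'; lra.
  have h2 : L V2 <= n%:R + 1.
    apply: IH hV2 => //; have := nuD i k.+1 j ik kj.
    by move: nuij nuk; rewrite -natr1 mulrDl mul1r; lra.
  by rewrite -natr1; lra.
have CT : C 0%N #|{: N.-tuple bool}| = setT.
  by apply/seteqP; split=> x // _; rewrite /C/= /rank ltn_ord.
apply: (claim q.+1 0%N #|{: N.-tuple bool}| S) => //.
  apply: (@le_trans _ _ 1); first exact/pr_le1/measurable_interval_sat.
  by rewrite -ler_pdivrMr// mul1r ltW// truncnS_gt.
rewrite CT /restricts; apply: filterS (ae_orbit T (interval_satT S1)) => x hx n.
by rewrite asboolT.
Qed.

End small_length.

(** * The index of a commensurating permutation *)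

Section index.
Implicit Types (M N : set int) (s t : symZN) (w : Defs.bij int).

Definition finitely_supported w : Prop :=
  exists2 K : int, 0 <= K & forall n, K <= `|n| -> w n = n.

(** For commensurated sets, being congruent amounts to having the same
    cardinality relative to the half-line. *)
Definition congruent M N : Prop :=
  exists2 w, finitely_supported w & forall n, N (w n) <-> M n.

Lemma congruent_refl M : congruent M M.
Proof. by exists 1%g => //; exists 0. Qed.

Lemma congruent_sym M N : congruent M N -> congruent N M.
Proof.
move=> [w [K K0 hK] hw]; exists (w^-1)%g.
  by exists K => // n Kn; rewrite bijV -{1}(hK n Kn); exact: bij_funK.
by move=> n; rewrite -hw bijV bij_invK.
Qed.

Lemma congruent_trans M N P : congruent M N -> congruent N P -> congruent M P.
Proof.
move=> [w [K K0 hK] hw] [w' [K' K'0 hK'] hw']; exists (w' * w)%g.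
  exists (Num.max K K'); first by rewrite le_max K0.
  by move=> n; rewrite ge_max => /andP[Kn K'n]; rewrite bijM hK// hK'.
by move=> n; rewrite bijM hw' hw.
Qed.

Lemma congruent_image s M N : congruent M N -> congruent (s @` M) (s @` N).
Proof.
move=> [w [K K0 hK] hw]; exists (val s * w * (val s)^-1)%g.
  have [K' K'0 hK'] := finite_int_bounded (finite_image s (bounded_int_finite K)).
  exists K' => // n Kn; rewrite !bijM hK; first exact: symKV.
  rewrite leNgt; apply/negP => h; have : `|n| < K'.
    by apply: hK'; exists (symZN_fun (s^-1)%g n) => //; exact: symKV.
  by rewrite ltNge Kn.
move=> n; split=> [[m Nm /(@sym_inj s) e]|[m Mm <-]].
  exists (symZN_fun (s^-1)%g n); last exact: symKV.
  by apply/hw; rewrite -[X in N X]e.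
by exists (w m); [exact/hw|rewrite !bijM; congr (s (w _)); exact: esym (symVK s m)].
Qed.

Definition ztransp (a b n : int) : int := if n == a then b else if n == b then a else n.

Lemma ztranspK a b : cancel (ztransp a b) (ztransp a b).
Proof.
move=> n; rewrite /ztransp.
have [->|na] := eqVneq n a; first by rewrite eqxx; case: eqVneq.
have [->|nb] := eqVneq n b; first by rewrite eqxx.
by rewrite (negbTE na) (negbTE nb).
Qed.

Definition transp a b : Defs.bij int := Defs.Bij (ztranspK a b) (ztranspK a b).

Lemma finitely_supported_transp a b : finitely_supported (transp a b).
Proof.
exists (`|a| + `|b| + 1) => [|n nab]; first by lia.
by rewrite /= /ztransp; case: eqVneq => [|_]; last case: eqVneq; lia.
Qed.

Lemma congruent_remove M N a b : congruent M N -> M a -> N b ->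
  congruent (M `\ a) (N `\ b).
Proof.
move=> [w fw hw] Ma Nb; apply: (@congruent_trans _ (N `\ w a)).
  exists w => // n; split=> [[/hw Mn ne]|[Mn ne]]; split=> //.
  - by move=> /= na; apply: ne; rewrite na.
  - exact/hw.
  - by move=> /= /(can_inj (bij_funK w)).
exists (transp (w a) b); first exact: finitely_supported_transp.
move=> n; rewrite /= /ztransp; case: eqVneq => [->|na].
  by split=> [[_]|[_]] h; exfalso; exact: h.
case: eqVneq => [nb|nb].
  rewrite nb in na *; split=> _; split=> //=; first exact/eqP.
    exact/hw.
  by move=> e; rewrite e eqxx in na.
by split=> -[Nn _]; split=> //=; apply/eqP.
Qed.

Lemma congruent_add M N a b : congruent M N -> ~ M a -> ~ N b ->
  congruent (M `|` [set a]) (N `|` [set b]).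
Proof.
move=> [w fw hw] nMa nNb; apply: (@congruent_trans _ (N `|` [set w a])).
  exists w => // n; split=> -[]; [move=> /hw; by left|move=> /= /(can_inj (bij_funK w)) ->; by right
    |move=> /hw; by left|move=> /= ->; by right].
have nNwa : ~ N (w a) by move=> /hw.
exists (transp (w a) b); first exact: finitely_supported_transp.
move=> n; rewrite /= /ztransp; case: eqVneq => [->|na].
  by split=> _; right.
case: eqVneq => [->|nb].
  split=> -[] //=.
  - by move=> wab; right; rewrite wab.
  - by move=> wab; right; rewrite wab.
split=> -[Nn|/= e]; [by left| |by left|].
  by move/eqP: nb.
by move/eqP: na.
Qed.

Definition half_line (k : int) : set int := [set n | k <= n].

Lemma half_line_add k : half_line k = half_line (k + 1) `|` [set k].
Proof.
apply/seteqP; split=> n; rewrite /half_line /=; last by move=> [|->]; lia.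
by move=> kn; have [->|nk] := eqVneq n k; [right|left; lia].
Qed.

Lemma half_line_remove k : half_line (k + 1) = half_line k `\ k.
Proof.
apply/seteqP; split=> n; rewrite /half_line /=; first by move=> h; split; lia.
by move=> [h /eqP ne]; lia.
Qed.

(** The number [k] is the index of [s]: one has
    [k = #|N \ s N| - #|s N \ N|], where [N] is the positive half-line. *)
Definition has_index s (k : int) : Prop := congruent (s @` half_line 0) (half_line k).

Lemma image_setU1 s M a : s @` (M `|` [set a]) = s @` M `|` [set s a].
Proof. by rewrite image_setU image_set1. Qed.

Lemma image_setD1 s M a : s @` (M `\ a) = (s @` M) `\ s a.
Proof.
apply/seteqP; split=> [_ [n [Mn na] <-]|_ [[n Mn <-] na]].
  by split; [exists n|move=> /= /(@sym_inj s)].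
by exists n => //; split=> // e; apply: na; rewrite /= e.
Qed.

(** Moving the end of a half-line adds or removes one point on both sides. *)
Lemma has_index_shift s k : has_index s k ->
  forall j, congruent (s @` half_line j) (half_line (k + j)).
Proof.
move=> hk; elim/int_ind => [|j IH|j IH].
- by rewrite addr0.
- rewrite -addn1 PoszD addrA !half_line_remove image_setD1.
  apply: congruent_remove => //; last by rewrite /half_line/=.
  by exists j%:Z => //; rewrite /half_line/=.
- have -> : - j.+1%:Z = - j%:Z - 1 by lia.
  rewrite addrA half_line_add [X in congruent _ X]half_line_add !subrK image_setU1.
  apply: congruent_add => //; last by rewrite /half_line/=; lia.
  by move=> [n /= nj /(@sym_inj s) e]; move: nj; rewrite e /half_line/=; lia.
Qed.

Lemma has_indexM s t k l : has_index s k -> has_index t l -> has_index (s * t)%g (k + l).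
Proof.
move=> hs ht; rewrite /has_index.
have -> : symZN_fun (s * t)%g @` half_line 0 = s @` (t @` half_line 0) by rewrite image_comp.
apply: congruent_trans (congruent_image s ht) _; exact: has_index_shift.
Qed.

Lemma has_index1 : has_index 1%g 0.
Proof. by rewrite /has_index (_ : _ @` _ = half_line 0) ?image_id//; exact: congruent_refl. Qed.

Lemma has_indexV s k : has_index s k -> has_index (s^-1)%g (- k).
Proof.
move=> /has_index_shift/(_ (- k)); rewrite subrr => /(congruent_image (s^-1)%g).
rewrite image_comp (_ : _ \o _ = id); last by apply/funext => n; exact: symVK.
by rewrite image_id => /congruent_sym.
Qed.

(** Each point added to a half-line can be traded for the point just below its
    end. *)
Lemma near_natZ_congruent M (K : int) : 0 <= K -> near_natZ M K ->
  exists k, congruent M (half_line k).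
Proof.
move=> K0 MK.
have : finite_set (M `&` [set n : int | `|n| < K]).
  by apply: sub_finite_set (bounded_int_finite K) => n [].
move=> /finite_seqP[l lE].
have -> : M = half_line K `|` [set` l].
  rewrite -lE; apply/seteqP; split=> n.
    move=> Mn; have [Kn|nK] := leP K `|n|; last by right.
    by have [h _] := MK n Kn; left; have := h Mn; rewrite /half_line/=; lia.
  by rewrite /half_line/= => -[Kn|[]//]; apply/MK; lia.
elim: l {lE} => [|a l [k IH]]; first by exists K; rewrite set_nil setU0; exact: congruent_refl.
have -> : half_line K `|` [set` a :: l] = (half_line K `|` [set` l]) `|` [set a].
  apply/seteqP; split=> n /=; rewrite !inE; last first.
    by move=> [[Kn|nl]|->]; [left|right; rewrite nl orbT|right; rewrite eqxx].
  by move=> [Kn|/orP[/eqP ->|nl]]; [left; left|right|left; right].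
have [h|h] := pselect ((half_line K `|` [set` l]) a).
  by exists k; rewrite (_ : _ `|` [set a] = half_line K `|` [set` l])//;
    apply/seteqP; split=> n; [move=> [//|->]|left].
exists (k - 1); rewrite (half_line_add (k - 1)) subrK.
by apply: congruent_add => //; rewrite /half_line/=; lia.
Qed.

Lemma has_index_ex s : exists k, has_index s k.
Proof.
have [K K0 hK] := sym_bound (s^-1)%g.
by apply: (@near_natZ_congruent _ K K0); exact: near_natZ_image.
Qed.

Lemma has_index_comm s t : has_index [~ s, t]%g 0.
Proof.
have [k hk] := has_index_ex s; have [l hl] := has_index_ex t.
have := has_indexM (has_indexV hk) (has_indexM (has_indexV hl) (has_indexM hk hl)).
by rewrite (_ : - k + _ = 0)//; lia.
Qed.

Lemma has_index_pres s t k : pres (symZN_fun (s^-1 * t)%g) 0 -> has_index t k -> has_index s k.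
Proof.
move=> h; rewrite /has_index (_ : t @` half_line 0 = s @` half_line 0)//.
have e n : s (symZN_fun (s^-1 * t)%g n) = t n by rewrite symM symKV.
apply/seteqP; split=> _ [n n0 <-].
  by exists (symZN_fun (s^-1 * t)%g n) => //; rewrite /half_line/= h.
exists (symZN_fun (t^-1)%g (s n)); last exact: symKV.
by rewrite /half_line/= -h symM symKV symVK.
Qed.

End index.

(** * Correcting an element of index zero in sparse windows *)

Section windows.
Variables (E : set int) (w : Defs.bij int) (K : int).
Hypotheses (K0 : 0 <= K) (wK : forall n, K <= `|n| -> w n = n).
Hypothesis E_sparse : forall e e', E e -> E e' -> e <> e' -> K + K < `|e - e'|.

(** The permutation [v], recentred at [e], within distance [K] of each point [e]
    of [E]; the identity elsewhere. *)
Definition window (v : Defs.bij int) (n : int) : int :=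
  xget n [set m | exists e, [/\ E e, `|n - e| <= K & m = e + v (n - e)]].

Lemma window_in v e n : E e -> `|n - e| <= K -> window v n = e + v (n - e).
Proof.
move=> Ee ne; apply: xget_unique; first by exists e.
move=> m [e' [Ee' ne' ->]]; have [->//|ee'] := eqVneq e' e.
by have := E_sparse Ee' Ee (elimN eqP ee'); lia.
Qed.

Lemma window_out v n : (forall e, E e -> K < `|n - e|) -> window v n = n.
Proof.
by move=> h; apply: xgetPN => m [e [/h + ne _]]; rewrite ltNge ne.
Qed.

Lemma windowP n : (exists2 e, E e & `|n - e| <= K) \/ (forall e, E e -> K < `|n - e|).
Proof.
have [h|h] := pselect (exists2 e, E e & `|n - e| <= K); [by left|right => e Ee].
by rewrite ltNge; apply/negP => ne; apply: h; exists e.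
Qed.

Lemma small_perm (v : Defs.bij int) n : (forall m, K <= `|m| -> v m = m) ->
  `|n| <= K -> `|v n| <= K.
Proof.
move=> vK nK; rewrite leNgt; apply/negP => h.
have /(can_inj (bij_funK v)) e := vK _ (ltW h); move: h; rewrite e; lia.
Qed.

Lemma windowK : cancel (window w) (window (w^-1)%g).
Proof.
move=> n; have [[e Ee ne]|h] := windowP n; last by rewrite (window_out w h) window_out.
rewrite (window_in w Ee ne) (window_in _ Ee); last first.
  by rewrite addrC addKr; exact: small_perm.
have -> : e + w (n - e) - e = w (n - e) by rewrite addrC addKr.
by rewrite bijV bij_funK addrC subrK.
Qed.

Lemma window_displacement n : `|window w n - n| < K + K + 1.
Proof.
have [[e Ee ne]|h] := windowP n; last by rewrite window_out// subrr normr0; lia.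
by rewrite (window_in w Ee ne); have := small_perm wK ne; lia.
Qed.

Hypothesis E0 : E 0.

Lemma window_far n : K < `|n| -> K < `|window w n| /\ (0 <= window w n) = (0 <= n).
Proof.
move=> Kn; have [[e Ee ne]|h] := windowP n; last by rewrite window_out.
rewrite (window_in w Ee ne); have wn := small_perm wK ne.
have e0 : e <> 0 by move=> e0; move: ne; rewrite e0; lia.
have := E_sparse Ee E0 e0; rewrite subr0 => eK; lia.
Qed.

Lemma window_natZ n : (0 <= window w n) = (0 <= w n).
Proof.
have [nK|nK] := leP `|n| K; first by rewrite (window_in w E0) ?subr0 ?add0r.
by rewrite (window_far nK).2 wK//; lia.
Qed.

(** The half-line starting just to the right of the window around 0. *)
Lemma window_pres : pres (window w) (K + 1).
Proof.
move=> n; have [nK|nK] := leP `|n| K.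
  rewrite (window_in w E0) ?subr0 ?add0r//; have := small_perm wK nK; lia.
by have [] := window_far nK; lia.
Qed.

End windows.

(** * Elements of index zero *)

Lemma derived_subgroup_is_subgroup (G : groupType) : is_subgroup (derived_subgroup G).
Proof.
split=> [A [[] //]|x y hx hy A hA|x hx A hA].
- by case: (hA) => -[_ hM _] _; apply: hM; [exact: hx|exact: hy].
- by case: (hA) => -[_ _ hV] _; apply: hV; exact: hx.
Qed.

Lemma derived_subgroup_comm (G : groupType) (x y : G) : derived_subgroup G [~ x, y]%g.
Proof. by move=> A [_ h]; apply: h; exists x, y. Qed.

Section index_zero.
Context {disp : measure_display} {X : measurableType disp} {R : realType}.
Context {mu : probability X R}.
Variable T : aut mu.
Notation Tp := (aut_pow T).
Notation G := (comfg T).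
Notation psi := (@psi disp X R mu T).
Notation len := (@len disp X R mu T).
Implicit Types (S V W : G) (E : set X).
Variables (U : nat -> set X) (mU : forall i, measurable (U i)) (sepU : separating U).
Hypotheses (mu_atomless : atomless mu) (T_ergodic : ergodic T).

Let T_aperiodic := aperiodic_inj mU sepU mu_atomless T_ergodic.

Definition index_zero S : Prop := \forall x \ae mu, has_index (psi S x) 0.

Lemma derived_index_zero S : derived_subgroup G S -> index_zero S.
Proof.
suff : derived_subgroup G `<=` [set V | index_zero V] by move/(_ S).
apply: smallest_sub; first split.
- by apply: filterS (psi1 T_aperiodic) => x ->; exact: has_index1.
- rewrite /index_zero => V W /= hV hW; move: (psiM T_aperiodic V W) hV hW.
  by apply: filterS3 => x -> hV hW; exact: (has_indexM hV hW).
- rewrite /index_zero => V /= hV; move: (psiV T_aperiodic V) hV.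
  by apply: filterS2 => x -> /has_indexV; rewrite oppr0.
- move=> _ [V [W ->]]; rewrite /index_zero/=.
  move: (psi_comm T_aperiodic V W) (psiV T_aperiodic V) (psiV T_aperiodic W).
  by apply: filterS3 => x -> -> ->; exact: (has_index_comm (psi V x) (psi W x)).
Qed.

(** Whether the index vanishes depends only on the image of the half-line, which
    almost every point shares with a rapidly converging sequence. *)
Lemma index_zero_limit S :
  (forall e : R, 0 < e -> exists V, index_zero V /\ len (S^-1 * V)%g < e) -> index_zero S.
Proof.
move=> h.
have e0 n : 0 < (2^-1 : R) ^+ n by rewrite exprn_gt0// invr_gt0.
have [V hV] := choice (fun n => h _ (e0 n)).
have := @pr_limsup _ _ _ mu (fun n => broken (S^-1 * V n)%g)
  (fun n => measurable_broken _) (fun n => ltW (hV n).2) => ls.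
have hi : \forall x \ae mu, forall n, has_index (psi (V n) x) 0.
  by apply: ae_all => n; exact: (hV n).1.
have hd : \forall x \ae mu, forall n, psi (S^-1 * V n)%g x = ((psi S x)^-1 * psi (V n) x)%g.
  by apply: ae_all => n; exact: psi_dist.
rewrite /index_zero; move: ls hi hd; apply: filterS3 => x [N hN] hi hd.
apply: has_index_pres (hi N); rewrite -hd.
by have /contrapT := hN N (leqnn N).
Qed.

Lemma sparse_subset E (n : nat) : measurable E -> 0 < pr mu E ->
  exists F, [/\ measurable F, F `<=` E, 0 < pr mu F &
    forall x (l : nat), (l < n)%N -> F x -> ~ F (Tp l.+1 x)].
Proof.
move=> mE E0; elim: n => [|n [F [mF FE F0 hF]]]; first by exists E; split.
pose B j := [set x | U j x /\ ~ U j (Tp n.+1 x)].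
have mB j : measurable (B j).
  apply: (@measurableI _ _ (U j) [set x | ~ U j (Tp n.+1 x)]) => //.
  by apply: measurable_not; exact: measurable_aut_pow.
have [|j FB] := @pr_countable_pos _ _ _ mu _ F B mF mB F0.
  apply: filterS T_aperiodic => x ap _; apply: sepU => e.
  by have := ap 0 n.+1%:Z; rewrite aut_pow0 => /(_ e).
exists (F `&` B j); split=> //.
- exact: measurableI.
- by move=> x [/FE].
- move=> x l; rewrite ltnS leq_eqVlt => /predU1P[->|ln] [Fx Bx] [Fl Bl].
    by have [_ nU] := Bx; have [Ul _] := Bl; exact: nU.
  exact: (hF x l ln).
Qed.

Lemma len_lt1_pres W E : measurable E -> 0 < pr mu E ->
  (\forall x \ae mu, E x -> exists k, pres (psi W x) k) -> len W < 1.
Proof.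
move=> mE E0 hE; rewrite ltNge; apply/negP => W1.
have mp := measurable_pres W 0.
have p0 : pr mu [set x | pres (psi W x) 0] = 0.
  have : pr mu [set x | pres (psi W x) 0] + len W = 1.
    rewrite -pr_disjointU; [|exact: mp|exact: measurable_broken|by move=> x hp /(_ hp)].
    apply: ae_pr1; first by apply: measurableU => //; exact: measurable_broken.
    by apply: aeW => x; have [|] := pselect (pres (psi W x) 0); [left|right].
  by have := pr_ge0 mu [set x | pres (psi W x) 0]; lra.
move/(pr0P mu mp)/(ae_orbit T): p0 => np.
have [x Ex [[hx sh] nx]] : exists2 x, E x & ((E x -> exists k, pres (psi W x) k) /\
   (forall k j, pres (psi W (Tp k x)) j <-> pres (psi W x) (j + k))) /\
   (forall n, ~ [set x | pres (psi W x) 0] (Tp n x)).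
  apply: (pr_pos_ex mE E0); have h := pres_shift W.
  by move: hE h np; apply: filterS3.
by have [k pk] := hx Ex; apply: (nx k); apply/sh; rewrite add0r.
Qed.

(** On a set [E] of positive measure [S] maps the positive half-line to one and
    the same set [M], which some finitely supported permutation maps back to the
    half-line because the index vanishes; [W] performs this permutation in
    disjoint windows around the points of a sparse part of [E]. *)
Lemma index_zero_correction S : index_zero S ->
  exists W, len W < 1 /\ len (W * S)%g < 1.
Proof.
move=> S0.
pose E0 l := [set x | forall n, seqcomm l (psi S x n) <-> 0 <= n].
have mE0 l : measurable (E0 l).
  apply: measurable_forall => n.
  exact: (measurable_psi S n (fun m => seqcomm l m <-> 0 <= n)).
have [||l] := @pr_countable_pos _ _ _ mu _ setT E0 measurableT mE0.
- by rewrite pr_setT.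
- apply: aeW => x _.
  have /set_mem/seqcommP[l hl] := valP (psi S x).
  exists l => n; rewrite -hl; split=> [[m m0 /(@sym_inj (psi S x)) <-]//|n0].
  by exists n.
rewrite setTI => El.
have [x Ex [w [K K0 wK] hw]] := pr_pos_ex (mE0 l) El S0.
have hw' n : seqcomm l n <-> 0 <= w n.
  change (seqcomm l n <-> half_line 0 (w n)); rewrite hw; split=> [ln|[m m0 <-]]; last exact/Ex.
  exists (symZN_fun ((psi S x)^-1)%g n); last exact: symKV.
  by apply/Ex; rewrite symKV.
have [E [mE EE0 E_pos spE]] := sparse_subset (absz (K + K)) (mE0 l) El.
pose Z x := [set e | E (Tp e x)].
have Zsp y (e e' : int) : Z y e -> Z y e' -> e <> e' -> K + K < `|e - e'|.
  have sp a b : Z y a -> Z y b -> a < b -> K + K < b - a.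
    move=> Za Zb ab; rewrite ltNge; apply/negP => h.
    apply: (spE (Tp a y) (absz (b - a)).-1 _ Za); first by lia.
    by rewrite -aut_powD (_ : _ + a = b)//; lia.
  move=> Ze Ze' ne; have [h|h] := ltP e e'; first by have := sp _ _ Ze Ze' h; lia.
  by have := sp _ _ Ze' Ze ltac:(lia); lia.
have wVK n : K <= `|n| -> (w^-1)%g n = n.
  by move=> Kn; rewrite bijV -{1}(wK n Kn) bij_funK.
pose f y n := window (Z y) K w n.
have mZ (e : int) : measurable [set y | Z y e] by exact: measurable_aut_pow.
have [W hW] : exists W, \forall x \ae mu, forall n, psi W x n = f x n.
  apply: (psi_build T_aperiodic).
  - move=> m; rewrite (_ : mkset _ =
      [set y | exists e, Z y e /\ (`|0 - e| <= K /\ m = e + w (0 - e))] `|`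
      ([set y | forall e, Z y e -> K < `|0 - e|] `&` [set _ | m = 0])).
      apply: measurableU.
        apply: measurable_exists => e.
        apply: (@measurableI _ _ [set y | Z y e]
          [set _ | `|0 - e| <= K /\ m = e + w (0 - e)]) => //.
        exact: measurable_const.
      apply: measurableI; last exact: (measurable_const (m = 0)).
      apply: measurable_forall => e.
      rewrite (_ : mkset _ = ~` [set y | Z y e] `|` [set _ | K < `|0 - e|]).
        apply: measurableU; first exact: measurableC.
        exact: (measurable_const (K < `|0 - e|)).
      apply/seteqP; split=> y /=.
        by have [Ze /(_ Ze)|nZ _] := pselect (Z y e); [right|left].
      by move=> [].
    apply/seteqP; split=> y /=; rewrite /f.
      have [[e Ze ne]|h] := windowP (Z y) K 0.
        by rewrite (window_in K0 (@Zsp y) w Ze ne) => <-; left; exists e.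
      by rewrite (window_out w h) => <-; right.
    move=> [[e [Ze [ne ->]]]|[h ->]]; first by rewrite (window_in K0 (@Zsp y) w Ze ne).
    by rewrite (window_out w h).
  - apply: aeW => y n; rewrite /f.
    have [[e Ze ne]|h] := windowP (Z y) K n.
      rewrite (window_in K0 (@Zsp y) w Ze ne).
      have Ze' : Z (Tp n y) (e - n) by rewrite /Z/= -aut_powD subrK.
      rewrite (window_in K0 (@Zsp _) w Ze'); last by lia.
      by rewrite sub0r opprB addrAC.
    rewrite (window_out w h) window_out ?subrr// => e.
    by rewrite /Z/= -aut_powD => /h; lia.
  - apply: aeW => y.
    apply: (in_symZN_displacement (q := window (Z y) K (w^-1)%g) (K := K + K + 1)).
    + exact: (windowK K0 wK (@Zsp y)).
    + have := windowK K0 wVK (@Zsp y); rewrite invgK; exact.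
    + exact: (window_displacement K0 wK (@Zsp y)).
exists W; split.
  apply: (len_lt1_pres mE E_pos); apply: filterS hW => y hW Ey.
  exists (K + 1) => n; rewrite hW; exact: (window_pres K0 wK (@Zsp y)).
apply: (len_lt1_pres mE E_pos); move: hW (psiM T_aperiodic W S).
apply: filterS2 => y hW -> Ey; exists 0 => n.
rewrite symM hW /f (window_natZ K0 wK (@Zsp y))//.
by apply/idP/idP => [/hw'/(EE0 _ Ey)|/(EE0 _ Ey)/hw'].
Qed.

End index_zero.

(** * Completeness *)

Section completeness.
Context {disp : measure_display} {X : measurableType disp} {R : realType}.
Context {mu : probability X R}.
Variable T : aut mu.
Notation Tp := (aut_pow T).
Notation G := (comfg T).
Notation psi := (@psi disp X R mu T).
Notation len := (@len disp X R mu T).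
Implicit Types (S V W : G).
Hypothesis T_aperiodic : \forall x \ae mu, forall j k, Tp j x = Tp k x -> j = k.

Definition stable_value (p : nat -> symZN) (n m : int) : Prop :=
  exists N, forall k, (N <= k)%N -> p k n = m.

Lemma stable_value_unique p n m m' : stable_value p n m -> stable_value p n m' -> m = m'.
Proof.
by move=> [N hN] [N' hN']; rewrite -(hN (maxn N N')) ?leq_maxl// hN' ?leq_maxr.
Qed.

Lemma stable_value_ex (p : nat -> symZN) n :
  (exists N, forall k, (N <= k)%N -> p k.+1 n = p k n) -> exists m, stable_value p n m.
Proof.
move=> [N hN]; exists (p N n), N => k Nk.
rewrite -(subnKC Nk); elim: (k - N)%N => [|i IH]; first by rewrite addn0.
by rewrite addnS hN ?leq_addr.
Qed.

Lemma pres_chain (p : nat -> symZN) (j : int) (N : nat) :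
  (forall k, (N <= k)%N -> pres (symZN_fun ((p k)^-1 * p k.+1)%g) j) ->
  forall k, (N <= k)%N -> pres (symZN_fun ((p N)^-1 * p k)%g) j.
Proof.
move=> h k Nk; rewrite -(subnKC Nk); elim: (k - N)%N => [|i IH].
  by rewrite addn0 mulVg; exact: pres1.
rewrite addnS; have := presM IH (h (N + i)%N (leq_addr _ _)).
by rewrite mulgA -(mulgA (p N)^-1%g) mulgV mulg1.
Qed.

Section fast_sequences.
Variables (v : nat -> G).

(** Both the images and the preimages of the half-line have to settle for the
    limit to be a permutation. *)
Definition jump k : set X :=
  broken ((v k)^-1 * v k.+1)%g `|` broken (v k * (v k.+1)^-1)%g.

Lemma measurable_jump k : measurable (jump k).
Proof. by apply: measurableU; exact: measurable_broken. Qed.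

Definition late_jump i : set X := \bigcup_(k in [set k | (i <= k)%N]) jump k.

Lemma measurable_late_jump i : measurable (late_jump i).
Proof. by apply: bigcup_measurable => k _; exact: measurable_jump. Qed.

Hypothesis v_fast : forall k, pr mu (jump k) <= 2^-1 ^+ k.

Lemma late_jump_ae : \forall x \ae mu, exists i, ~ late_jump i x.
Proof.
apply: filterS (pr_limsup measurable_jump v_fast) => x [N hN].
by exists N => -[k /= Nk]; exact: hN.
Qed.

Let p x k : symZN := psi (v k) x.

Lemma jump_pres : \forall x \ae mu, forall j i, ~ late_jump i (Tp j x) ->
  forall k, (i <= k)%N -> pres (symZN_fun ((p x k)^-1 * p x k.+1)%g) j /\
    pres (symZN_fun (p x k * (p x k.+1)^-1)%g) j.
Proof.
have h1 : \forall x \ae mu, forall k, psi ((v k)^-1 * v k.+1)%g x = ((p x k)^-1 * p x k.+1)%g.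
  by apply: ae_all => k; exact: psi_dist.
have h2 : \forall x \ae mu, forall k, psi (v k * (v k.+1)^-1)%g x = (p x k * (p x k.+1)^-1)%g.
  apply: ae_all => k; move: (psiM T_aperiodic (v k) (v k.+1)^-1%g) (psiV T_aperiodic (v k.+1)).
  by apply: filterS2 => x -> ->.
have h3 : \forall x \ae mu, forall k, (forall i j, pres (psi ((v k)^-1 * v k.+1)%g (Tp i x)) j <->
      pres (psi ((v k)^-1 * v k.+1)%g x) (j + i)) /\
    (forall i j, pres (psi (v k * (v k.+1)^-1)%g (Tp i x)) j <->
      pres (psi (v k * (v k.+1)^-1)%g x) (j + i)).
  by apply: ae_all => k; move: (pres_shift ((v k)^-1 * v k.+1)%g)
    (pres_shift (v k * (v k.+1)^-1)%g); apply: filterS2.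
move: h1 h2 h3; apply: filterS3 => x h1 h2 h3 j i nj k ik.
rewrite -h1 -h2; have [s1 s2] := h3 k.
have := s1 j 0; have := s2 j 0; rewrite add0r => -[g2 _] [g1 _].
split; [apply: g1|apply: g2]; apply: contrapT => h; apply: nj; exists k => //.
  by left.
by right.
Qed.

Lemma fast_limit : exists l, \forall x \ae mu, forall n, stable_value (p x) n (psi l x n).
Proof.
pose g x n := xget 0 [set m | stable_value (p x) n m].
have gP x n m : stable_value (p x) n m -> g x n = m.
  by move=> h; apply: xget_unique => // m' h'; exact: stable_value_unique h' h.
have mQ n m : measurable [set x | stable_value (p x) n m].
  apply: measurable_exists => N; apply: measurable_forall => k.
  have [Nk|Nk] := leqP N k.
    rewrite (_ : mkset _ = [set x | psi (v k) x n = m]); first exact: measurable_psi_eq.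
    by apply/seteqP; split=> x /=; auto.
  by rewrite (_ : mkset _ = setT)//; apply/seteqP; split.
have steps : \forall x \ae mu, [/\ forall n, exists m, stable_value (p x) n m,
    forall n, exists m, stable_value (fun k => (p x k)^-1)%g n m &
    exists N, forall k, (N <= k)%N -> pres (symZN_fun ((p x N)^-1 * p x k)%g) 0].
  move: jump_pres (ae_orbit T late_jump_ae); apply: filterS2 => x jp lj; split=> [n|n|].
  - apply: stable_value_ex.
    have [i hi] := lj n; have [i' hi'] := lj (n + 1).
    exists (maxn i i') => k; rewrite geq_max => /andP[ik i'k].
    have := pres_fix (jp _ _ hi _ ik).1 (jp _ _ hi' _ i'k).1.
    by rewrite symM => /(congr1 (p x k)); rewrite symKV.
  - apply: stable_value_ex.
    have [i hi] := lj n; have [i' hi'] := lj (n + 1).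
    exists (maxn i i') => k; rewrite geq_max => /andP[ik i'k].
    have := pres_fix (jp _ _ hi _ ik).2 (jp _ _ hi' _ i'k).2.
    by rewrite symM => /(congr1 (symZN_fun (p x k)^-1%g)); rewrite symVK.
  - have [i hi] := lj 0; exists i; apply: pres_chain => k ik.
    exact: (jp _ _ hi _ ik).1.
have [l hl] : exists l, \forall x \ae mu, forall n, psi l x n = g x n.
  apply: (psi_build T_aperiodic).
  - move=> m; rewrite (_ : mkset _ = [set x | stable_value (p x) 0 m] `|`
        ([set x | forall m', ~ stable_value (p x) 0 m'] `&` [set _ | 0 = m])).
      apply: measurableU => //; apply: measurableI; last exact: (measurable_const (0 = m)).
      by apply: measurable_forall => m'; exact: measurable_not.
    apply/seteqP; split=> x /=.
      have [[m' h] <-|/forallNP h <-] := pselect (exists m', stable_value (p x) 0 m').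
        by left; rewrite (gP _ _ _ h).
      by right; split=> //; apply/esym/xgetPN => m'; exact: h.
    by move=> [/gP//|[h <-]]; apply/xgetPN => m'; exact: h.
  - have sh : \forall x \ae mu, forall i k n, psi (v i) (Tp k x) n = psi (v i) x (n + k) - k.
      by apply: ae_all => i; exact: psi_shift.
    move: steps sh; apply: filterS2 => x [st _ _] sh n; have [m hm] := st n.
    rewrite (gP _ _ _ hm); apply: gP; have [N hN] := hm.
    by exists N => k /hN; rewrite /p sh add0r => ->.
  - apply: filterS steps => x [st stV [N hN]].
    have [h hP] := choice stV.
    have gS n : stable_value (p x) n (g x n) by have [m hm] := st n; rewrite (gP _ _ _ hm).
    have gK : cancel (g x) h.
      move=> n; have [N1 h1] := gS n; have [N2 h2] := hP (g x n).
      by rewrite -(h2 (maxn N1 N2)) ?leq_maxr// -(h1 (maxn N1 N2)) ?leq_maxl// symVK.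
    have hK : cancel h (g x).
      move=> n; have [N1 h1] := gS (h n); have [N2 h2] := hP n.
      by rewrite -(h1 (maxn N1 N2)) ?leq_maxl// -(h2 (maxn N1 N2)) ?leq_maxr// symKV.
    have [K K0 hKb] := sym_bound (p x N)^-1%g.
    have [K' K'0 hK'] := finite_int_bounded (finite_image h (bounded_int_finite K)).
    apply: (in_symZN_bound gK hK (K := K')) => n K'n.
    have gn : K <= `|g x n|.
      rewrite leNgt; apply/negP => h1; have : `|n| < K' by apply: hK'; exists (g x n).
      by rewrite ltNge K'n.
    rewrite -(hKb _ gn); have [N1 h1] := gS n.
    have := hN (maxn N N1) (leq_maxl _ _) n.
    by rewrite symM h1 ?leq_maxr.
exists l; move: hl steps; apply: filterS2 => x hl [st _ _] n.
by rewrite hl; have [m hm] := st n; rewrite (gP _ _ _ hm).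
Qed.

Lemma fast_limit_len l i : (\forall x \ae mu, forall n, stable_value (p x) n (psi l x n)) ->
  len_dist len (v i) l <= pr mu (late_jump i).
Proof.
move=> hl; apply: len_le_pr; first exact: measurable_late_jump.
move: jump_pres hl (psi_dist T_aperiodic (v i) l); apply: filterS3 => x jp {}hl -> h.
apply: contrapT => nl; apply: h.
have ch := @pres_chain (p x) 0 i (fun k ik => (jp 0 i nl k ik).1).
move=> n; have [N hN] := hl n.
have := ch (maxn i N) (leq_maxl _ _) n.
by rewrite !symM hN ?leq_maxr.
Qed.

End fast_sequences.

Lemma comfg_complete : two_sided_complete len.
Proof.
move=> u cauchy; have lenG := comfg_length_group T_aperiodic.
have e0 n : 0 < (2^-1 : R) ^+ n by rewrite exprn_gt0// invr_gt0.
have [N hN] := choice (fun k => cauchy _ (e0 k)).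
pose r k := (k + \max_(i < k.+1) N i)%N.
have rN k k' : (k <= k')%N -> (N k <= r k')%N.
  move=> kk'; rewrite /r; apply: leq_trans (leq_addl _ _).
  exact: (leq_bigmax (Ordinal (leq_ltn_trans kk' (ltnSn k')))).
pose v k := u (r k).
have fast k : pr mu (jump v k) <= 2^-1 ^+ k.
  apply: le_trans (prU _ (measurable_broken _) (measurable_broken _)) _.
  have := hN k (r k) (r k.+1) (rN _ _ (leqnn k)) (rN _ _ (leqnSn k)).
  by rewrite /two_sided_dist /len_dist invgK => /ltW.
have [l hl] := fast_limit fast; exists l => e e_0.
have e20 : 0 < e / 2 by rewrite divr_gt0.
have [M hM] := cauchy _ e20.
have [i hi] : exists i, pr mu (late_jump v (i + M)%N) < e / 2.
  apply: (@pr_decr_small _ _ _ mu (fun i => late_jump v (i + M)%N)) => //.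
  - by move=> i; exact: measurable_late_jump.
  - by move=> i x [k /= ik jk]; exists k => //=; apply: leq_trans ik; rewrite leq_add2r.
  apply: filterS (late_jump_ae fast) => x [i hi]; exists i => -[k /= ik jk]; apply: hi.
  by exists k => //=; apply: leq_trans ik; exact: leq_addr.
exists M => n Mn.
have Mr : (M <= r (i + M))%N by rewrite /r -addnA addnCA leq_addr.
have h1 := hM n (r (i + M)%N) Mn Mr.
have h2 : len_dist len (v (i + M)%N) l <= pr mu (late_jump v (i + M)%N).
  exact: fast_limit_len.
have h3 := len_distE lenG (u n) (v (i + M)%N) l.
have h4 := len_dist_ge0 lenG (u n)^-1%g (u (r (i + M)%N))^-1%g.
apply: le_lt_trans h3 _; rewrite [e]splitr; apply: ltrD; last exact: le_lt_trans hi.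
by apply: le_lt_trans h1; rewrite lerDl.
Qed.

End completeness.

(** * Separability *)

Section separability.
Context {disp : measure_display} {X : measurableType disp} {R : realType}.
Variable mu : probability X R.
Variables (U : nat -> set X) (mU : forall i, measurable (U i)).
Hypothesis measurableE : @measurable disp X = <<s range U >>.
Implicit Types (A B C : set X) (e : R).

(** [A] is a union of cells of level [N]; these sets form a countable algebra
    generating the measurable sets. *)
Definition determined (N : nat) A : Prop :=
  forall x y, pattern U N x = pattern U N y -> A x -> A y.

Lemma determinedW N M A : (N <= M)%N -> determined N A -> determined M A.
Proof.
by move=> NM h x y /patternP e; apply: h; apply/patternP => i iN; apply: e; exact: leq_trans NM.
Qed.

Lemma determinedC N A : determined N A -> determined N (~` A).
Proof. by move=> h x y e nA Ay; apply: nA; exact: h (esym e) Ay. Qed.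

Lemma determinedU N A B : determined N A -> determined N B -> determined N (A `|` B).
Proof. by move=> hA hB x y e [/(hA _ _ e)|/(hB _ _ e)]; [left|right]. Qed.

Lemma measurable_determined N A : determined N A -> measurable A.
Proof.
move=> h; rewrite (_ : A = [set x | exists2 y, A y & pattern U N x = pattern U N y]).
  exact: (measurable_pattern mU (fun w => exists2 y, A y & w = pattern U N y)).
by apply/seteqP; split=> x; [exists x|move=> [y Ay e]; exact: h (esym e) Ay].
Qed.

Definition setdiff A B := (A `\` B) `|` (B `\` A).

Lemma measurable_setdiff A B : measurable A -> measurable B -> measurable (setdiff A B).
Proof. by move=> mA mB; apply: measurableU; exact: measurableD. Qed.

Definition approximable A : Prop := measurable A /\
  forall e, 0 < e -> exists N B, determined N B /\ pr mu (setdiff A B) < e.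

Lemma approximable_determined N A : determined N A -> approximable A.
Proof.
move=> h; split; first exact: measurable_determined h.
move=> e e0; exists N, A; split=> //.
by rewrite /setdiff setDv setU0 pr_set0.
Qed.

Lemma approximableC A : approximable A -> approximable (~` A).
Proof.
move=> [mA hA]; split; first exact: measurableC.
move=> e /hA[N [B [dB hB]]]; exists N, (~` B); split; first exact: determinedC.
rewrite (_ : setdiff _ _ = setdiff A B)//.
apply/seteqP; split=> x [] [h1 h2].
- by right; split=> //; exact: contrapT.
- by left; split=> //; exact: contrapT.
- by right; split=> //; move=> /(_ h1).
- by left; split=> //; move=> /(_ h1).
Qed.

Lemma approximableU A B : approximable A -> approximable B -> approximable (A `|` B).
Proof.
move=> [mA hA] [mB hB]; split; first exact: measurableU.
move=> e e0; have e20 : 0 < e / 2 by rewrite divr_gt0.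
have [N [C [dC AC]]] := hA _ e20; have [M [D [dD BD]]] := hB _ e20.
exists (maxn N M), (C `|` D); split.
  apply: determinedU; first exact: determinedW (leq_maxl _ _) dC.
  exact: determinedW (leq_maxr _ _) dD.
have mC := measurable_determined dC; have mD := measurable_determined dD.
apply: (@le_lt_trans _ _ (pr mu (setdiff A C `|` setdiff B D))).
  apply: le_pr.
  - by apply: measurable_setdiff; exact: measurableU.
  - by apply: measurableU; exact: measurable_setdiff.
  move=> x [[[Ax|Bx] /not_orP[nC nD]]|[[Cx|Dx] /not_orP[nA nB]]].
  - by left; left.
  - by right; left.
  - by left; right.
  - by right; right.
apply: le_lt_trans (prU _ _ _) _; [exact: measurable_setdiff..|].
by rewrite [e]splitr ltrD.
Qed.

(** The approximable sets form a sigma-algebra. *)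
Lemma approximable_measurable A : measurable A -> approximable A.
Proof.
rewrite measurableE; apply: smallest_sub => [|_ [i _ <-]]; last first.
  apply: (@approximable_determined i.+1) => x y /patternP/(_ i (ltnSn i)) h.
  by move/h.
split.
- by apply: (@approximable_determined 0%N).
- by move=> B hB; rewrite setTD; exact: approximableC.
move=> F hF; have mF i : measurable (F i) by case: (hF i).
split; first exact: bigcupT_measurable.
move=> e e0; have e20 : 0 < e / 2 by rewrite divr_gt0.
pose P n := \big[setU/set0]_(i < n) F i.
have aP n : approximable (P n).
  rewrite /P; elim: n => [|n IH].
    by rewrite big_ord0; apply: (@approximable_determined 0%N).
  by rewrite big_ord_recr; exact: approximableU.
have PE n x : P n x <-> exists2 i, (i < n)%N & F i x.
  rewrite /P -bigcup_mkord; split=> [[i /= ? ?]|[i ? ?]]; by exists i.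
have [n hn] : exists n, pr mu ((\bigcup_i F i) `\` P n) < e / 2.
  apply: pr_decr_small => //.
  - by move=> n; apply: measurableD; [exact: bigcupT_measurable|case: (aP n)].
  - move=> n x [Fx nP]; split=> // /PE[i ni Fi]; apply: nP; apply/PE.
    by exists i => //; exact: ltnW.
  apply: aeW => x; have [[i Fi]|nF] := pselect (exists i, F i x).
    by exists i.+1 => -[_]; apply; apply/PE; exists i.
  by exists 0%N => -[[i _ Fi]]; exfalso; apply: nF; exists i.
have [mPn hP] := aP n; have [N [B [dB hB]]] := hP _ e20.
have mB := measurable_determined dB.
exists N, B; split=> //.
have mFP : measurable ((\bigcup_i F i) `\` P n).
  by apply: measurableD => //; exact: bigcupT_measurable.
apply: (@le_lt_trans _ _ (pr mu (((\bigcup_i F i) `\` P n) `|` setdiff (P n) B))).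
  apply: le_pr.
  - by apply: measurable_setdiff => //; exact: bigcupT_measurable.
  - by apply: measurableU => //; exact: measurable_setdiff.
  move=> x [[Fx nB]|[Bx nF]].
    by have [Px|nP] := pselect (P n x); [right; left|left].
  by right; right; split=> // /PE[i _ Fi]; apply: nF; exists i.
apply: le_lt_trans (prU _ _ _) _ => //; first exact: measurable_setdiff.
by rewrite [e]splitr ltrD.
Qed.

(** A countable enumeration of the algebra of unions of cells. *)
Definition coded_set (c : {N : nat & {set N.-tuple bool}}) : set X :=
  [set x | pattern U (tag c) x \in tagged c].

Lemma measurable_coded_set c : measurable (coded_set c).
Proof. exact: (measurable_pattern mU (fun w => w \in tagged c)). Qed.

Lemma coded_set_dense A e : measurable A -> 0 < e ->
  exists c, pr mu (setdiff A (coded_set c)) < e.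
Proof.
move=> /approximable_measurable[_ hA] /hA[N [B [dB hB]]].
pose s : {set N.-tuple bool} := [set w | `[< exists2 x, B x & pattern U N x = w >]]%SET.
exists (Tagged (fun N => {set N.-tuple bool}) s).
rewrite (_ : coded_set _ = B)//; apply/seteqP; split=> x.
  by rewrite /coded_set/= finset.inE => /asboolP[y By e']; exact: dB e' By.
by move=> Bx; rewrite /coded_set/= finset.inE; apply/asboolP; exists x.
Qed.

End separability.

Section separable_subgroups.
Context {disp : measure_display} {X : measurableType disp} {R : realType}.
Context {mu : probability X R}.
Variable T : aut mu.
Notation G := (comfg T).
Notation psi := (@psi disp X R mu T).
Notation len := (@len disp X R mu T).
Implicit Types (S V : G).
Variables (U : nat -> set X) (mU : forall i, measurable (U i)).
Hypothesis measurableE : @measurable disp X = <<s range U >>.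
Hypothesis T_aperiodic : \forall x \ae mu, forall j k, aut_pow T j x = aut_pow T k x -> j = k.

(** The sets commensurated to the half-line are countably many: [seqcomm l] is the
    symmetric difference of the half-line with the finite set [l]. *)
Definition image_is S (l : seq int) : set X :=
  [set x | forall n, seqcomm l (psi S x n) <-> 0 <= n].

Lemma measurable_image_is S l : measurable (image_is S l).
Proof.
apply: measurable_forall => n.
exact: (measurable_psi S n (fun m => seqcomm l m <-> 0 <= n)).
Qed.

Lemma image_is_ex S x : exists l, image_is S l x.
Proof.
have /set_mem/seqcommP[l hl] := valP (psi S x).
exists l => n; rewrite -hl; split=> [[m m0 /(@sym_inj (psi S x)) <-]//|n0].
by exists n.
Qed.

Lemma pr_seqU (I : eqType) (c : seq I) (F : I -> set X) (a : R) :
  (forall i, measurable (F i)) -> (forall i, i \in c -> pr mu (F i) <= a) ->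
  measurable [set x | exists2 i, i \in c & F i x] /\
  pr mu [set x | exists2 i, i \in c & F i x] <= (size c)%:R * a.
Proof.
move=> mF; elim: c => [|i c IH] ha.
  rewrite (_ : mkset _ = set0); first by rewrite pr_set0 mul0r.
  by apply/seteqP; split=> x // [].
have [mc hc] := IH (fun j jc => ha j (mem_behead (s := i :: c) jc)).
rewrite (_ : mkset _ = F i `|` [set x | exists2 i, i \in c & F i x]); last first.
  apply/seteqP; split=> x /=.
    by move=> [j]; rewrite inE => /predU1P[->|jc] Fj; [left|right; exists j].
  by move=> [Fi|[j jc Fj]]; [exists i; rewrite ?mem_head|exists j => //; rewrite inE jc orbT].
split; first exact: measurableU.
rewrite (le_trans (prU _ (mF i) mc))//= -natr1 mulrDl mul1r addrC lerD//.
by apply: ha; rewrite mem_head.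
Qed.

Notation code := {N : nat & {set N.-tuple bool}}.

(** [c] lists images of the half-line that account for all the points [x] up to
    measure [1 / (j + 1)], each with an approximation of the set where it occurs;
    the factor [size c + 1] keeps the total error of the approximations bounded. *)
Definition described S (c : seq (seq int * code)) (j : nat) : Prop :=
  (forall q, q \in c -> pr mu (setdiff (image_is S q.1) (coded_set U q.2)) <=
     (j.+1%:R * (size c).+1%:R)^-1) /\
  pr mu (~` [set x | exists2 q, q \in c & image_is S q.1 x]) < j.+1%:R^-1.

Lemma described_ex S j : exists c, described S c j.
Proof.
have j0 : 0 < (j.+1%:R^-1 : R) by rewrite invr_gt0.
pose A m := ~` [set x | exists2 l : seq int, (pickle l < m)%N & image_is S l x].
have mA m : measurable (A m).
  apply: measurableC.
  rewrite (_ : mkset _ = [set x | exists l, [set _ | (pickle l < m)%N] x /\ image_is S l x]).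
    apply: measurable_exists => l.
    apply: (@measurableI _ _ [set _ : X | (pickle l < m)%N] (image_is S l)).
      exact: (measurable_const (pickle l < m)%N).
    exact: measurable_image_is.
  by apply/seteqP; split=> x [l]; [exists l|move=> [? ?]; exists l].
have [m hm] : exists m, pr mu (A m) < j.+1%:R^-1.
  apply: pr_decr_small => //.
    by move=> m; apply: subsetC => x [l lm Sl]; exists l => //; exact: ltnW.
  apply: aeW => x; have [l hl] := image_is_ex S x.
  by exists (pickle l).+1; apply; exists l.
pose ls : seq (seq int) := pmap unpickle (iota 0 m).
have lsP l : (pickle l < m)%N -> l \in ls.
  move=> lm; rewrite mem_pmap; apply/mapP; exists (pickle l); last by rewrite pickleK.
  by rewrite mem_iota.
have d0 : 0 < ((j.+1%:R * (size ls).+1%:R)^-1 : R) by rewrite invr_gt0 mulr_gt0.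
have [f hf] := choice (fun l => @coded_set_dense _ _ _ mu U mU measurableE (image_is S l) _
  (measurable_image_is S l) d0).
exists [seq (l, f l) | l <- ls]; split.
  by move=> _ /mapP[l _ ->] /=; rewrite size_map; exact/ltW/hf.
apply: le_lt_trans hm; apply: le_pr.
- apply: measurableC.
  have [] := @pr_seqU _ [seq (l, f l) | l <- ls] (fun q => image_is S q.1) 1 => // i.
    exact: measurable_image_is.
  by move=> _; apply: pr_le1; exact: measurable_image_is.
- exact: mA.
- apply: subsetC => x [l lm Sl]; exists (l, f l) => //.
  by apply/mapP; exists l => //; exact: lsP.
Qed.

Lemma described_close S V c j : described S c j -> described V c j ->
  len_dist len S V <= 3 * j.+1%:R^-1.
Proof.
move=> [hS cS] [hV _].
pose F q := setdiff (image_is S q.1) (coded_set U q.2) `|`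
  setdiff (image_is V q.1) (coded_set U q.2).
have mD W q : measurable (setdiff (image_is W q.1) (coded_set U q.2)).
  by apply: measurable_setdiff; [exact: measurable_image_is|exact: measurable_coded_set].
pose a : R := (j.+1%:R * (size c).+1%:R)^-1.
have [||mF hF] := @pr_seqU _ c F (a + a).
- by move=> q; exact: measurableU.
- by move=> q qc; rewrite (le_trans (prU _ _ _))// lerD// ?hS// hV.
have mC : measurable (~` [set x | exists2 q, q \in c & image_is S q.1 x]).
  apply: measurableC.
  have [] := @pr_seqU _ c (fun q => image_is S q.1) 1 => // i.
    exact: measurable_image_is.
  by move=> _; apply: pr_le1; exact: measurable_image_is.
apply: (@le_trans _ _ (pr mu (~` [set x | exists2 q, q \in c & image_is S q.1 x] `|`
    [set x | exists2 q, q \in c & F q x]))).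
  apply: len_le_pr; first exact: measurableU.
  apply: filterS (psi_dist T_aperiodic S V) => x -> h.
  have [[q qc Sq]|nS] := pselect (exists2 q, q \in c & image_is S q.1 x); last by left.
  right; exists q => //; apply: contrapT => /not_orP[n1 n2]; apply: h.
  have cq : coded_set U q.2 x by apply: contrapT => nc; apply: n1; left.
  have Vq : image_is V q.1 x by apply: contrapT => nV; apply: n2; right.
  move=> n; rewrite symM; apply/idP/idP => [/Sq|n0]; first by rewrite symKV => /Vq.
  by apply/Sq; rewrite symKV; exact/Vq.
apply: (le_trans (prU _ _ _)) => //.
have sa : (size c)%:R * a <= j.+1%:R^-1.
  rewrite /a invfM mulrCA ler_piMr ?invr_ge0// ler_pdivrMr// mul1r ler_nat.
  exact: leqnSn.
move: cS hF sa; rewrite mulrDr; move: (pr mu _) (pr mu _) (_ * a) (_^-1) => y1 y2 z i.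
lra.
Qed.

Lemma comfg_separable (H : subgroup G) : metric_separable (len_dist (sub_len len (H := H))).
Proof.
pose pick (p : seq (seq int * code) * nat) : subgroup_type H :=
  xget 1%g [set V : subgroup_type H | described (val V) p.1 p.2].
exists (range pick).
  by apply: (sub_countable (card_image_le pick setT)); exact: countableP.
move=> S e e0.
have [j hj] : exists j : nat, 3 * j.+1%:R^-1 < e.
  exists (Num.truncn (e / 3)^-1).
  rewrite mulrC -ltr_pdivlMr// -[X in _ < X]invrK ltf_pV2 ?posrE ?invr_gt0 ?divr_gt0//.
  exact: truncnS_gt.
have [c hc] := described_ex (val S) j.
exists (pick (c, j)); first by exists (c, j).
rewrite sub_lenE; apply: le_lt_trans hj; apply: described_close (hc) _.
exact: (@xgetPex _ 1%g [set V : subgroup_type H | described (val V) c j] (ex_intro _ S hc)).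
Qed.

End separable_subgroups.

(** * Boundedness *)

Section boundedness.
Context {disp : measure_display} {X : measurableType disp} {R : realType}.
Context {mu : probability X R}.
Variable T : aut mu.
Notation G := (comfg T).
Notation len := (@len disp X R mu T).
Variables (U : nat -> set X) (mU : forall i, measurable (U i)) (sepU : separating U).
Hypotheses (mu_atomless : atomless mu) (T_ergodic : ergodic T).

Let T_aperiodic := aperiodic_inj mU sepU mu_atomless T_ergodic.
Let lenG := comfg_length_group T_aperiodic.

Variable H : subgroup G.
Hypothesis HE : subgroup_set H = closure (derived_subgroup G).

Lemma closed_derived_index_zero S : subgroup_set H S -> index_zero S.
Proof.
rewrite HE => /(closure_len lenG) h.
apply: (index_zero_limit mU sepU mu_atomless T_ergodic) => e /h[V DV SV].
by exists V; split=> //; exact: (derived_index_zero mU sepU mu_atomless T_ergodic).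
Qed.

Lemma closed_derived_comm V W : subgroup_set H [~ V, W]%g.
Proof. by rewrite HE; apply: subset_closure; exact: derived_subgroup_comm. Qed.

Lemma closed_derived_limit V :
  (forall e : R, 0 < e -> exists W, subgroup_set H W /\ len (V^-1 * W)%g < e) ->
  subgroup_set H V.
Proof.
move=> hV; rewrite HE; apply: closed_closure; apply/(closure_len lenG) => e e0.
by have [W [HW VW]] := hV e e0; exists W => //; rewrite -HE.
Qed.

Lemma closed_derived_len_lt1 S : len S < 1 -> subgroup_set H S.
Proof.
exact: (len_lt1_mem mU sepU mu_atomless T_ergodic (subgroupP H)
  closed_derived_comm closed_derived_limit).
Qed.

(** An element [x] of [H] is the product of [W^-1] and [W x], both of length less
    than 1 for a suitable [W]. *)
Lemma closed_derived_bounded_metric (d : subgroup_type H -> subgroup_type H -> R) :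
  compatible_metric d -> left_invariant d -> bounded_metric d.
Proof.
move=> [[d0 dC dT] oE] inv.
have dV x : d 1%g (x^-1)%g = d 1%g x.
  by rewrite -(inv x) mulgV mulg1 dC.
have dM x y : d 1%g (x * y)%g <= d 1%g x + d 1%g y.
  by rewrite (le_trans (dT _ x _))// lerD2l -[X in d X (x * y)%g]mulg1 inv.
(* the length function of [d], extended by 0 to the whole group *)
pose L (V : G) : R := if pselect (subgroup_set H V) is left h
  then d 1%g (exist _ V (mem_set h) : subgroup_type H) else 0.
have LE (x : subgroup_type H) : L (val x) = d 1%g x.
  rewrite /L; case: pselect => [h|]; last by have /set_mem := valP x.
  by congr (d _ _); exact: val_inj.
have LH V : subgroup_set H V -> exists2 x : subgroup_type H, val x = V & L V = d 1%g x.
  by move=> h; exists (exist _ V (mem_set h) : subgroup_type H) => //; rewrite -LE.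
have LM V W : subgroup_set H V -> subgroup_set H W -> L (V * W)%g <= L V + L W.
  by move=> /LH[x <- ->] /LH[y <- ->]; rewrite -sub_valM LE.
have [e e0 he] : exists2 e, 0 < e &
    forall x, len_dist (sub_len len (H := H)) 1%g x < e -> d 1%g x < 1.
  apply/(nbhs_len (sub_length_group lenG H) 1%g [set x | d 1%g x < 1]).
  apply: open_nbhs_nbhs; split; last by rewrite /= (d0 _ _).2.
  rewrite oE => x /= dx; exists (1 - d 1%g x); first by rewrite subr_gt0.
  by move=> y xy; rewrite (le_lt_trans (dT _ x _))// -ltrBrDl.
have L1 V : subgroup_set H V -> len V < e -> L V <= 1.
  move=> /LH[x <- ->] xe; apply/ltW/he.
  by rewrite /len_dist invg1 mul1g.
have [M hM] := len_lt1_bounded mU sepU mu_atomless T_ergodic (subgroupP H)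
  closed_derived_comm closed_derived_limit e0 LM L1.
have bound x : d 1%g x <= M + M.
  have Hx : subgroup_set H (val x) by have /set_mem := valP x.
  have [W [W1 WS]] := index_zero_correction mU sepU mu_atomless T_ergodic
    (closed_derived_index_zero Hx).
  have WV1 : len (W^-1)%g < 1 by rewrite (lenV lenG).
  rewrite -LE (_ : val x = (W^-1 * (W * val x))%g); last by rewrite mulgA mulVg mul1g.
  rewrite (le_trans (LM _ _ _ _))//; try exact: closed_derived_len_lt1.
  by apply: lerD; exact: hM.
exists (M + M) => g h.
by rewrite -(inv g^-1%g) mulVg.
Qed.

End boundedness.

Theorem theorem4p3 (R : realType) (disp : measure_display)
    (X : measurableType disp) (mu : probability X R) (T : aut mu)
    (X_standard : standard_borel R X) (mu_atomless : atomless mu)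
    (T_ergodic : ergodic T) :
  exists H : subgroup (comfg T),
    [/\ subgroup_set H = closure (derived_subgroup (comfg T)),
        polish_group R (subgroup_type H) &
        bounded_group R (subgroup_type H)].
Proof.
have [U [mU sepU measurableE]] := standard_borel_separating mu X_standard.
have T_aperiodic := aperiodic_inj mU sepU mu_atomless T_ergodic.
have lenG := comfg_length_group T_aperiodic.
pose H := Subgroup (closure_subgroup lenG (derived_subgroup_is_subgroup (comfg T))).
have lenH := sub_length_group lenG H.
exists H; split=> //.
- split; first exact: (length_topological_group lenH).
  apply: (length_polish_space lenH); first exact: (comfg_separable mU measurableE T_aperiodic).
  apply: (sub_two_sided_complete lenG); first exact: closed_closure.
  exact: comfg_complete.
- apply: (length_bounded_group lenH (M := 1)) => [x|]; first exact: comfg_len_le1.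
  exact: (closed_derived_bounded_metric mU sepU mu_atomless T_ergodic).
Qed.
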